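(* Let $n\ge3$. A $1$-generic immersion $f:I\to\mathbb{Q}_n$ is a conformal geodesic if and only if $$\frac{d\mu_1}{ds}+\frac32\,\frac{d|X|^2}{ds}=0\qquad\text{and}\qquad \frac{\nabla^2X}{ds^2}-X\big(|X|^2+2\mu_1\big)=0 \quad\text{on } I .$$
   Context: On $\mathbb{R}^{n+2}$ (coordinates $0,\dots,n+1$) take $\langle v,w\rangle=\sum_{A=1}^nv^Aw^A-v^0w^{n+1}-v^{n+1}w^0$; $\mathbb{Q}_n$ is its projectivized null cone and $\mathrm{M\ddot{o}b}(n)$ the identity component of its isometry group. A frame along an immersion $f:I\to\mathbb{Q}_n$ is a smooth $e=(e_0|\dots|e_{n+1})$ from an open subset of $I$ into $\mathrm{M\ddot{o}b}(n)$ with $[e_0]=f$; $\phi=e^{-1}de$, i.e. $de_b=\sum_a\phi^a_be_a$. Indices $2\le\alpha\le n$, $3\le b,c\le n$. Second order frames satisfy $\phi^\alpha_0=\phi^\alpha_1=0$; writing $\phi^0_\alpha=p^\alpha\phi^1_0$, $f$ is 1-generic if $\sum_\alpha(p^\alpha)^2\ne0$ everywhere, and the conformal arclength $ds=(\sum_\alpha(p^\alpha)^2)^{1/4}\phi^1_0$ is frame independent. Special third order frames (which exist locally for 1-generic $f$) are second order frames with $\phi^1_0=\phi^0_2=ds$, $\phi^0_b=0$, $\phi^0_0=0$; any two differ by a rotation of $e_3,\dots,e_n$ by an $SO(n-2)$-valued function. In such a frame write $\phi^0_1=\mu_1ds$ and $\phi^b_2=q^bds$; the function $\mu_1$ and the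 section $X=\sum_bq^be_b$ of the bundle $\Theta=\mathrm{span}\{e_3,\dots,e_n\}$ are frame independent. $\Theta$ has the metric making $\{e_b\}$ orthonormal (norm $|\cdot|$) and connection $\nabla e_b=\sum_c\phi^c_be_c$; $\nabla X/ds$, $\nabla^2X/ds^2$ are covariant derivatives along $d/ds$. A 1-generic $f$ is a conformal geodesic if for every compact subinterval $D\subset I$ and every smooth variation $f_t$ ($|t|<\varepsilon$) through immersions with $f_0=f$ and $f_t=f$ outside a compact subset of the interior of $D$, one has $\frac{d}{dt}\big|_{t=0}\int_D ds_t=0$, $ds_t$ being the conformal arclength of $f_t$. *)

(* Defs.v *)
From HB Require Import structures.
From mathcomp Require Import all_boot all_order all_algebra.
From mathcomp Require Import all_classical all_reals all_analysis.
Set Implicit Arguments. Unset Strict Implicit. Unset Printing Implicit Defensive.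
Import Order.TTheory GRing.Theory Num.Theory.
Import numFieldNormedType.Exports.
Local Open Scope classical_set_scope.
Local Open Scope ring_scope.

(* Coordinates of R^{n+2} are indexed by 'I_(n.+2) = {0,...,n+1}; vectors are
   column vectors 'cV[R]_(n.+2); a frame (e_0|...|e_{n+1}) is a matrix whose
   b-th column is e_b. *)
Section ConformalCurves.
Variables (R : realType) (n : nat).

Definition idx (k : nat) : 'I_(n.+2) := inord k.

Definition mink (v w : 'cV[R]_(n.+2)) : R :=
  \sum_(i < n.+2 | (1 <= i <= n)%N) v i 0 * w i 0
  - v (idx 0) 0 * w (idx n.+1) 0 - v (idx n.+1) 0 * w (idx 0) 0.

(* the timelike vector e_0 + e_{n+1} (<T,T> = -2), used for time orientation *)
Definition Tvec : 'cV[R]_(n.+2) :=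
  \col_i (if (i == idx 0) || (i == idx n.+1) then 1 else 0).

(* Mob(n) = identity component SO^+(n+1,1) of the isometry group of < , >:
   isometries with determinant 1 preserving the time orientation. *)
Definition mob (A : 'M[R]_(n.+2)) : Prop :=
  [/\ forall v w, mink (A *m v) (A *m w) = mink v w,
      \det A = 1 & mink (A *m Tvec) Tvec < 0].

Definition smooth1 (U : set R) (g : R -> R) : Prop :=
  forall (k : nat) (x : R), U x -> derivable (iter k (@derive1 R R) g) x 1.

Definition dmx {m p : nat} (e : R -> 'M[R]_(m, p)) (x : R) : 'M[R]_(m, p) :=
  \matrix_(i, j) derive1 (fun y => e y i j) x.

Definition smoothmx {m p : nat} (U : set R) (e : R -> 'M[R]_(m, p)) : Prop :=
  forall i j, smooth1 U (fun y => e y i j).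

(* An immersion f : I -> Q_n is represented by a smooth lift F : I -> R^{n+2}
   into the null cone minus 0 (f = [F]); f is an immersion iff F, F' are
   linearly independent. *)
Definition lift_immersion (I : set R) (F : R -> 'cV[R]_(n.+2)) : Prop :=
  smoothmx I F /\
  forall x, I x -> [/\ F x != 0, mink (F x) (F x) = 0 &
     forall a b : R, a *: F x + b *: dmx F x = 0 -> a = 0 /\ b = 0].

Definition frame (I : set R) (F : R -> 'cV[R]_(n.+2)) (J : set R)
    (e : R -> 'M[R]_(n.+2)) : Prop :=
  [/\ open J, J `<=` I, smoothmx J e &
      forall x, J x -> mob (e x) /\
        exists c : R, c != 0 /\ col (idx 0) (e x) = c *: F x].

(* phi = e^{-1} de evaluated on d/dx : de_b = sum_a phi^a_b e_a *)
Definition phi (e : R -> 'M[R]_(n.+2)) (x : R) : 'M[R]_(n.+2) :=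
  invmx (e x) *m dmx e x.

Definition second_order (I : set R) (F : R -> 'cV[R]_(n.+2)) (J : set R)
    (e : R -> 'M[R]_(n.+2)) : Prop :=
  frame I F J e /\
  forall x, J x -> forall a : 'I_(n.+2), (2 <= a <= n)%N ->
     phi e x a (idx 0) = 0 /\ phi e x a (idx 1) = 0.

(* sum_alpha (p^alpha)^2, where phi^0_alpha = p^alpha phi^1_0 *)
Definition psq (e : R -> 'M[R]_(n.+2)) (x : R) : R :=
  \sum_(a < n.+2 | (2 <= a <= n)%N)
     (phi e x (idx 0) a / phi e x (idx 1) (idx 0)) ^+ 2.

(* density of the (positively oriented) conformal arclength w.r.t. dx *)
Definition dens (e : R -> 'M[R]_(n.+2)) (x : R) : R :=
  Num.sqrt (Num.sqrt (psq e x)) * `|phi e x (idx 1) (idx 0)|.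

Definition one_generic (I : set R) (F : R -> 'cV[R]_(n.+2)) : Prop :=
  [/\ lift_immersion I F,
      forall x, I x -> exists J e, second_order I F J e /\ J x &
      forall J e x, second_order I F J e -> J x -> psq e x != 0].

(* conformal arclength density ds/dx of f = [F] at x (frame independent) *)
Definition cds (I : set R) (F : R -> 'cV[R]_(n.+2)) (x : R) : R :=
  xget 0 [set r | exists J e, second_order I F J e /\ J x /\ r = dens e x].

Definition special_third (I : set R) (F : R -> 'cV[R]_(n.+2)) (J : set R)
    (e : R -> 'M[R]_(n.+2)) : Prop :=
  second_order I F J e /\
  forall x, J x -> [/\ phi e x (idx 1) (idx 0) = cds I F x,
                       phi e x (idx 0) (idx 2) = cds I F x,
                       phi e x (idx 0) (idx 0) = 0 &
                       forall b : 'I_(n.+2), (3 <= b <= n)%N ->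
                         phi e x (idx 0) b = 0].

Definition mu1 I F e (y : R) : R := phi e y (idx 0) (idx 1) / cds I F y.
Definition qX I F e (b : 'I_(n.+2)) (y : R) : R := phi e y b (idx 2) / cds I F y.
Definition Xnorm2 I F e (y : R) : R :=
  \sum_(b < n.+2 | (3 <= b <= n)%N) (qX I F e b y) ^+ 2.
Definition dds I F (h : R -> R) (x : R) : R := derive1 h x / cds I F x.
(* covariant derivative nabla/ds on Theta, in the coordinates w.r.t. e_3..e_n *)
Definition covd I F e (s : 'I_(n.+2) -> R -> R) : 'I_(n.+2) -> R -> R :=
  fun c y => (derive1 (s c) y
              + \sum_(b < n.+2 | (3 <= b <= n)%N) s b y * phi e y c b)
             / cds I F y.
Definition sect (e : R -> 'M[R]_(n.+2)) (s : 'I_(n.+2) -> R -> R) (y : R)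
  : 'cV[R]_(n.+2) :=
  \sum_(b < n.+2 | (3 <= b <= n)%N) s b y *: col b (e y).

Definition pdiff (b : bool) (g : R -> R -> R) : R -> R -> R :=
  fun t x => if b then derive1 (fun s => g s x) t else derive1 (fun y => g t y) x.

Definition smooth2 (U : set (R * R)) (g : R -> R -> R) : Prop :=
  forall w : seq bool,
    {within U, continuous (fun p : R * R => foldr pdiff g w p.1 p.2)} /\
    forall p : R * R, U p ->
      derivable (fun s => foldr pdiff g w s p.2) p.1 1 /\
      derivable (fun y => foldr pdiff g w p.1 y) p.2 1.

Definition conformal_geodesic (I : set R) (F : R -> 'cV[R]_(n.+2)) : Prop :=
  forall (a b : R), a <= b -> [set` `[a, b]] `<=` I ->
  forall (eps : R) (V : R -> R -> 'cV[R]_(n.+2)) (K : set R),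
    0 < eps -> compact K -> K `<=` [set` `]a, b[] ->
    (forall i j, smooth2 ([set` `]- eps, eps[] `*` I) (fun t x => V t x i j)) ->
    (forall t, - eps < t < eps -> lift_immersion I (V t)) ->
    (forall x, I x -> exists c : R, c != 0 /\ V 0 x = c *: F x) ->
    (forall t x, - eps < t < eps -> I x -> ~ K x ->
        exists c : R, c != 0 /\ V t x = c *: F x) ->
    is_derive (0 : R) (1 : R)
      (fun t => Rintegral lebesgue_measure [set` `[a, b]] (cds I (V t))) 0.

End ConformalCurves.

(* Main.v *)
(** Let H0 be a multiple of the lift F and put H_{i+1} = H_i' / s for a positive function s.
    Computing in a second order frame, the arclength density of F is
    s D^(1/4) / <H1, H1>, where D is minus the Gram determinant of H0, ..., H3; in particular it is
    smooth in F and in parameters. Normalizing the lift e0 by |e0'| = ds and differentiating with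
    respect to arclength gives globally defined vectors with
      e0' = e1,  e1' = mu e0 + en,  en' = mu e1 + e2,  e2' = e0 + X,
    where mu is mu_1 and X the section of the statement. For a variation W of e0, the derivative of
    the density is a total derivative plus (s / 2) <EL, W>, where EL = - X'' + mu' e2 + 2 mu X.
    Since <e0, W> = 0, only EL modulo e0 matters, and in a special third order frame
      EL = - (nabla^2 X - (|X|^2 + 2 mu) X) + (mu' + 3/2 (|X|^2)') e2 + |X|^2 e0,
    which shows that the equations are sufficient. Conversely, rotating F by the null rotation in
    the directions en(x0), ei(x0), with a bump function as angle, is an admissible variation whose
    W at x0 is a multiple of ei(x0); this isolates each component of EL. *)

Require Import Defs.
From HB Require Import structures.
From mathcomp Require Import all_boot all_order all_algebra.
From mathcomp Require Import all_classical all_reals all_analysis.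
From mathcomp Require Import ring lra.
Set Implicit Arguments.
Unset Strict Implicit.
Unset Printing Implicit Defensive.
Import Order.TTheory GRing.Theory Num.Theory.
Import numFieldNormedType.Exports.
Local Open Scope classical_set_scope.
Local Open Scope ring_scope.

(** * Smooth functions of one variable *)

Section OneVariable.
Variable R : realType.
Implicit Types (U : set R) (f g h : R -> R) (x y a b : R).

(** Two obstacles shape the proof. The density [cds] is picked by [xget] among the densities of
    local frames, and the integral defining a conformal geodesic runs over a segment that need not
    lie in the domain of a single special frame. Hence the preference for frame-free data: the Gram
    determinant gives the density of every varied curve without frames depending on the parameter,
    and second order frames of varied curves serve only to make the set behind [xget] nonempty. All
    normalizations concern the base curve alone: the factor of the lift and the function s stay
    those of t = 0 along the whole variation, which is legitimate because the density formula holds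
    for any lift and any positive s. The varied curves are immersions but perhaps not 1-generic;
    since D = 1 at t = 0, compactness keeps D positive over the segment for small t, and there the
    fourth root is smooth. Special frames return only pointwise, where EL is compared with the two
    equations. *)

Lemma is_derive1D f g x a b : is_derive x 1 f a -> is_derive x 1 g b ->
  is_derive x (1 : R) (fun y => f y + g y) (a + b).
Proof. by move=> fa gb; exact: (is_deriveD fa gb). Qed.

Lemma is_derive1N f x a : is_derive x 1 f a ->
  is_derive x (1 : R) (fun y => - f y) (- a).
Proof. by move=> fa; exact: (is_deriveN fa). Qed.

Lemma is_derive1B f g x a b : is_derive x 1 f a -> is_derive x 1 g b ->
  is_derive x (1 : R) (fun y => f y - g y) (a - b).
Proof. by move=> fa gb; exact: (is_deriveB fa gb). Qed.

Lemma is_derive1M f g x a b : is_derive x 1 f a -> is_derive x 1 g b ->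
  is_derive x (1 : R) (fun y => f y * g y) (a * g x + f x * b).
Proof.
move=> fa gb; apply: (is_derive_eq (is_deriveM fa gb)).
by rewrite /GRing.scale /= addrC mulrC.
Qed.

Lemma is_derive1V f x a : f x != 0 -> is_derive x 1 f a ->
  is_derive x (1 : R) (fun y => (f y)^-1) (- a / f x ^+ 2).
Proof.
move=> f0 fa; apply: (is_derive_eq (is_deriveV f0 fa)).
by rewrite /GRing.scale /= mulNr mulrC -mulNr.
Qed.

Lemma is_derive1_sqrt_comp f x a : 0 < f x -> is_derive x 1 f a ->
  is_derive x (1 : R) (fun y => Num.sqrt (f y)) (a / (2 * Num.sqrt (f x))).
Proof.
move=> f0 fa.
have sf := is_derive1_sqrt f0.
by apply: (is_derive_eq (is_derive1_comp sf fa)); rewrite mulrC.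
Qed.

Lemma is_derive1_cst (c x : R) : is_derive x (1 : R) (fun=> c) 0.
Proof. exact: is_derive_cst. Qed.

Lemma is_derive1_id x : is_derive x (1 : R) (fun y => y) 1.
Proof. exact: is_derive_id. Qed.

Lemma is_derive1_sum (T : Type) (r : seq T) (P : pred T) (h : T -> R -> R)
    (d : T -> R) x : (forall i, P i -> is_derive x 1 (h i) (d i)) ->
  is_derive x (1 : R) (fun y => \sum_(i <- r | P i) h i y) (\sum_(i <- r | P i) d i).
Proof.
move=> hd; elim: r => [|i r IH].
  rewrite big_nil; under eq_fun do rewrite big_nil.
  exact: is_derive1_cst.
rewrite big_cons; under eq_fun do rewrite big_cons.
by case: ifP => // Pi; apply: is_derive1D => //; exact: hd.
Qed.

Lemma is_derive1_derive1 f x a : is_derive x 1 f a -> derive1 f x = a.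
Proof. by move=> fa; rewrite derive1E derive_val. Qed.

Lemma is_derive1_unique f x a b :
  is_derive x 1 f a -> is_derive x 1 f b -> a = b.
Proof. by move=> /is_derive1_derive1 <- /is_derive1_derive1. Qed.

Lemma derivable_is_derive1 f x : derivable f x 1 -> is_derive x (1 : R) f (derive1 f x).
Proof. by move=> fx; rewrite derive1E; exact: derivableP. Qed.

Lemma is_derive1_derivable f x a : is_derive x 1 f a -> derivable f x 1.
Proof. by case. Qed.

Lemma near_open (T : topologicalType) (U : set T) (P : T -> Prop) (z : T) : open U -> U z ->
  (forall t, U t -> P t) -> \forall t \near z, P t.
Proof.
by move=> oU Uz UP; apply: filterS (open_nbhs_nbhs (conj oU Uz)).
Qed.

Lemma is_derive1_ext U f g x a : open U -> U x -> (forall y, U y -> f y = g y) ->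
  is_derive x 1 f a -> is_derive x (1 : R) g a.
Proof. by move=> oU Ux fg; apply: near_eq_is_derive; exact: near_open fg. Qed.

Lemma derive1_ext U f g x : open U -> U x -> (forall y, U y -> f y = g y) ->
  derive1 f x = derive1 g x.
Proof. by move=> oU Ux fg; rewrite !derive1E; apply: near_eq_derive; exact: near_open fg. Qed.

Lemma derivable_ext U f g x : open U -> U x -> (forall y, U y -> f y = g y) ->
  derivable f x 1 -> derivable g x 1.
Proof. by move=> oU Ux fg; apply: near_eq_derivable; exact: near_open fg. Qed.

Lemma is_derive1_continuous f x a : is_derive x 1 f a -> {for x, continuous f}.
Proof.
by move=> /is_derive1_derivable/derivable1_diffP/differentiable_continuous.
Qed.

(** Differentiability of order k+1, by recursion on the derivative rather than through [iter]: this
    is the form in which the rules for products, inverses and roots can be proved by induction on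
    the order. *)
Fixpoint diffk (k : nat) (U : set R) (f : R -> R) : Prop :=
  (forall x, U x -> derivable f x 1) /\
  (if k is k'.+1 then diffk k' U (derive1 f) else True).

Lemma diffkW k U f : diffk k.+1 U f -> diffk k U f.
Proof.
elim: k f => [|k IH] f; first by case=> ? _; split.
by case=> ? H; split => //; exact: IH.
Qed.

Lemma smooth1_diffk U f : smooth1 U f <-> forall k, diffk k U f.
Proof.
split=> [sf k|Hf k].
  elim: k f sf => [|k IH] f sf; first by split => // x Ux; exact: (sf 0%N x Ux).
  split; first by move=> x Ux; exact: (sf 0%N x Ux).
  by apply: IH => j x Ux; rewrite -iterSr; exact: sf.
elim: k f Hf => [|k IH] f Hf x Ux; first by case: (Hf 0%N) => df _; exact: df.
by rewrite iterSr; apply: IH => // j; case: (Hf j.+1).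
Qed.

Lemma smooth1_is_derive1 U f x : smooth1 U f -> U x -> is_derive x (1 : R) f (derive1 f x).
Proof. by move=> sf Ux; apply: derivable_is_derive1; exact: (sf 0%N x Ux). Qed.

Lemma smooth1_derive1 U f : smooth1 U f -> smooth1 U (derive1 f).
Proof. by move=> sf k x Ux; rewrite -iterSr; exact: sf. Qed.

Lemma smooth1_continuous U f x : smooth1 U f -> U x -> {for x, continuous f}.
Proof. by move=> sf Ux; exact: is_derive1_continuous (smooth1_is_derive1 sf Ux). Qed.

Lemma smooth1_subset U V f : V `<=` U -> smooth1 U f -> smooth1 V f.
Proof. by move=> VU sf k x Vx; exact: sf (VU _ Vx). Qed.

Section OpenDomain.
Variables (U : set R) (oU : open U).

Lemma diffk_ext k f g : (forall x, U x -> f x = g x) -> diffk k U f -> diffk k U g.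
Proof.
elim: k f g => [|k IH] f g fg [df Hf]; split; try by move=> x Ux; apply: (derivable_ext oU Ux fg); exact: df.
  exact: I.
by apply: IH Hf => x Ux; exact: (derive1_ext oU Ux fg).
Qed.

Lemma diffk_cst k (c : R) : diffk k U (fun=> c).
Proof.
elim: k c => [|k IH] c; split; try by move=> x _; exact: is_derive1_derivable (is_derive1_cst _ _).
  exact: I.
by apply: diffk_ext (IH 0) => x Ux; rewrite (is_derive1_derive1 (is_derive1_cst c x)).
Qed.

Lemma diffkD k f g : diffk k U f -> diffk k U g -> diffk k U (fun x => f x + g x).
Proof.
have H f' g' x (df : derivable f' x 1) (dg : derivable g' x 1) :=
  is_derive1D (derivable_is_derive1 df) (derivable_is_derive1 dg).
elim: k f g => [|k IH] f g [df Hf] [dg Hg];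
  (split=> [x Ux|]; first exact: is_derive1_derivable (H _ _ _ (df x Ux) (dg x Ux))); first exact: I.
apply: diffk_ext (IH _ _ Hf Hg) => x Ux; exact: esym (is_derive1_derive1 (H _ _ _ (df x Ux) (dg x Ux))).
Qed.

(** In f' g + f g' each derivative is regular to one order less than its partner; [diffkW] lowers
    the partner, so that the induction hypothesis applies to both products. *)
Lemma diffkM k f g : diffk k U f -> diffk k U g -> diffk k U (fun x => f x * g x).
Proof.
have H f' g' x (df : derivable f' x 1) (dg : derivable g' x 1) :=
  is_derive1M (derivable_is_derive1 df) (derivable_is_derive1 dg).
elim: k f g => [|k IH] f g Hf Hg; have [df Hf'] := Hf; have [dg Hg'] := Hg;
  (split=> [x Ux|]; first exact: is_derive1_derivable (H _ _ _ (df x Ux) (dg x Ux))); first exact: I.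
apply: diffk_ext (diffkD (IH _ _ Hf' (diffkW Hg)) (IH _ _ (diffkW Hf) Hg')) => x Ux.
exact: esym (is_derive1_derive1 (H _ _ _ (df x Ux) (dg x Ux))).
Qed.

Lemma diffkV k f : (forall x, U x -> f x != 0) -> diffk k U f -> diffk k U (fun x => (f x)^-1).
Proof.
move=> f0; have H x (Ux : U x) df := is_derive1V (f0 _ Ux) (@derivable_is_derive1 f x df).
elim: k => [|k IH] Hf; have [df Hf'] := Hf;
  (split=> [x Ux|]; first exact: is_derive1_derivable (H _ Ux (df x Ux))); first exact: I.
(* The derivative is a product of f' and of the inverse itself, so the induction hypothesis for the
   inverse closes the argument. The same device serves for the square root. *)
apply: (@diffk_ext _ (fun x => ((-1) * derive1 f x) * ((f x)^-1 * (f x)^-1))) => [x Ux|].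
  by rewrite (is_derive1_derive1 (H _ Ux (df x Ux))) mulN1r expr2 invfM.
have Hi := IH (diffkW Hf).
by apply: diffkM; apply: diffkM; [exact: diffk_cst|exact: Hf'|exact: Hi|exact: Hi].
Qed.

Lemma diffk_sqrt k f : (forall x, U x -> 0 < f x) -> diffk k U f -> diffk k U (fun x => Num.sqrt (f x)).
Proof.
move=> f0; have H x (Ux : U x) df := is_derive1_sqrt_comp (f0 _ Ux) (@derivable_is_derive1 f x df).
elim: k => [|k IH] Hf; have [df Hf'] := Hf;
  (split=> [x Ux|]; first exact: is_derive1_derivable (H _ Ux (df x Ux))); first exact: I.
apply: (@diffk_ext _ (fun x => derive1 f x * (2 * Num.sqrt (f x))^-1)) => [x Ux|].
  exact: esym (is_derive1_derive1 (H _ Ux (df x Ux))).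
apply: diffkM; first exact: Hf'.
apply: diffkV => [x Ux|]; first by rewrite mulf_neq0 ?pnatr_eq0// sqrtr_eq0 -ltNge f0.
by apply: diffkM; [exact: diffk_cst|exact: IH (diffkW Hf)].
Qed.

Lemma smooth1_ext f g : (forall x, U x -> f x = g x) -> smooth1 U f -> smooth1 U g.
Proof. by move=> fg /smooth1_diffk Hf; apply/smooth1_diffk => k; exact: diffk_ext fg _. Qed.

Lemma smooth1_cst (c : R) : smooth1 U (fun=> c).
Proof. by apply/smooth1_diffk => k; exact: diffk_cst. Qed.

Lemma smooth1D f g : smooth1 U f -> smooth1 U g -> smooth1 U (fun x => f x + g x).
Proof. by move=> /smooth1_diffk Hf /smooth1_diffk Hg; apply/smooth1_diffk => k; exact: diffkD. Qed.

Lemma smooth1M f g : smooth1 U f -> smooth1 U g -> smooth1 U (fun x => f x * g x).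
Proof. by move=> /smooth1_diffk Hf /smooth1_diffk Hg; apply/smooth1_diffk => k; exact: diffkM. Qed.

Lemma smooth1N f : smooth1 U f -> smooth1 U (fun x => - f x).
Proof.
move=> sf; apply: (@smooth1_ext (fun x => (-1) * f x)) => [x _|]; first by rewrite mulN1r.
by apply: smooth1M; [exact: smooth1_cst|exact: sf].
Qed.

Lemma smooth1B f g : smooth1 U f -> smooth1 U g -> smooth1 U (fun x => f x - g x).
Proof. by move=> sf sg; apply: smooth1D; [exact: sf|exact: smooth1N]. Qed.

Lemma smooth1V f : (forall x, U x -> f x != 0) -> smooth1 U f -> smooth1 U (fun x => (f x)^-1).
Proof. by move=> f0 /smooth1_diffk Hf; apply/smooth1_diffk => k; exact: diffkV. Qed.

Lemma smooth1_sqrt f : (forall x, U x -> 0 < f x) -> smooth1 U f ->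
  smooth1 U (fun x => Num.sqrt (f x)).
Proof. by move=> f0 /smooth1_diffk Hf; apply/smooth1_diffk => k; exact: diffk_sqrt. Qed.

Lemma smooth1_sum (T : Type) (r : seq T) (P : pred T) (h : T -> R -> R) :
  (forall i, P i -> smooth1 U (h i)) -> smooth1 U (fun x => \sum_(i <- r | P i) h i x).
Proof.
move=> Hh; elim: r => [|i r IH].
  by apply: (@smooth1_ext (fun=> 0) _ _ (@smooth1_cst 0)) => x _; rewrite big_nil.
case Pi: (P i); last by apply: (smooth1_ext _ IH) => x _; rewrite big_cons Pi.
by apply: (smooth1_ext _ (smooth1D (Hh _ Pi) IH)) => x _; rewrite big_cons Pi.
Qed.

Lemma smooth1_prod (T : Type) (r : seq T) (P : pred T) (h : T -> R -> R) :
  (forall i, P i -> smooth1 U (h i)) -> smooth1 U (fun x => \prod_(i <- r | P i) h i x).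
Proof.
move=> Hh; elim: r => [|i r IH].
  by apply: (@smooth1_ext (fun=> 1) _ _ (@smooth1_cst 1)) => x _; rewrite big_nil.
case Pi: (P i); last by apply: (smooth1_ext _ IH) => x _; rewrite big_cons Pi.
by apply: (smooth1_ext _ (smooth1M (Hh _ Pi) IH)) => x _; rewrite big_cons Pi.
Qed.

End OpenDomain.
End OneVariable.

(** * The Minkowski form and its isometries *)

Section Mink.
Variables (R : realType) (n : nat).
Local Notation V := 'cV[R]_(n.+2).
Local Notation ix := (@idx n).
Implicit Types (u v w z : V) (a b : R).

Lemma minkC v w : mink v w = mink w v.
Proof.
rewrite /mink; under eq_bigr do rewrite mulrC.
by rewrite -!addrA -!opprD [v (ix 0) 0 * _]mulrC [v (ix n.+1) 0 * _]mulrC [X in _ - X = _]addrC.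
Qed.

Lemma minkDl u v w : mink (u + v) w = mink u w + mink v w.
Proof.
rewrite /mink; under eq_bigr do rewrite !mxE mulrDl.
by rewrite big_split /= !mxE; ring.
Qed.

Lemma minkZl a v w : mink (a *: v) w = a * mink v w.
Proof.
rewrite /mink; under eq_bigr do rewrite !mxE -mulrA.
by rewrite -mulr_sumr !mxE; ring.
Qed.

Lemma minkDr u v w : mink u (v + w) = mink u v + mink u w.
Proof. by rewrite minkC minkDl !(minkC u). Qed.

Lemma minkZr a v w : mink v (a *: w) = a * mink v w.
Proof. by rewrite minkC minkZl minkC. Qed.

Lemma minkNl v w : mink (- v) w = - mink v w.
Proof. by rewrite -scaleN1r minkZl mulN1r. Qed.

Lemma minkNr v w : mink v (- w) = - mink v w.
Proof. by rewrite minkC minkNl minkC. Qed.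

Lemma mink0l w : mink 0 w = 0.
Proof. by rewrite -(scale0r 0) minkZl mul0r. Qed.

Lemma mink0r w : mink w 0 = 0.
Proof. by rewrite minkC mink0l. Qed.

Definition minkE := (minkDl, minkDr, minkNl, minkNr, minkZl, minkZr).

Lemma mink_suml (T : Type) (r : seq T) (P : pred T) (f : T -> V) w :
  mink (\sum_(i <- r | P i) f i) w = \sum_(i <- r | P i) mink (f i) w.
Proof.
elim: r => [|i r IH]; first by rewrite !big_nil mink0l.
by rewrite !big_cons; case: (P i); rewrite ?minkDl IH.
Qed.

Lemma mink_sumr (T : Type) (r : seq T) (P : pred T) (f : T -> V) w :
  mink w (\sum_(i <- r | P i) f i) = \sum_(i <- r | P i) mink w (f i).
Proof. by rewrite minkC mink_suml; under eq_bigr do rewrite minkC. Qed.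

Lemma val_ix k : (k <= n.+1)%N -> ix k = k :> nat.
Proof. by move=> kn; rewrite /idx inordK. Qed.

Lemma eq_ix k (i : 'I_n.+2) : (k <= n.+1)%N -> (i == ix k) = (i == k :> nat).
Proof. by move=> kn; rewrite -val_eqE /= val_ix. Qed.

Lemma idxK (i : 'I_n.+2) : ix i = i.
Proof. by apply/val_inj; rewrite /= val_ix // -ltnS. Qed.

Definition bvec (i : 'I_n.+2) : V := delta_mx i 0.

Lemma col_mul_bvec (A : 'M[R]_(n.+2)) i : col i A = A *m bvec i.
Proof. exact: colE. Qed.

Lemma bvecE i j : bvec i j 0 = (j == i)%:R.
Proof. by rewrite mxE eqxx andbT. Qed.

Lemma mink_bvec0 w : mink (bvec (ix 0)) w = - w (ix n.+1) 0.
Proof.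
rewrite /mink big1 ?add0r => [|i /andP[i1 _]].
  by rewrite !bvecE eqxx eq_ix // val_ix //= mul0r subr0 mul1r.
by rewrite bvecE eq_ix //; case: (i : nat) i1 => //= m _; rewrite mul0r.
Qed.

Lemma mink_bvecn1 w : mink (bvec (ix n.+1)) w = - w (ix 0) 0.
Proof.
rewrite /mink big1 ?add0r => [|i /andP[_ i1]].
  by rewrite !bvecE eqxx eq_ix // val_ix //= mul0r oppr0 mul1r add0r.
by rewrite bvecE eq_ix //= ltn_eqF ?mul0r.
Qed.

Lemma mink_bvec_mid (i : 'I_n.+2) w : (1 <= i <= n)%N -> mink (bvec i) w = w i 0.
Proof.
move=> i1n; rewrite /mink (bigD1 i) //= big1 => [|j /andP[_ ji]].
  rewrite !bvecE eqxx mul1r addr0 ![_ == i]eq_sym !eq_ix //.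
  by case/andP: i1n; case: (i : nat) => // m _ mn; rewrite eqSS (@ltn_eqF m n) ?mul0r ?subr0.
by rewrite bvecE (negbTE ji) mul0r.
Qed.

Lemma ix_cases (P : 'I_n.+2 -> Prop) : P (ix 0) -> P (ix n.+1) ->
  (forall i : 'I_n.+2, (1 <= i <= n)%N -> P i) -> forall i, P i.
Proof.
move=> P0 Pn Pm i.
have [i0|i0] := eqVneq (i : nat) 0%N; first by rewrite -(idxK i) i0.
have [i1|i1] := eqVneq (i : nat) n.+1; first by rewrite -(idxK i) i1.
apply: Pm; rewrite lt0n i0 /=.
by rewrite -ltnS ltn_neqAle i1 -ltnS /=.
Qed.

Lemma mink_nondegenerate v : (forall w, mink v w = 0) -> v = 0.
Proof.
move=> v0; apply/matrixP => i j; rewrite ord1 mxE {j}.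
move: i; apply: ix_cases.
- by have := v0 (bvec (ix n.+1)); rewrite minkC mink_bvecn1 => /eqP; rewrite oppr_eq0 => /eqP.
- by have := v0 (bvec (ix 0)); rewrite minkC mink_bvec0 => /eqP; rewrite oppr_eq0 => /eqP.
- by move=> i i1n; have := v0 (bvec i); rewrite minkC mink_bvec_mid.
Qed.

Lemma cvec_bvec v : v = \sum_i v i 0 *: bvec i.
Proof.
apply/matrixP => i j; rewrite ord1 summxE (bigD1 i) //= big1.
  by rewrite mxE bvecE eqxx mulr1 addr0.
by move=> k ki; rewrite mxE bvecE eq_sym (negbTE ki) mulr0.
Qed.

Definition isometry (A : 'M[R]_(n.+2)) := forall v w, mink (A *m v) (A *m w) = mink v w.

Definition gram : 'M[R]_(n.+2) := \matrix_(i, j) mink (bvec i) (bvec j).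

Lemma mink_gram v w : mink v w = (v^T *m gram *m w) 0 0.
Proof.
rewrite {1}(cvec_bvec v) {1}(cvec_bvec w) mink_suml.
under eq_bigr do rewrite minkZl mink_sumr.
rewrite -mulmxA mxE; apply: eq_bigr => i _; rewrite !mxE; congr (_ * _).
by apply: eq_bigr => j _; rewrite minkZr mxE mulrC.
Qed.

Lemma mulmx_inj_unit (A : 'M[R]_(n.+2)) : (forall v : V, A *m v = 0 -> v = 0) -> A \in unitmx.
Proof.
move=> Ai; rewrite -unitmx_tr -row_free_unit; apply/row_freeP.
apply/row_freeP; rewrite -kermx_eq0; apply/eqP/row_matrixP => i; rewrite row0.
have : row i (kermx A^T) *m A^T = 0 by apply/sub_kermxP; exact: row_sub.
move=> /(congr1 trmx); rewrite trmx_mul trmxK trmx0 => /Ai /(congr1 trmx).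
by rewrite trmxK trmx0.
Qed.

Lemma gram_unit : gram \in unitmx.
Proof.
apply: mulmx_inj_unit => v Gv; apply: mink_nondegenerate => w.
by rewrite minkC mink_gram -mulmxA Gv mulmx0 mxE.
Qed.

Lemma isometry_unit A : isometry A -> A \in unitmx.
Proof.
move=> iA; apply: mulmx_inj_unit => v Av; apply: mink_nondegenerate => w.
by rewrite -iA Av mink0l.
Qed.

(** Take determinants in A^T G A = G, where the Gram matrix G is invertible. *)
Lemma isometry_det A : isometry A -> \det A * \det A = 1.
Proof.
move=> iA; have E : A^T *m gram *m A = gram.
  apply/matrixP => i j.
  have -> : (A^T *m gram *m A) i j = mink (A *m bvec i) (A *m bvec j).
    have H (M : 'M[R]_(n.+2)) : M i j = ((bvec i)^T *m M *m bvec j) 0 0.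
      by rewrite trmx_delta -rowE -colE !mxE.
    by rewrite H mink_gram trmx_mul !mulmxA.
  by rewrite iA mxE.
have := congr1 determinant E; rewrite !det_mulmx det_tr => {}E.
have G0 : \det gram != 0 by have := gram_unit; rewrite unitmxE unitfE.
by apply: (mulIf G0); rewrite mul1r -{2}E; ring.
Qed.

Lemma isometryM A B : isometry A -> isometry B -> isometry (A *m B).
Proof. by move=> iA iB v w; rewrite -!mulmxA iA iB. Qed.

Lemma isometry1 : isometry 1%:M.
Proof. by move=> v w; rewrite !mul1mx. Qed.

Lemma TvecE : Tvec R n = bvec (ix 0) + bvec (ix n.+1).
Proof.
apply/matrixP => i j; rewrite ord1 !mxE eqxx !andbT.
case: eqVneq => [->|_] /=; last by case: eqP; rewrite ?add0r.
by rewrite eq_ix // val_ix //= addr0.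
Qed.

Lemma mink_Tvec v : mink v (Tvec R n) = - (v (ix 0) 0 + v (ix n.+1) 0).
Proof. by rewrite TvecE minkDr !(minkC v) mink_bvec0 mink_bvecn1 opprD addrC. Qed.

Lemma mink_sqr v : mink v v = \sum_(i < n.+2 | (1 <= i <= n)%N) (v i 0) ^+ 2
   - 2 * (v (ix 0) 0 * v (ix n.+1) 0).
Proof. by rewrite /mink; under eq_bigr do rewrite -expr2; ring. Qed.

Lemma sumsq_ge0 v : 0 <= \sum_(i < n.+2 | (1 <= i <= n)%N) (v i 0) ^+ 2.
Proof. by apply: sumr_ge0 => i _; exact: sqr_ge0. Qed.

(** The only negative contribution to the form is the product of the two extreme coordinates; once
    it vanishes, a sum of squares is left. *)
Lemma mink_degenerate_ge0 v : v (ix 0) 0 * v (ix n.+1) 0 = 0 -> 0 <= mink v v.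
Proof. by move=> v0; rewrite mink_sqr v0 mulr0 subr0 sumsq_ge0. Qed.

Lemma mink_degenerate_eq0 v (i : 'I_n.+2) : v (ix 0) 0 * v (ix n.+1) 0 = 0 -> mink v v = 0 ->
  (1 <= i <= n)%N -> v i 0 = 0.
Proof.
move=> v0; rewrite mink_sqr v0 mulr0 subr0 => /eqP; rewrite psumr_eq0.
  by move=> /allP H i1n; have := H i (mem_index_enum _); rewrite i1n /= sqrf_eq0 => /eqP.
by move=> j _; exact: sqr_ge0.
Qed.

Lemma null_eq0 v : mink v v = 0 -> v (ix 0) 0 = 0 -> v (ix n.+1) 0 = 0 -> v = 0.
Proof.
move=> vv v0 vn; apply/matrixP => i j; rewrite ord1 mxE; move: i; apply: ix_cases => // i i1n.
by apply: mink_degenerate_eq0 i1n => //; rewrite v0 mul0r.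
Qed.

(* Subtracting from [w] a multiple of [v] kills one of its two extreme coordinates. *)
Lemma null_orth_ge0 v w : mink v v = 0 -> v != 0 -> mink v w = 0 ->
  0 <= mink w w /\ (mink w w = 0 -> exists a, w = a *: v).
Proof.
move=> vv v0 vw.
have key a : ((w - a *: v) (ix 0) 0 = 0 \/ (w - a *: v) (ix n.+1) 0 = 0) ->
    0 <= mink w w /\ (mink w w = 0 -> forall i : 'I_n.+2, (1 <= i <= n)%N -> (w - a *: v) i 0 = 0).
  move=> H.
  have W : mink (w - a *: v) (w - a *: v) = mink w w.
    by rewrite !minkE (minkC w v) vv vw; ring.
  have H0 : (w - a *: v) (ix 0) 0 * (w - a *: v) (ix n.+1) 0 = 0.
    by case: H => ->; rewrite ?mul0r ?mulr0.
  by split=> [|ww i i1n]; rewrite -?W; [exact: mink_degenerate_ge0|apply: mink_degenerate_eq0; rewrite ?W].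
have fin a (c d : 'I_n.+2) : (c = ix 0 /\ d = ix n.+1 \/ d = ix 0 /\ c = ix n.+1) -> v c 0 != 0 -> (w - a *: v) c 0 = 0 ->
    0 <= mink w w /\ (mink w w = 0 -> exists a, w = a *: v).
  move=> cd vc wc.
  have /key [W0 W1] : (w - a *: v) (ix 0) 0 = 0 \/ (w - a *: v) (ix n.+1) 0 = 0.
    by case: cd wc => [[-> _]|[_ ->]]; [left|right].
  split=> // ww; exists a; apply/eqP; rewrite -subr_eq0; apply/eqP.
  have O : mink v (w - a *: v) = 0 by rewrite !minkE vw vv; ring.
  have Od : (w - a *: v) d 0 = 0.
    have : mink v (w - a *: v) = - (v c 0 * (w - a *: v) d 0).
      rewrite /mink big1 => [|i i1n]; last by rewrite (W1 ww) // mulr0.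
      by case: cd wc => [[-> ->]|[-> ->]] ->; rewrite mulr0 ?subr0 ?sub0r ?oppr0 ?add0r.
    by rewrite O => /esym/eqP; rewrite oppr_eq0 mulf_eq0 (negbTE vc) => /eqP.
  apply/matrixP => i j; rewrite ord1 [RHS]mxE; move: i; apply: ix_cases; last exact: W1.
    by case: cd wc Od => [[-> ->]|[-> ->]].
  by case: cd wc Od => [[-> ->]|[-> ->]].
have [v00|v00] := eqVneq (v (ix 0) 0) 0.
  have vn0 : v (ix n.+1) 0 != 0.
    by apply: contra_neq v0 => vn0; exact: null_eq0.
  apply: (@fin (w (ix n.+1) 0 / v (ix n.+1) 0) (ix n.+1) (ix 0)) => //; first by right.
  by rewrite !mxE divfK // subrr.
apply: (@fin (w (ix 0) 0 / v (ix 0) 0) (ix 0) (ix n.+1)) => //; first by left.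
by rewrite !mxE divfK // subrr.
Qed.

(** The form is positive definite on the orthogonal of a null vector modulo that vector. Applied to
    a lift and its derivative, this gives the positive speed of an immersion. *)
Lemma null_orth_gt0 v w : mink v v = 0 -> v != 0 -> mink v w = 0 ->
  (forall a b, a *: v + b *: w = 0 -> a = 0 /\ b = 0) -> 0 < mink w w.
Proof.
move=> vv v0 vw ind; have [w0 w1] := null_orth_ge0 vv v0 vw.
rewrite lt0r w0 andbT; apply/eqP => /w1 [a wa].
have [_ /eqP] : a = 0 /\ (-1 : R) = 0 by apply: ind; rewrite wa scaleN1r subrr.
by rewrite oppr_eq0 oner_eq0.
Qed.

(** A timelike and a null vector with negative product lie in the same half of the light cone. This
    reduces the time orientation required by [mob] to that of the first column. *)
Lemma timelike_future u v : mink u u < 0 -> mink v v = 0 -> v != 0 -> mink u v < 0 ->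
  0 < v (ix 0) 0 + v (ix n.+1) 0 -> 0 < u (ix 0) 0 + u (ix n.+1) 0.
Proof.
move=> uu vv v0 uv vpos.
have sq := mink_sqr; have sg := sumsq_ge0.
have vp : 0 <= v (ix 0) 0 /\ 0 <= v (ix n.+1) 0.
  have : 0 <= v (ix 0) 0 * v (ix n.+1) 0 by have := sq v; rewrite vv; have := sg v; lra.
  by split; nra.
have up : 0 < u (ix 0) 0 * u (ix n.+1) 0 by have := sq u; have := sg u; lra.
rewrite ltNge; apply/negP => uneg.
have [u0 un] : u (ix 0) 0 < 0 /\ u (ix n.+1) 0 < 0 by split; nra.
have kill c : u c 0 < 0 -> 0 <= v c 0 -> (c = ix 0 \/ c = ix n.+1) -> v c 0 = 0.
  (* The vector v + l u has vanishing coordinate c, hence non-negative square; but that square is 2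
     l <u,v> + l^2 <u,u>, which is negative unless l = 0. *)
  move=> uc vc cc; pose l := - (v c 0) / u c 0.
  have l0 : 0 <= l by rewrite /l mulNr -mulrN mulr_ge0 // -invrN invr_ge0 oppr_ge0 ltW.
  have : 0 <= mink (v + l *: u) (v + l *: u).
    apply: mink_degenerate_ge0.
    suff H : (v + l *: u) c 0 = 0 by case: cc H => -> ->; rewrite ?mul0r ?mulr0.
    by rewrite !mxE /l divfK ?ltr0_neq0 // addrC addNr.
  rewrite !minkE vv (minkC v u) => H.
  have l00 : l = 0 by nra.
  have : l * u c 0 = 0 by rewrite l00 mul0r.
  by rewrite /l divfK ?ltr0_neq0 // => /eqP; rewrite oppr_eq0 => /eqP.
have E0 : v (ix 0) 0 = 0 by apply: kill => //; [case: vp|left].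
have En : v (ix n.+1) 0 = 0 by apply: kill => //; [case: vp|right].
by move: vpos; rewrite E0 En addr0 ltxx.
Qed.

End Mink.

(** * Derivatives of vector- and matrix-valued functions *)

Section MatrixCalculus.
Variable R : realType.

(** A relation, so that existence and value of the derivative travel together and structure
    equations can be combined without separate differentiability conditions. *)
Definition vderiv (m : nat) (f : R -> 'cV[R]_m) (x : R) (d : 'cV[R]_m) : Prop :=
  forall i, is_derive x (1 : R) (fun y => f y i 0) (d i 0).

Section VDeriv.
Variable m : nat.
Implicit Types (f g : R -> 'cV[R]_m) (x : R) (d : 'cV[R]_m).

Lemma vderiv_dmx f x d : vderiv f x d -> dmx f x = d.
Proof.
by move=> fd; apply/matrixP => i j; rewrite ord1 mxE; exact: is_derive1_derive1 (fd i).
Qed.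

Lemma smoothmx_vderiv (U : set R) f x : smoothmx U f -> U x -> vderiv f x (dmx f x).
Proof. by move=> sf Ux i; rewrite mxE; exact: smooth1_is_derive1 (sf i 0) Ux. Qed.

Lemma vderivD f g x c d : vderiv f x c -> vderiv g x d ->
  vderiv (fun y => f y + g y) x (c + d).
Proof.
move=> fc gd i; rewrite mxE; under eq_fun do rewrite mxE.
exact: is_derive1D (fc i) (gd i).
Qed.

Lemma vderivZ (a : R -> R) f x (b : R) d : is_derive x 1 a b -> vderiv f x d ->
  vderiv (fun y => a y *: f y) x (b *: f x + a x *: d).
Proof.
move=> ab fd i; rewrite !mxE; under eq_fun do rewrite mxE.
exact: is_derive1M ab (fd i).
Qed.

Lemma vderivB f g x c d : vderiv f x c -> vderiv g x d ->
  vderiv (fun y => f y - g y) x (c - d).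
Proof.
move=> fc gd i; rewrite !mxE; under eq_fun do rewrite !mxE.
exact: is_derive1B (fc i) (gd i).
Qed.

Lemma vderiv_cst (c : 'cV[R]_m) x : vderiv (fun=> c) x 0.
Proof. by move=> i; rewrite mxE; exact: is_derive1_cst. Qed.

Lemma vderiv_sum (T : Type) (r : seq T) (P : pred T) (f : T -> R -> 'cV[R]_m) (d : T -> 'cV[R]_m) x :
  (forall i, P i -> vderiv (f i) x (d i)) ->
  vderiv (fun y => \sum_(i <- r | P i) f i y) x (\sum_(i <- r | P i) d i).
Proof.
move=> fd i; rewrite summxE; under eq_fun do rewrite summxE.
by apply: is_derive1_sum => j Pj; exact: fd.
Qed.

Lemma vderiv_ext (U : set R) f g x d : open U -> U x -> (forall y, U y -> f y = g y) ->
  vderiv f x d -> vderiv g x d.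
Proof.
by move=> oU Ux fg fd i; apply: (is_derive1_ext oU Ux _ (fd i)) => y Uy; rewrite fg.
Qed.

Lemma vderiv_unique f x c d : vderiv f x c -> vderiv f x d -> c = d.
Proof. by move=> /vderiv_dmx <- /vderiv_dmx. Qed.

End VDeriv.

Lemma vderiv_mink n (f g : R -> 'cV[R]_(n.+2)) x c d : vderiv f x c -> vderiv g x d ->
  is_derive x (1 : R) (fun y => mink (f y) (g y)) (mink c (g x) + mink (f x) d).
Proof.
move=> fc gd.
have H (i : 'I_n.+2) := is_derive1M (fc i) (gd i).
have H2 i j := is_derive1M (fc i) (gd j).
apply: (is_derive_eq (is_derive1B (is_derive1B
  (is_derive1_sum (index_enum 'I_n.+2) (P := fun i : 'I_n.+2 => (1 <= i <= n)%N) (fun i _ => H i))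
  (H2 (idx n 0) (idx n n.+1))) (H2 (idx n n.+1) (idx n 0)))).
by rewrite /mink big_split /=; ring.
Qed.

(** The structure equations have the form f' = s d; cancelling the common factor turns each constant
    product into a linear relation between arclength derivatives. *)
Lemma vderiv_mink_cst n (U : set R) (f g : R -> 'cV[R]_(n.+2)) x (c k : R) d d' :
  open U -> U x -> (forall y, U y -> mink (f y) (g y) = c) -> k != 0 ->
  vderiv f x (k *: d) -> vderiv g x (k *: d') -> mink d (g x) + mink (f x) d' = 0.
Proof.
move=> oU Ux fg k0 df dg; apply: (mulfI k0); rewrite mulr0 mulrDr -minkZl -minkZr.
apply: (is_derive1_unique (vderiv_mink df dg)).
by apply: (is_derive1_ext oU Ux _ (is_derive1_cst c x)) => y Uy; rewrite fg.
Qed.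

Section SmoothMx.
Variables (U : set R) (oU : open U).

Lemma smoothmx_ext m p (f g : R -> 'M[R]_(m, p)) : (forall y, U y -> f y = g y) ->
  smoothmx U f -> smoothmx U g.
Proof. by move=> fg sf i j; apply: (smooth1_ext oU _ (sf i j)) => y Uy; rewrite fg. Qed.

Lemma smoothmx_cst m p (A : 'M[R]_(m, p)) : smoothmx U (fun=> A).
Proof. by move=> i j; exact: smooth1_cst. Qed.

Lemma smoothmxD m p (f g : R -> 'M[R]_(m, p)) : smoothmx U f -> smoothmx U g ->
  smoothmx U (fun y => f y + g y).
Proof.
by move=> sf sg i j; apply: (smooth1_ext oU _ (smooth1D oU (sf i j) (sg i j))) => y _; rewrite mxE.
Qed.

Lemma smoothmxZ m p (a : R -> R) (f : R -> 'M[R]_(m, p)) : smooth1 U a -> smoothmx U f ->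
  smoothmx U (fun y => a y *: f y).
Proof.
by move=> sa sf i j; apply: (smooth1_ext oU _ (smooth1M oU sa (sf i j))) => y _; rewrite mxE.
Qed.

Lemma smoothmxB m p (f g : R -> 'M[R]_(m, p)) : smoothmx U f -> smoothmx U g ->
  smoothmx U (fun y => f y - g y).
Proof.
by move=> sf sg i j; apply: (smooth1_ext oU _ (smooth1B oU (sf i j) (sg i j))) => y _; rewrite !mxE.
Qed.

Lemma smoothmx_mul m p q (f : R -> 'M[R]_(m, p)) (g : R -> 'M[R]_(p, q)) :
  smoothmx U f -> smoothmx U g -> smoothmx U (fun y => f y *m g y).
Proof.
move=> sf sg i j.
have H : smooth1 U (fun y => \sum_k f y i k * g y k j).
  by apply: smooth1_sum => [//|k _]; apply: smooth1M; [exact: oU|exact: sf|exact: sg].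
by apply: (smooth1_ext oU _ H) => y _; rewrite mxE.
Qed.

Lemma smoothmx_dmx m p (f : R -> 'M[R]_(m, p)) : smoothmx U f -> smoothmx U (dmx f).
Proof.
move=> sf i j; apply: (smooth1_ext oU _ (smooth1_derive1 (sf i j))) => y _.
by rewrite mxE.
Qed.

Lemma smoothmx_col m p (f : R -> 'M[R]_(m, p)) j : smoothmx U f -> smoothmx U (fun y => col j (f y)).
Proof.
by move=> sf i k; apply: (smooth1_ext oU _ (sf i j)) => y _; rewrite mxE.
Qed.

Lemma smooth1_det m (f : R -> 'M[R]_m) : smoothmx U f -> smooth1 U (fun y => \det (f y)).
Proof.
move=> sf; rewrite /determinant; apply: smooth1_sum => [//|s _].
apply: smooth1M => //; first exact: smooth1_cst.
by apply: smooth1_prod => [//|i _]; exact: sf.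
Qed.

Lemma smooth1_mink n (f g : R -> 'cV[R]_(n.+2)) : smoothmx U f -> smoothmx U g ->
  smooth1 U (fun y => mink (f y) (g y)).
Proof.
move=> sf sg; have H i j : smooth1 U (fun y => f y i 0 * g y j 0).
  by apply: smooth1M; [exact: oU|exact: sf|exact: sg].
apply: smooth1B; [exact: oU| |exact: H].
apply: smooth1B; [exact: oU| |exact: H].
by apply: smooth1_sum => [//|i _]; exact: H.
Qed.

Lemma smoothmx_sum m p (T : Type) (r : seq T) (P : pred T) (f : T -> R -> 'M[R]_(m, p)) :
  (forall i, P i -> smoothmx U (f i)) -> smoothmx U (fun y => \sum_(i <- r | P i) f i y).
Proof.
move=> sf i j.
have H : smooth1 U (fun y => \sum_(k <- r | P k) f k y i j).
  by apply: smooth1_sum => [//|k Pk]; exact: sf.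
by apply: (smooth1_ext oU _ H) => y _; rewrite summxE.
Qed.

End SmoothMx.

Lemma smoothmx_subset m p (U W : set R) (f : R -> 'M[R]_(m, p)) : W `<=` U -> smoothmx U f -> smoothmx W f.
Proof. by move=> WU sf i j; exact: smooth1_subset (sf i j). Qed.

Lemma dmx_ext m p (U : set R) (f g : R -> 'M[R]_(m, p)) x : open U -> U x ->
  (forall y, U y -> f y = g y) -> dmx f x = dmx g x.
Proof.
move=> oU Ux fg; apply/matrixP => i j; rewrite !mxE.
by apply: (derive1_ext oU Ux) => y Uy; rewrite fg.
Qed.

End MatrixCalculus.

(** * Smooth frames through prescribed vectors *)

Section MovingFrames.
Variables (R : realType) (n : nat).
Local Notation V := 'cV[R]_(n.+2).
Local Notation ix := (@idx n).

Lemma open_setI_neq0 (U : set R) (f : R -> R) : open U ->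
  (forall x, U x -> {for x, continuous f}) -> open [set x | U x /\ f x != 0].
Proof.
move=> oU cf; rewrite openE => x [Ux fx].
have N1 : nbhs x U := open_nbhs_nbhs (conj oU Ux).
have N2 : nbhs x (fun y => f y != 0).
  by apply: (cf x Ux [set y | y != 0]); apply: open_nbhs_nbhs; split; [exact: open_neq|exact: fx].
by apply: filterS2 N1 N2 => y.
Qed.

Lemma open_setI_gt0 (U : set R) (f : R -> R) : open U ->
  (forall x, U x -> {for x, continuous f}) -> open [set x | U x /\ 0 < f x].
Proof.
move=> oU cf; rewrite openE => x [Ux fx].
have N1 : nbhs x U := open_nbhs_nbhs (conj oU Ux).
have N2 : nbhs x (fun y => 0 < f y).
  by apply: (cf x Ux [set y | 0 < y]); apply: open_nbhs_nbhs; split; [exact: open_gt|exact: fx].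
by apply: filterS2 N1 N2 => y.
Qed.

Definition refl (w : V) : 'M[R]_(n.+2) :=
  1%:M - (2 / mink w w) *: (w *m (w^T *m gram R n)).

Lemma reflE (w v : V) : refl w *m v = v - (2 * mink w v / mink w w) *: w.
Proof.
rewrite /refl mulmxBl mul1mx -scalemxAl -[w *m _ *m v]mulmxA; congr (_ - _).
have -> : w^T *m gram R n *m v = (mink w v)%:M.
  by apply/matrixP => i j; rewrite !ord1 mink_gram [RHS]mxE eqxx mulr1n.
by rewrite mul_mx_scalar scalerA; congr (_ *: _); ring.
Qed.

Lemma isometry_refl (w : V) : mink w w != 0 -> isometry (refl w).
Proof.
move=> w0 v z; rewrite !reflE !minkE (minkC v w); by field.
Qed.

Lemma refl_orth (w v : V) : mink w v = 0 -> refl w *m v = v.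
Proof. by move=> wv; rewrite reflE wv mulr0 mul0r scale0r subr0. Qed.

Lemma refl_sub (u v : V) : mink u u = mink v v -> mink (u - v) (u - v) != 0 ->
  refl (u - v) *m u = v.
Proof.
move=> uv w0; rewrite reflE.
have -> : 2 * mink (u - v) u / mink (u - v) (u - v) = 1.
  have -> : 2 * mink (u - v) u = mink (u - v) (u - v) by rewrite !minkE (minkC v u) uv; ring.
  by rewrite divff.
by rewrite scale1r opprB addrC subrK.
Qed.

Lemma refl_self (v : V) : mink v v != 0 -> refl v *m v = - v.
Proof.
move=> v0; rewrite reflE mulfK // -[X in X - _]scale1r -scalerBl.
by rewrite -[RHS]scaleN1r; congr (_ *: _); ring.
Qed.

Lemma smoothmx_refl (J : set R) (w : R -> V) : open J -> smoothmx J w ->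
  (forall x, J x -> mink (w x) (w x) != 0) -> smoothmx J (fun x => refl (w x)).
Proof.
move=> oJ sw w0; apply: (smoothmxB oJ); first exact: smoothmx_cst.
apply: (smoothmxZ oJ).
  apply: (smooth1M oJ); first exact: smooth1_cst.
  by apply: (smooth1V oJ w0); exact: smooth1_mink.
apply: (smoothmx_mul oJ sw); apply: (smoothmx_mul oJ); last exact: smoothmx_cst.
by move=> i j; apply: (smooth1_ext oJ _ (sw j i)) => y _; rewrite mxE.
Qed.

(* The reflection in [Q c - v] carries [Q c] to [v]; where [Q c - v] is null, [Q c + v] is not,
   and one reflects in [Q c + v] and then in [v]. *)
Lemma isometry_extend (J : set R) (Q : R -> 'M[R]_(n.+2)) (v : R -> V) (c : V) x0 :
  open J -> J x0 -> smoothmx J Q -> (forall x, J x -> isometry (Q x)) ->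
  smoothmx J v -> mink c c != 0 -> (forall x, J x -> mink (v x) (v x) = mink c c) ->
  exists J' Q', [/\ open J', J' x0, J' `<=` J, smoothmx J' Q' &
    forall x, J' x -> [/\ isometry (Q' x), Q' x *m c = v x &
      forall z, mink z c = 0 -> mink (Q x *m z) (v x) = 0 -> Q' x *m z = Q x *m z]].
Proof.
move=> oJ Jx0 sQ iQ sv c0 vv.
pose u x := Q x *m c.
have su : smoothmx J u by apply: (smoothmx_mul oJ sQ); exact: smoothmx_cst.
have uu x : J x -> mink (u x) (u x) = mink c c by move=> /iQ; exact.
have [w0|w0] := eqVneq (mink (u x0 - v x0) (u x0 - v x0)) 0; last first.
  pose w x := u x - v x.
  have sw : smoothmx J w := smoothmxB oJ su sv.
  pose J' := [set x | J x /\ mink (w x) (w x) != 0].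
  have oJ' : open J'.
    by apply: open_setI_neq0 => // x Jx; exact: smooth1_continuous (smooth1_mink oJ sw sw) Jx.
  have J'J : J' `<=` J by move=> x [].
  exists J', (fun x => refl (w x) *m Q x); split=> //.
    apply: (smoothmx_mul oJ'); last exact: (smoothmx_subset J'J sQ).
    by apply: (smoothmx_refl oJ'); [exact: (smoothmx_subset J'J sw)|move=> x []].
  move=> x [Jx wx]; split.
  - by apply: isometryM; [exact: isometry_refl|exact: iQ].
  - by rewrite -mulmxA; apply: refl_sub; rewrite ?uu ?vv.
  - move=> z zc zv; rewrite -mulmxA refl_orth //.
    by rewrite /w minkDl minkNl (minkC (v x)) zv /u iQ // minkC zc subr0.
pose w x := u x + v x.
have sw : smoothmx J w := smoothmxD oJ su sv.
(* Parallelogram law: the squares of Q c + v and Q c - v add up to 4 <c,c>, which is not 0, so they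
   cannot both be null. *)
have wE x : J x -> mink (w x) (w x) = 4 * mink c c - mink (u x - v x) (u x - v x).
  by move=> Jx; rewrite !minkE (minkC (v x) (u x)) uu // vv //; ring.
pose J' := [set x | J x /\ mink (w x) (w x) != 0].
have oJ' : open J'.
  by apply: open_setI_neq0 => // x Jx; exact: smooth1_continuous (smooth1_mink oJ sw sw) Jx.
have J'J : J' `<=` J by move=> x [].
exists J', (fun x => refl (v x) *m (refl (w x) *m Q x)); split=> //.
- by split=> //; rewrite wE // w0 subr0 mulf_neq0 ?pnatr_eq0.
- apply: (smoothmx_mul oJ').
    apply: (smoothmx_refl oJ'); first exact: (smoothmx_subset J'J sv).
    by move=> x /J'J /vv ->.
  apply: (smoothmx_mul oJ'); last exact: (smoothmx_subset J'J sQ).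
  by apply: (smoothmx_refl oJ'); [exact: (smoothmx_subset J'J sw)|move=> x []].
- move=> x [Jx wx]; have v0 : mink (v x) (v x) != 0 by rewrite vv.
  split.
  + by do 2 (apply: isometryM; first exact: isometry_refl); exact: iQ.
  + have E : refl (w x) *m u x = - v x.
      have := @refl_sub (u x) (- v x); rewrite opprK; apply; last exact: wx.
      by rewrite minkNl minkNr opprK uu ?vv.
    by rewrite -[_ *m c]mulmxA -[(refl (w x) *m Q x) *m c]mulmxA E mulmxN refl_self // opprK.
  + move=> z zc zv; rewrite -!mulmxA (@refl_orth (w x)).
      by rewrite refl_orth // minkC.
    by rewrite /w minkDl (minkC (v x)) zv /u iQ // minkC zc addr0.
Qed.

Definition diag_last (d : R) : 'M[R]_(n.+2) := diag_mx (\row_j (if j == ix n then d else 1)).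

Lemma diag_lastE d (z : V) i : (diag_last d *m z) i 0 = (if i == ix n then d else 1) * z i 0.
Proof. by rewrite /diag_last mul_diag_mx !mxE. Qed.

Lemma isometry_diag_last d : (0 < n)%N -> d * d = 1 -> isometry (diag_last d).
Proof.
move=> n0 dd v w; rewrite /mink !diag_lastE !(eq_ix, val_ix) //.
rewrite (@ltn_eqF 0) // gtn_eqF // !mul1r; congr (_ - _ - _).
apply: eq_bigr => i _; rewrite !diag_lastE; case: ifP => _; last by rewrite !mul1r.
by rewrite mulrACA dd mul1r.
Qed.

(* The determinant is corrected by a sign in the column [n]. *)
Lemma mob_of_isometry (J : set R) (Q : R -> 'M[R]_(n.+2)) : (0 < n)%N -> open J ->
  smoothmx J Q -> (forall x, J x -> isometry (Q x)) ->
  (forall x, J x -> mink (Q x *m Tvec R n) (Tvec R n) < 0) ->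
  exists e, [/\ smoothmx J e, forall x, J x -> mob (e x) &
     forall x k, J x -> (k <= n.+1)%N -> k != n -> col (ix k) (e x) = Q x *m bvec R (ix k)].
Proof.
move=> n0 oJ sQ iQ tQ.
have colE x i : i != ix n -> diag_last (\det (Q x)) *m bvec R i = bvec R i.
  move=> i_n; apply/matrixP => j k; rewrite ord1 diag_lastE bvecE.
  case: (eqVneq j i) => [->|_]; last by rewrite mulr0.
  by rewrite (negbTE i_n) mulr1.
exists (fun x => Q x *m diag_last (\det (Q x))); split.
- apply: (smoothmx_mul oJ sQ) => i j.
  have H : smooth1 J (fun x => if i == j then if j == ix n then \det (Q x) else 1 else 0).
    by case: (i == j); [case: (j == ix n); [exact: smooth1_det|exact: smooth1_cst]|exact: smooth1_cst].
  by apply: (smooth1_ext oJ _ H) => x _; rewrite /diag_last !mxE; have [->|] := eqVneq i j.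
- move=> x Jx; have dd := isometry_det (iQ _ Jx).
  split.
  + exact: isometryM (iQ _ Jx) (isometry_diag_last n0 dd).
  + rewrite det_mulmx det_diag (bigD1 (ix n)) //= big1 ?mulr1 ?mxE ?eqxx //.
    by move=> i i_n; rewrite mxE (negbTE i_n).
  + have -> : Q x *m diag_last (\det (Q x)) *m Tvec R n = Q x *m Tvec R n; last exact: tQ.
    rewrite -mulmxA; congr (_ *m _); apply/matrixP => j k; rewrite ord1 diag_lastE.
    case: (eqVneq j (ix n)) => [->|_]; last by rewrite mul1r.
    by rewrite !mxE !eq_ix // !val_ix // gtn_eqF // ltn_eqF //= mulr0.
- by move=> x k Jx kn k_n; rewrite col_mul_bvec -mulmxA colE // eq_ix // val_ix.
Qed.

Lemma mink_bvec_ends : [/\ mink (bvec R (ix 0)) (bvec R (ix 0)) = 0,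
  mink (bvec R (ix 0)) (bvec R (ix n.+1)) = -1 & mink (bvec R (ix n.+1)) (bvec R (ix n.+1)) = 0].
Proof.
by rewrite !mink_bvec0 mink_bvecn1 !bvecE !eqxx !eq_ix // !val_ix //= oppr0.
Qed.

Lemma mink_bvec_end_mid (i : 'I_n.+2) : (1 <= i <= n)%N ->
  mink (bvec R (ix 0)) (bvec R i) = 0 /\ mink (bvec R (ix n.+1)) (bvec R i) = 0.
Proof.
case/andP => i0 i1; rewrite mink_bvec0 mink_bvecn1 !bvecE ![_ == i]eq_sym !eq_ix //.
have -> : (i == n.+1 :> nat) = false by rewrite ltn_eqF.
have -> : (i == 0 :> nat) = false by rewrite gtn_eqF.
by rewrite oppr0.
Qed.

Lemma mink_bvec_mid_mid (i j : 'I_n.+2) : (1 <= i <= n)%N ->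
  mink (bvec R i) (bvec R j) = (i == j)%:R.
Proof. by move=> i1n; rewrite mink_bvec_mid // bvecE. Qed.

(** [isometry_extend] cannot prescribe the images of null vectors. Therefore c0 and cn are replaced
    by c0 + cn and c0 - cn, of squares -2 and 2; these and c1 are pairwise orthogonal, so each
    extension keeps what was already prescribed, and v0, vn are recovered by halving. *)
Lemma adapted_isometry (J : set R) (v0 v1 vn : R -> V) x0 : (0 < n)%N -> open J -> J x0 ->
  smoothmx J v0 -> smoothmx J v1 -> smoothmx J vn ->
  (forall x, J x -> [/\ mink (v0 x) (v0 x) = 0, mink (v0 x) (vn x) = -1 & mink (vn x) (vn x) = 0]) ->
  (forall x, J x -> [/\ mink (v1 x) (v1 x) = 1, mink (v0 x) (v1 x) = 0 & mink (vn x) (v1 x) = 0]) ->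
  exists J' Q, [/\ open J', J' x0, J' `<=` J, smoothmx J' Q &
    forall x, J' x -> [/\ isometry (Q x), Q x *m bvec R (ix 0) = v0 x,
       Q x *m bvec R (ix 1) = v1 x & Q x *m bvec R (ix n.+1) = vn x]].
Proof.
move=> n0 oJ Jx0 s0 s1 sn g0 g1.
have [b00 b0n bnn] := mink_bvec_ends.
have i1 : (1 <= ix 1 <= n)%N by rewrite val_ix // n0.
have [b01 bn1] := mink_bvec_end_mid i1.
have b11 := mink_bvec_mid_mid (ix 1) i1; rewrite eqxx in b11.
set c0 := bvec R (ix 0) in b00 b0n b01 *; set cn := bvec R (ix n.+1) in b0n bnn bn1 *.
set c1 := bvec R (ix 1) in b01 bn1 b11 *.
have [J1 [Q1 [oJ1 J1x J1J sQ1 H1]]] := @isometry_extend J (fun=> 1%:M) (fun x => v0 x + vn x) (c0 + cn) x0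
  oJ Jx0 (@smoothmx_cst R J oJ _ _ 1%:M) (fun _ _ => @isometry1 R n) (smoothmxD oJ s0 sn)
  ltac:(rewrite !minkE (minkC cn c0) b00 b0n bnn; lra)
  ltac:(move=> x Jx; rewrite !minkE (minkC cn c0) b00 b0n bnn (minkC (vn x) (v0 x)); case: (g0 x Jx) => -> -> ->; lra).
have [J2 [Q2 [oJ2 J2x J2J1 sQ2 H2]]] := @isometry_extend J1 Q1 (fun x => v0 x - vn x) (c0 - cn) x0
  oJ1 J1x sQ1 ltac:(by move=> x /H1 []) (smoothmx_subset J1J (smoothmxB oJ s0 sn))
  ltac:(rewrite !minkE (minkC cn c0) b00 b0n bnn; lra)
  ltac:(move=> x /J1J Jx; rewrite !minkE (minkC cn c0) b00 b0n bnn (minkC (vn x) (v0 x)); case: (g0 x Jx) => -> -> ->; lra).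
have J2J : J2 `<=` J by move=> x /J2J1 /J1J.
have [J3 [Q3 [oJ3 J3x J3J2 sQ3 H3]]] := @isometry_extend J2 Q2 v1 c1 x0
  oJ2 J2x sQ2 ltac:(by move=> x /H2 []) (smoothmx_subset J2J s1)
  ltac:(rewrite b11; exact: oner_neq0)
  ltac:(by move=> x /J2J /g1 [-> _ _]).
have J3J : J3 `<=` J by move=> x /J3J2 /J2J.
exists J3, Q3; split=> // x J3x'.
have J2x' := J3J2 _ J3x'; have J1x' := J2J1 _ J2x'; have Jx' := J1J _ J1x'.
have [iQ3 Q31 Q3z] := H3 _ J3x'; have [iQ2 Q2m Q2z] := H2 _ J2x'; have [iQ1 Q1p _] := H1 _ J1x'.
have [g00 g0n gnn] := g0 _ Jx'; have [g11 g01 gn1] := g1 _ Jx'.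
have Q2p : Q2 x *m (c0 + cn) = v0 x + vn x.
  rewrite -Q1p; apply: Q2z; rewrite ?Q1p !minkE.
    by rewrite (minkC cn c0) b00 bnn; ring.
  by rewrite (minkC (vn x) (v0 x)) g00 gnn; ring.
have half (z z' : V) : z + z' + (z - z') = 2 *: z.
  by rewrite addrACA subrr addr0 scaler_nat mulr2n.
have half' (z z' : V) : z + z' - (z - z') = 2 *: z'.
  by rewrite opprB [z + z']addrC addrACA subrr addr0 scaler_nat mulr2n.
have two : (2 : R) != 0 by rewrite pnatr_eq0.
have E0 : Q2 x *m c0 = v0 x.
  apply: (scalerI two); rewrite scalemxAr -(half c0 cn) mulmxDr Q2p Q2m; exact: half.
have En : Q2 x *m cn = vn x.
  apply: (scalerI two); rewrite scalemxAr -(half' c0 cn) mulmxBr Q2p Q2m; exact: half'.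
by split=> //; rewrite Q3z ?E0 ?En.
Qed.

Lemma adapted_isometry_extend (J : set R) (Q : R -> 'M[R]_(n.+2)) (v : R -> V) i x0 :
  (2 <= i <= n)%N -> open J -> J x0 -> smoothmx J v -> smoothmx J Q ->
  (forall x, J x -> isometry (Q x)) ->
  (forall x, J x -> [/\ mink (v x) (v x) = 1, mink (Q x *m bvec R (ix 0)) (v x) = 0,
     mink (Q x *m bvec R (ix 1)) (v x) = 0 & mink (Q x *m bvec R (ix n.+1)) (v x) = 0]) ->
  exists J' Q', [/\ open J', J' x0, J' `<=` J, smoothmx J' Q' &
    forall x, J' x -> [/\ isometry (Q' x), Q' x *m bvec R (ix i) = v x,
       Q' x *m bvec R (ix 0) = Q x *m bvec R (ix 0),
       Q' x *m bvec R (ix 1) = Q x *m bvec R (ix 1)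
       & Q' x *m bvec R (ix n.+1) = Q x *m bvec R (ix n.+1)]].
Proof.
move=> i2n oJ Jx0 sv sQ iQ gv.
have [i2 i_n] := andP i2n.
have iv : ix i = i :> nat by rewrite val_ix // (leq_trans i_n).
have i1n : (1 <= ix i <= n)%N by rewrite iv (ltnW i2).
have [b0i bni] := mink_bvec_end_mid i1n.
have bii := mink_bvec_mid_mid (ix i) i1n; rewrite eqxx in bii.
have b1i : mink (bvec R (ix 1)) (bvec R (ix i)) = 0.
  rewrite minkC mink_bvec_mid_mid // eq_ix // iv gtn_eqF //.
have [J' [Q' [oJ' J'x J'J sQ' H]]] := @isometry_extend J Q v (bvec R (ix i)) x0 oJ Jx0 sQ iQ sv
  ltac:(rewrite bii; exact: oner_neq0) ltac:(by move=> x /gv [-> _ _ _]).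
exists J', Q'; split=> // x J'x'; have [iQ' Q'i Q'z] := H _ J'x'.
by have [_ h0 h1 hn] := gv _ (J'J _ J'x'); split=> //; apply: Q'z.
Qed.

End MovingFrames.

(** * The arclength density of a lift *)

Section FrameAlgebra.
Variables (R : realType) (n : nat).
Local Notation V := 'cV[R]_(n.+2).
Local Notation ix := (@idx n).
Implicit Types (A : 'M[R]_(n.+2)) (v w : V).

Lemma mob_isometry A : mob A -> isometry A.
Proof. by case. Qed.

Lemma isometry_col A (i j : 'I_n.+2) : isometry A ->
  mink (col i A) (col j A) = mink (bvec R i) (bvec R j).
Proof. by move=> iA; rewrite !col_mul_bvec iA. Qed.

Lemma mink_mul_col0 A w : isometry A -> mink (A *m w) (col (ix 0) A) = - w (ix n.+1) 0.
Proof. by move=> iA; rewrite col_mul_bvec iA minkC mink_bvec0. Qed.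

Lemma mink_mul_coln1 A w : isometry A -> mink (A *m w) (col (ix n.+1) A) = - w (ix 0) 0.
Proof. by move=> iA; rewrite col_mul_bvec iA minkC mink_bvecn1. Qed.

Lemma mink_mul_col_mid A w (i : 'I_n.+2) : isometry A -> (1 <= i <= n)%N ->
  mink (A *m w) (col i A) = w i 0.
Proof. by move=> iA i1n; rewrite col_mul_bvec iA minkC mink_bvec_mid. Qed.

Lemma frame_coords A v : isometry A -> exists w, v = A *m w.
Proof.
by move=> iA; exists (invmx A *m v); rewrite mulmxA mulmxV ?mul1mx // isometry_unit.
Qed.

Lemma frame_ext A v w : isometry A ->
  (forall i, mink v (col i A) = mink w (col i A)) -> v = w.
Proof.
move=> iA; have [v' ->] := frame_coords v iA; have [w' ->] := frame_coords w iA => H.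
congr (_ *m _); apply/matrixP => i j; rewrite ord1 {j}.
move: i; apply: ix_cases.
- by have := H (ix n.+1); rewrite !mink_mul_coln1 // => /oppr_inj.
- by have := H (ix 0); rewrite !mink_mul_col0 // => /oppr_inj.
- by move=> i i1n; have := H i; rewrite !mink_mul_col_mid.
Qed.

Lemma frame_parseval A v : isometry A -> mink v v =
  \sum_(i < n.+2 | (1 <= i <= n)%N) (mink v (col i A)) ^+ 2
  - 2 * (mink v (col (ix 0) A) * mink v (col (ix n.+1) A)).
Proof.
move=> iA; have [w ->] := frame_coords v iA.
rewrite iA mink_sqr mink_mul_col0 // mink_mul_coln1 // mulrNN [X in _ - 2 * X]mulrC.
by congr (_ - _); apply: eq_bigr => i i1n; rewrite mink_mul_col_mid.
Qed.

Lemma dmx_phi (e : R -> 'M[R]_(n.+2)) x : isometry (e x) -> dmx e x = e x *m phi e x.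
Proof. by move=> iA; rewrite /phi mulmxA mulmxV ?mul1mx // isometry_unit. Qed.

Lemma vderiv_col (J : set R) (e : R -> 'M[R]_(n.+2)) x i : smoothmx J e -> J x ->
  vderiv (fun y => col i (e y)) x (col i (dmx e x)).
Proof.
move=> se Jx j; rewrite !mxE; under eq_fun do rewrite mxE.
exact: smooth1_is_derive1 (se j i) Jx.
Qed.

Section PhiCoordinates.
Variables (J : set R) (e : R -> 'M[R]_(n.+2)).
Hypotheses (oJ : open J) (se : smoothmx J e) (ie : forall x, J x -> isometry (e x)).
Variables (x : R) (Jx : J x).

Lemma phi_col0 j : mink (col j (dmx e x)) (col (ix n.+1) (e x)) = - phi e x (ix 0) j.
Proof.
by rewrite (dmx_phi (ie Jx)) [col j _]colE -mulmxA -colE (mink_mul_coln1 _ (ie Jx)) mxE.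
Qed.

Lemma phi_mid (i j : 'I_n.+2) : (1 <= i <= n)%N ->
  mink (col j (dmx e x)) (col i (e x)) = phi e x i j.
Proof.
move=> i1n.
by rewrite (dmx_phi (ie Jx)) [col j _]colE -mulmxA -colE (mink_mul_col_mid _ (ie Jx) i1n) mxE.
Qed.

Lemma phi_skew (i j : 'I_n.+2) : mink (col i (dmx e x)) (col j (e x)) =
  - mink (col j (dmx e x)) (col i (e x)).
Proof.
have H := vderiv_mink (vderiv_col i se Jx) (vderiv_col j se Jx).
have : is_derive x (1 : R) (fun y => mink (col i (e y)) (col j (e y))) 0.
  apply: (is_derive1_ext oJ Jx _ (is_derive1_cst (mink (bvec R i) (bvec R j)) x)) => y Jy.
  by rewrite isometry_col //; exact: ie.
move=> /(is_derive1_unique H) /eqP; rewrite addr_eq0 => /eqP ->.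
by rewrite minkC.
Qed.

Lemma phi_skew_diag (i : 'I_n.+2) : mink (col i (dmx e x)) (col i (e x)) = 0.
Proof. by have := phi_skew i i; lra. Qed.

End PhiCoordinates.

(** With rows ordered g0, ..., g3 and the first row (0, 0, A, B), minus the determinant is the value
    at (0, A, B) of the quadratic form given by the adjugate of the Gram matrix of g1, g2, g3.
    Keeping the eight products as scalar arguments allows differentiation in them. *)
Definition gram_poly (A B C E G K M U : R) : R :=
  A ^+ 2 * (C * U - G ^+ 2) - 2 * A * B * (C * M - E * G) + B ^+ 2 * (C * K - E ^+ 2).

(* Minus the Gram determinant of [g0, ..., g3], provided [g0] is null and orthogonal to [g1] *)
Definition gramP (g0 g1 g2 g3 : V) : R :=
  gram_poly (mink g0 g2) (mink g0 g3) (mink g1 g1) (mink g1 g2) (mink g1 g3)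
    (mink g2 g2) (mink g2 g3) (mink g3 g3).

(** The exponents come from weights. Multiplying the lift by k multiplies the determinant by k^8 and
    <g1,g1> by k^2, so the quotient does not change. Each g_i has weight -i in s, so the determinant
    has weight -12 and the quotient -3 + 2 = -1, which the factor s in front of [arcden]
    compensates. *)
Definition arcden (g0 g1 g2 g3 : V) : R :=
  Num.sqrt (Num.sqrt (gramP g0 g1 g2 g3)) / mink g1 g1.

(** A triangular change of vectors multiplies a Gram determinant by the square of the product of its
    diagonal entries, and for e0, e1, en, p that determinant is -<p,p>. *)
Lemma gramP_triangular (e0 e1 en p : V) (a b0 b1 c0 c1 cn d0 d1 dn dp : R) :
  [/\ mink e0 e0 = 0, mink e0 e1 = 0, mink e1 e1 = 1, mink e0 en = -1 & mink en en = 0] ->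
  [/\ mink e1 en = 0, mink e0 p = 0, mink e1 p = 0 & mink en p = 0] ->
  gramP (a *: e0) (b0 *: e0 + b1 *: e1) (c0 *: e0 + c1 *: e1 + cn *: en)
    (d0 *: e0 + d1 *: e1 + dn *: en + dp *: p)
  = (a * b1 * cn * dp) ^+ 2 * mink p p.
Proof.
move=> [h00 h01 h11 h0n hnn] [h1n h0p h1p hnp].
rewrite /gramP /gram_poly !minkE (minkC e1 e0) (minkC en e0) (minkC en e1) (minkC p e0) (minkC p e1) (minkC p en).
rewrite h00 h01 h11 h0n hnn h1n h0p h1p hnp; ring.
Qed.

End FrameAlgebra.

Section DensityFormula.
Variables (R : realType) (n : nat).
Hypothesis n2 : (2 <= n)%N.
Local Notation V := 'cV[R]_(n.+2).
Local Notation ix := (@idx n).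

Lemma ix1_mid : (1 <= ix 1 <= n)%N.
Proof. by rewrite val_ix // (ltnW n2). Qed.

Section SecondOrder.
Variables (I J : set R) (F : R -> V) (e : R -> 'M[R]_(n.+2)).
Hypothesis so : second_order I F J e.

Lemma second_order_open : open J. Proof. by case: so => [[]]. Qed.
Lemma second_order_smooth : smoothmx J e. Proof. by case: so => [[]]. Qed.
Lemma second_order_isometry x : J x -> isometry (e x).
Proof. by case: so => [[_ _ _ H] _] /H [] /mob_isometry. Qed.
Lemma second_order_sub : J `<=` I. Proof. by case: so => [[]]. Qed.

Let oJ := second_order_open.
Let se := second_order_smooth.
Let ie := second_order_isometry.

Lemma frame_table x : J x ->
  [/\ mink (col (ix 0) (e x)) (col (ix 0) (e x)) = 0,
      mink (col (ix 0) (e x)) (col (ix 1) (e x)) = 0,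
      mink (col (ix 1) (e x)) (col (ix 1) (e x)) = 1,
      mink (col (ix 0) (e x)) (col (ix n.+1) (e x)) = -1 &
      mink (col (ix n.+1) (e x)) (col (ix n.+1) (e x)) = 0].
Proof.
move=> Jx; have [b00 b0n bnn] := mink_bvec_ends R n.
have [b01 bn1] := mink_bvec_end_mid R ix1_mid.
rewrite !isometry_col ?b00 ?b01 ?b0n ?bnn ?(mink_bvec_mid_mid _ _ ix1_mid) ?eqxx //; exact: ie.
Qed.

Lemma frame_table1n x : J x -> mink (col (ix 1) (e x)) (col (ix n.+1) (e x)) = 0.
Proof.
move=> Jx; rewrite isometry_col; last exact: ie.
by rewrite minkC; case: (mink_bvec_end_mid R ix1_mid).
Qed.

Lemma frame_table_mid x (i : 'I_n.+2) : J x -> (2 <= i <= n)%N ->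
  [/\ mink (col (ix 0) (e x)) (col i (e x)) = 0,
      mink (col (ix 1) (e x)) (col i (e x)) = 0 &
      mink (col (ix n.+1) (e x)) (col i (e x)) = 0].
Proof.
move=> Jx /andP[i2 i_n]; rewrite !isometry_col; try exact: ie.
have i1n : (1 <= i <= n)%N by rewrite i_n (ltnW i2).
have [-> ->] := mink_bvec_end_mid R i1n; split=> //.
by rewrite mink_bvec_mid_mid ?ix1_mid // eq_sym eq_ix // gtn_eqF.
Qed.

Local Notation E i x := (col (ix i) (e x)).
Local Notation ph i j x := (phi e x (ix i) (ix j)).

Lemma ix_cases1 (P : 'I_n.+2 -> Prop) : P (ix 0) -> P (ix 1) -> P (ix n.+1) ->
  (forall i : 'I_n.+2, (2 <= i <= n)%N -> P i) -> forall i, P i.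
Proof.
move=> P0 P1 Pn Pm; apply: ix_cases => // i /andP[i1 i_n].
have [i1'|i1'] := eqVneq (i : nat) 1%N; first by rewrite -(idxK i) i1'.
by apply: Pm; rewrite i_n andbT ltn_neqAle eq_sym i1' i1.
Qed.

Lemma second_order_D0 x : J x ->
  vderiv (fun y => E 0 y) x (ph 0 0 x *: E 0 x + ph 1 0 x *: E 1 x).
Proof.
move=> Jx; suff <- : col (ix 0) (dmx e x) = ph 0 0 x *: E 0 x + ph 1 0 x *: E 1 x.
  exact: vderiv_col se Jx.
have [t00 t01 t11 t0n tnn] := frame_table Jx; have t1n := frame_table1n Jx.
apply: (frame_ext (ie Jx)); apply: ix_cases1; rewrite ?minkDl ?minkZl.
- by rewrite (phi_skew_diag oJ se ie Jx) (minkC (E 1 x)) t00 t01; ring.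
- by rewrite (phi_mid ie Jx _ ix1_mid) t01 t11; ring.
- by rewrite (phi_col0 ie Jx) t0n t1n; ring.
- move=> i i2n; rewrite ?minkDl ?minkZl; have [-> -> _] := frame_table_mid Jx i2n.
  case: so => _ /(_ x Jx i i2n) [p0 _].
  by rewrite (phi_mid ie Jx) ?p0; [ring|case/andP: i2n => i2 ->; rewrite (ltnW i2)].
Qed.

(** The coefficient of the last column equals phi^1_0 because the connection form is skew: it is
    minus the product of e_1' with e_0, hence the product of e_0' with e_1. *)
Lemma second_order_D1 x : J x ->
  vderiv (fun y => E 1 y) x (ph 0 1 x *: E 0 x + ph 1 0 x *: E n.+1 x).
Proof.
move=> Jx; suff <- : col (ix 1) (dmx e x) = ph 0 1 x *: E 0 x + ph 1 0 x *: E n.+1 x.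
  exact: vderiv_col se Jx.
have [t00 t01 t11 t0n tnn] := frame_table Jx; have t1n := frame_table1n Jx.
apply: (frame_ext (ie Jx)); apply: ix_cases1; rewrite ?minkDl ?minkZl.
- by rewrite (phi_skew oJ se ie Jx) (phi_mid ie Jx _ ix1_mid) (minkC (E n.+1 x)) t00 t0n; ring.
- by rewrite (phi_skew_diag oJ se ie Jx) t01 (minkC (E n.+1 x)) t1n; ring.
- by rewrite (phi_col0 ie Jx) t0n tnn; ring.
- move=> i i2n; rewrite ?minkDl ?minkZl; have [-> _ ->] := frame_table_mid Jx i2n.
  case: so => _ /(_ x Jx i i2n) [_ p0].
  by rewrite (phi_mid ie Jx) ?p0; [ring|case/andP: i2n => i2 ->; rewrite (ltnW i2)].
Qed.

(** The vector p is the component of the derivative of e_{n+1} in the span of e_2, ..., e_n. Its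
    square is psq times (phi^1_0)^2 wherever phi^1_0 is not 0: this is how the arclength enters the
    Gram determinant. *)
Lemma second_order_Dn x : J x -> exists p : V,
  [/\ vderiv (fun y => E n.+1 y) x (ph 0 1 x *: E 1 x - ph 0 0 x *: E n.+1 x + p),
      [/\ mink (E 0 x) p = 0, mink (E 1 x) p = 0 & mink (E n.+1 x) p = 0],
      forall i : 'I_n.+2, (2 <= i <= n)%N -> mink p (col i (e x)) = phi e x (ix 0) i &
      mink p p = \sum_(a < n.+2 | (2 <= a <= n)%N) (phi e x (ix 0) a) ^+ 2].
Proof.
move=> Jx.
have [t00 t01 t11 t0n tnn] := frame_table Jx; have t1n := frame_table1n Jx.
pose p := col (ix n.+1) (dmx e x) - ph 0 1 x *: E 1 x + ph 0 0 x *: E n.+1 x.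
have p0 : mink (E 0 x) p = 0.
  rewrite minkC /p !minkE (phi_skew oJ se ie Jx) (phi_col0 ie Jx).
  by rewrite (minkC (E 1 x)) (minkC (E n.+1 x)) t01 t0n; ring.
have p1 : mink (E 1 x) p = 0.
  rewrite minkC /p !minkE (phi_skew oJ se ie Jx) (phi_col0 ie Jx).
  by rewrite (minkC (E n.+1 x)) t1n t11; ring.
have pn : mink (E n.+1 x) p = 0.
  by rewrite minkC /p !minkE (phi_skew_diag oJ se ie Jx) t1n tnn; ring.
have pm (i : 'I_n.+2) : (2 <= i <= n)%N -> mink p (col i (e x)) = phi e x (ix 0) i.
  move=> i2n; rewrite /p !minkE (phi_skew oJ se ie Jx) (phi_col0 ie Jx).
  by have [_ -> ->] := frame_table_mid Jx i2n; ring.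
exists p; split=> //.
- have -> : ph 0 1 x *: E 1 x - ph 0 0 x *: E n.+1 x + p = col (ix n.+1) (dmx e x).
    by apply/matrixP => i j; rewrite /p !mxE; ring.
  exact: vderiv_col se Jx.
- rewrite (frame_parseval p (ie Jx)) (minkC p) p0 mul0r mulr0 subr0.
  rewrite (bigD1 (ix 1)) ?ix1_mid //= (minkC p) p1 expr0n add0r.
  apply: eq_big => [i|i].
    by rewrite eq_ix //; case: (i : nat) => [|[|m]]; rewrite ?andbF ?andbT.
  move=> /andP[/andP[i1 i_n]]; rewrite eq_ix // => i1'; rewrite pm //.
  by rewrite i_n andbT ltn_neqAle eq_sym i1' i1.
Qed.

Variables (H0 H1 H2 : R -> V) (H3 : V) (s : R -> R) (x : R).
Hypotheses (H0F : forall y, J y -> exists c, H0 y = c *: F y)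
  (s0 : forall y, J y -> 0 < s y) (Jx : J x)
  (dH0 : forall y, J y -> vderiv H0 y (s y *: H1 y))
  (dH1 : forall y, J y -> vderiv H1 y (s y *: H2 y))
  (dH2 : vderiv H2 x (s x *: H3)) (H1x : mink (H1 x) (H1 x) != 0).

(* [H0] is a multiple of [e_0]; differentiating, one finds [H1], [H2] and [H3] in a triangular form
   to which [gramP_triangular] applies. *)
Lemma dens_formula : dens e x = s x * arcden (H0 x) (H1 x) (H2 x) H3.
Proof.
have sn y : J y -> s y != 0 by move=> /s0 /gt_eqF ->.
(* The factor supplied by [H0F] is chosen point by point and has no regularity. Written as a product
   with e_{n+1} it is visibly differentiable; the coefficients of [H1] and [H2] are treated in the
   same way. *)
pose k y := - mink (H0 y) (E n.+1 y).
have H0E y : J y -> H0 y = k y *: E 0 y.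
  move=> Jy; case: so => [[_ _ _ /(_ y Jy) [_ [c [c0 cE]]]] _].
  have [d dE] := H0F Jy.
  have Hd : H0 y = (d / c) *: E 0 y by rewrite cE scalerA divfK.
  rewrite /k Hd minkZl; have [_ _ _ -> _] := frame_table Jy.
  by rewrite mulrN1 opprK.
have der_mink (G : R -> V) y i (d : V) : J y -> vderiv G y d ->
    exists d', is_derive y (1 : R) (fun z => mink (G z) (E i z)) d'.
  move=> Jy dG; exists (mink d (E i y) + mink (G y) (col (ix i) (dmx e y))).
  exact: (vderiv_mink dG (vderiv_col (ix i) se Jy)).
have der_k y : J y -> exists d, is_derive y (1 : R) k d.
  move=> Jy; have [d dk] := der_mink _ _ n.+1 _ Jy (dH0 Jy).
  by exists (- d); exact: is_derive1N.
have H1E y : J y -> exists a, H1 y = a *: E 0 y + (k y * ph 1 0 y / s y) *: E 1 y.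
  move=> Jy; have [dk Hk] := der_k y Jy.
  have := vderivZ Hk (second_order_D0 Jy).
  move=> /(vderiv_ext oJ Jy (fun z Jz => esym (H0E z Jz))) /(vderiv_unique (dH0 Jy)) EQ.
  exists ((dk + k y * ph 0 0 y) / s y).
  apply: (scalerI (sn y Jy)); rewrite EQ scalerDr !scalerDr !scalerA addrA -scalerDl.
  by congr (_ *: _ + _ *: _); field; exact: sn.
pose a y := - mink (H1 y) (E n.+1 y); pose b y := mink (H1 y) (E 1 y).
have bE y : J y -> b y = k y * ph 1 0 y / s y.
  move=> Jy; have [a' H] := H1E y Jy; rewrite /b H minkDl !minkZl.
  by have [_ -> -> _ _] := frame_table Jy; rewrite mulr0 add0r mulr1.
have H1E' y : J y -> H1 y = a y *: E 0 y + b y *: E 1 y.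
  move=> Jy; rewrite bE //; have [a' H] := H1E y Jy.
  have -> : a y = a'; last by [].
  rewrite /a H minkDl !minkZl; have [_ _ _ -> _] := frame_table Jy.
  by rewrite (frame_table1n Jy) mulr0 addr0 mulrN1 opprK.
have der_a y : J y -> exists d, is_derive y (1 : R) a d.
  move=> Jy; have [d dk] := der_mink _ _ n.+1 _ Jy (dH1 Jy).
  by exists (- d); exact: is_derive1N.
have der_b y : J y -> exists d, is_derive y (1 : R) b d.
  by move=> Jy; exact: der_mink _ _ 1%N _ Jy (dH1 Jy).
have H2E y : J y -> exists c0 c1, H2 y = c0 *: E 0 y + c1 *: E 1 y + (b y * ph 1 0 y / s y) *: E n.+1 y.
  move=> Jy; have [da Ha] := der_a y Jy; have [db Hb] := der_b y Jy.
  have := vderivD (vderivZ Ha (second_order_D0 Jy)) (vderivZ Hb (second_order_D1 Jy)).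
  move=> /(vderiv_ext oJ Jy (fun z Jz => esym (H1E' z Jz))) /(vderiv_unique (dH1 Jy)) EQ.
  exists ((da + a y * ph 0 0 y + b y * ph 0 1 y) / s y), ((a y * ph 1 0 y + db) / s y).
  apply: (scalerI (sn y Jy)); rewrite EQ; apply/matrixP => i j; rewrite !mxE.
  by field; exact: sn.
pose c0 y := - mink (H2 y) (E n.+1 y); pose c1 y := mink (H2 y) (E 1 y).
pose cn y := - mink (H2 y) (E 0 y).
have H2c y : J y -> [/\ H2 y = c0 y *: E 0 y + c1 y *: E 1 y + cn y *: E n.+1 y &
    cn y = b y * ph 1 0 y / s y].
  move=> Jy; have [d0 [d1 H]] := H2E y Jy.
  have [t00 t01 t11 t0n tnn] := frame_table Jy; have t1n := frame_table1n Jy.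
  have -> : cn y = b y * ph 1 0 y / s y.
    rewrite /cn H !minkE t00 (minkC (E 1 y)) t01 (minkC (E n.+1 y)) t0n; ring.
  split=> //.
  have -> : c0 y = d0 by rewrite /c0 H !minkE t0n t1n tnn; ring.
  by have -> : c1 y = d1 by rewrite /c1 H !minkE t01 t11 (minkC (E n.+1 y)) t1n; ring.
have [t00 t01 t11 t0n tnn] := frame_table Jx; have t1n := frame_table1n Jx.
have [p [dEn [p0 p1 pn] _ pp]] := second_order_Dn Jx.
have [d0 [d1 [dn H3E]]] : exists d0 d1 dn, H3 = d0 *: E 0 x + d1 *: E 1 x + dn *: E n.+1 x + (cn x / s x) *: p.
  have [dc0 Hc0] := der_mink _ _ n.+1 _ Jx dH2.
  have [dc1 Hc1] := der_mink _ _ 1%N _ Jx dH2.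
  have [dcn Hcn] := der_mink _ _ 0%N _ Jx dH2.
  have := vderivD (vderivD (vderivZ (is_derive1N Hc0) (second_order_D0 Jx))
     (vderivZ Hc1 (second_order_D1 Jx))) (vderivZ (is_derive1N Hcn) dEn).
  have HE z (Jz : J z) : c0 z *: E 0 z + c1 z *: E 1 z + cn z *: E n.+1 z = H2 z.
    by case: (H2c z Jz) => <-.
  move=> /(vderiv_ext oJ Jx HE) /(vderiv_unique dH2) EQ.
  exists ((- dc0 + c0 x * ph 0 0 x + c1 x * ph 0 1 x) / s x),
    ((c0 x * ph 1 0 x + dc1 + cn x * ph 0 1 x) / s x),
    ((c1 x * ph 1 0 x - dcn - cn x * ph 0 0 x) / s x).
  apply: (scalerI (sn x Jx)); rewrite EQ; apply/matrixP => i j; rewrite !mxE -/(c0 x) -/(c1 x) /cn.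
  by field; exact: sn.
have [H2x cnE] := H2c x Jx.
have HG : gramP (H0 x) (H1 x) (H2 x) H3 = (k x * b x * cn x * (cn x / s x)) ^+ 2 * mink p p.
  rewrite H3E H2x (H1E' x Jx) (H0E x Jx).
  exact: gramP_triangular.
have H11 : mink (H1 x) (H1 x) = b x ^+ 2.
  by rewrite (H1E' x Jx) !minkE t00 (minkC (E 1 x) (E 0 x)) t01 t11; ring.
have b0 : b x != 0 by move: H1x; rewrite H11 sqrf_eq0.
have sx := s0 Jx; have bx := bE x Jx.
have k0 : k x != 0 by apply: contra_neq b0 => kx; rewrite bx kx mul0r mul0r.
have ph0 : ph 1 0 x != 0 by apply: contra_neq b0 => px; rewrite bx px mulr0 mul0r.
have psqE : mink p p = ph 1 0 x ^+ 2 * psq e x.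
  rewrite pp /psq mulr_sumr; apply: eq_bigr => i _; rewrite exprMn exprVn.
  by field.
(* The determinant is (k^4 phi^5 / s^6)^2 <p,p> = k^8 phi^12 / s^12 psq with phi = phi^1_0, and q is
   the fourth root of the factor of psq. The absolute value is essential, since phi^1_0 may be
   negative in a second order frame. *)
pose q := k x ^+ 2 * `|ph 1 0 x| ^+ 3 / s x ^+ 3.
have q0 : 0 <= q.
  apply: mulr_ge0; first by apply: mulr_ge0; [exact: sqr_ge0|exact: exprn_ge0].
  by rewrite invr_ge0 exprn_ge0 // ltW.
have abs2 : `|ph 1 0 x| ^+ 2 = ph 1 0 x ^+ 2 by rewrite real_normK // num_real.
have GE : gramP (H0 x) (H1 x) (H2 x) H3 = (q ^+ 2) ^+ 2 * psq e x.
  rewrite HG psqE cnE bx /q.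
  have -> : ((k x ^+ 2 * `|ph 1 0 x| ^+ 3 / s x ^+ 3) ^+ 2) ^+ 2 =
     k x ^+ 8 * (`|ph 1 0 x| ^+ 2) ^+ 6 / s x ^+ 12 by field; exact: sn.
  by rewrite abs2; field; exact: sn.
rewrite /dens /arcden GE.
have -> : Num.sqrt ((q ^+ 2) ^+ 2 * psq e x) = q ^+ 2 * Num.sqrt (psq e x).
  by rewrite sqrtrM ?sqr_ge0 // sqrtr_sqr ger0_norm // sqr_ge0.
rewrite sqrtrM ?sqr_ge0 // sqrtr_sqr (ger0_norm q0) H11 bx /q.
have -> : (k x * ph 1 0 x / s x) ^+ 2 = k x ^+ 2 * `|ph 1 0 x| ^+ 2 / s x ^+ 2.
  by rewrite abs2; field; exact: sn.
have nph0 : `|ph 1 0 x| != 0 by rewrite normr_eq0.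
by field; rewrite k0 nph0 (sn x Jx).
Qed.

End SecondOrder.
End DensityFormula.

(** * Second order frames along an arbitrary immersion *)

Lemma mink_neq0 (R : realType) n (u v : 'cV[R]_(n.+2)) : mink u v = -1 -> u != 0.
Proof.
by move=> uv; apply/eqP => u0; move/eqP: uv; rewrite u0 mink0l eq_sym oppr_eq0 oner_eq0.
Qed.

(** The image v + w of [Tvec] has square -2 and product -1 with v, so it is future-pointing as soon
    as v is. *)
Lemma mink_Tvec_lt0 (R : realType) n (Q : 'M[R]_(n.+2)) v w :
  Q *m bvec R (idx n 0) = v -> Q *m bvec R (idx n n.+1) = w ->
  mink v v = 0 -> mink v w = -1 -> mink w w = 0 -> 0 < v (idx n 0) 0 + v (idx n n.+1) 0 ->
  mink (Q *m Tvec R n) (Tvec R n) < 0.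
Proof.
move=> Qv Qw vv vw ww v0; rewrite mink_Tvec oppr_lt0 {1 2}TvecE mulmxDr Qv Qw.
apply: (@timelike_future _ _ _ v) => //; last by rewrite minkDl (minkC w) vv vw; lra.
  by rewrite !minkE (minkC w) vv vw ww; lra.
exact: mink_neq0 vw.
Qed.

(** For a null vector, twice the product of the extreme coordinates is a sum of squares. They
    therefore never have opposite signs, and their sum vanishes only for the zero vector. *)
Lemma null_future_sign (R : realType) n (v : 'cV[R]_(n.+2)) : mink v v = 0 -> v != 0 ->
  exists s : R, (s = 1 \/ s = -1) /\ 0 < s * (v (idx n 0) 0 + v (idx n n.+1) 0).
Proof.
move=> vv v0; have sq := mink_sqr v; rewrite vv in sq; have sg := sumsq_ge0 v.
have p0 : 0 <= v (idx n 0) 0 * v (idx n n.+1) 0 by lra.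
have [c0|c0|c0] := ltrgtP 0 (v (idx n 0) 0 + v (idx n n.+1) 0).
- by exists 1; split; [left|rewrite mul1r].
- by exists (-1); split; [right|rewrite mulN1r oppr_gt0].
have z0 : v (idx n 0) 0 = 0 by nra.
have zn : v (idx n n.+1) 0 = 0 by lra.
by move: v0; rewrite (null_eq0 vv z0 zn) eqxx.
Qed.

Section SecondOrderExistence.
Variables (R : realType) (n : nat).
Hypothesis n2 : (2 <= n)%N.
Local Notation V := 'cV[R]_(n.+2).
Local Notation ix := (@idx n).
Variables (I : set R) (F : R -> V).
Hypotheses (oI : open I) (liF : lift_immersion I F).

Lemma lift_smooth : smoothmx I F. Proof. by case: liF. Qed.
Lemma lift_null x : I x -> mink (F x) (F x) = 0.
Proof. by case: liF => _ H /H []. Qed.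
Lemma lift_neq0 x : I x -> F x != 0.
Proof. by case: liF => _ H /H []. Qed.

Lemma lift_vderiv x : I x -> vderiv F x (dmx F x).
Proof. exact: smoothmx_vderiv lift_smooth. Qed.

Lemma vderiv_null (J : set R) (G : R -> V) x d c : open J -> J x ->
  (forall y, J y -> mink (G y) (G y) = c) -> vderiv G x d -> mink (G x) d = 0.
Proof.
move=> oJ Jx Gc dG.
have := is_derive1_ext oJ Jx (fun y Jy => esym (Gc y Jy)) (is_derive1_cst c x).
move=> /(is_derive1_unique (vderiv_mink dG dG)).
by rewrite (minkC d) => H; lra.
Qed.

Lemma lift_deriv_orth x : I x -> mink (F x) (dmx F x) = 0.
Proof. by move=> Ix; exact: (vderiv_null oI Ix lift_null (lift_vderiv Ix)). Qed.

Lemma lift_speed_gt0 x : I x -> 0 < mink (dmx F x) (dmx F x).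
Proof.
move=> Ix; apply: (@null_orth_gt0 _ _ (F x)).
- exact: lift_null.
- exact: lift_neq0.
- exact: lift_deriv_orth.
- by case: liF => _ /(_ x Ix) [].
Qed.

Lemma smooth_speed : smooth1 I (fun x => mink (dmx F x) (dmx F x)).
Proof. by apply: (smooth1_mink oI); exact: (smoothmx_dmx oI lift_smooth). Qed.

(** This is stated for every immersion because it is applied to varied curves. The lift G with |G'|
    = 1 satisfies <G,G''> = -1, and G'' corrected by a multiple of G is null. With G, G' and this
    vector as columns 0, 1, n+1, the derivatives of the first two columns have no component along
    e_2, ..., e_n. *)
Lemma second_order_exists x0 : I x0 -> exists J e, second_order I F J e /\ J x0.
Proof.
move=> Ix0; have [sg [sgE sg0]] := null_future_sign (lift_null Ix0) (lift_neq0 Ix0).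
pose fut x := sg * (F x (ix 0) 0 + F x (ix n.+1) 0).
pose J0 := [set x | I x /\ 0 < fut x].
have sfut : smooth1 I fut.
  apply: (smooth1M oI); first exact: smooth1_cst.
  by apply: (smooth1D oI); exact: lift_smooth.
have oJ0 : open J0 by apply: open_setI_gt0 => // x Ix; exact: smooth1_continuous sfut Ix.
have J0x : J0 x0 by [].
have J0I : J0 `<=` I by move=> x [].
pose rho x := sg / Num.sqrt (mink (dmx F x) (dmx F x)).
have sv x : I x -> 0 < Num.sqrt (mink (dmx F x) (dmx F x)).
  by move=> Ix; rewrite sqrtr_gt0 lift_speed_gt0.
have sg_n0 : sg != 0 by case: sgE => ->; rewrite ?oppr_eq0 oner_eq0.
have rho0 x : I x -> rho x != 0.
  by move=> Ix; rewrite mulf_neq0 // invr_neq0 // gt_eqF // sv.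
have rho2 x : I x -> rho x ^+ 2 * mink (dmx F x) (dmx F x) = 1.
  move=> Ix; have -> : rho x ^+ 2 = sg ^+ 2 / Num.sqrt (mink (dmx F x) (dmx F x)) ^+ 2.
    by rewrite /rho exprMn exprVn.
  rewrite sqr_sqrtr; last exact: ltW (lift_speed_gt0 Ix).
  rewrite divfK; last by rewrite gt_eqF // lift_speed_gt0.
  by case: sgE => ->; rewrite ?sqrrN expr1n.
have srho : smooth1 I rho.
  apply: (smooth1M oI); first exact: smooth1_cst.
  apply: (smooth1V oI) => [x Ix|]; first by rewrite gt_eqF // sv.
  by apply: (smooth1_sqrt oI) => [x Ix|]; [exact: lift_speed_gt0|exact: smooth_speed].
pose G x := rho x *: F x.
have sG : smoothmx I G := smoothmxZ oI srho lift_smooth.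
pose G1 := dmx G; have sG1 : smoothmx I G1 := smoothmx_dmx oI sG.
pose G2 := dmx G1; have sG2 : smoothmx I G2 := smoothmx_dmx oI sG1.
(* Since <G,G''> = -1, the square of G'' - mu G is <G'',G''> + 2 mu; this value of mu makes it
   null. *)
pose mu x := - (1 / 2) * mink (G2 x) (G2 x).
pose en x := G2 x - mu x *: G x.
have smu : smooth1 I mu.
  by apply: (smooth1M oI); [exact: smooth1_cst|exact: smooth1_mink].
have sen : smoothmx I en by apply: (smoothmxB oI sG2); exact: (smoothmxZ oI).
have dG x (Ix : I x) : vderiv G x (G1 x) := smoothmx_vderiv sG Ix.
have dG1 x (Ix : I x) : vderiv G1 x (G2 x) := smoothmx_vderiv sG1 Ix.
have GE x : G x = rho x *: F x by [].
have G1E x : G1 x = dmx G x by [].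
have muE x : mu x = - (1 / 2) * mink (G2 x) (G2 x) by [].
have enE x : en x = G2 x - mu x *: G x by [].
clearbody en mu G2 G1.
have g00 x : I x -> mink (G x) (G x) = 0.
  by move=> Ix; rewrite GE !minkE lift_null // !mulr0.
have g01 x : I x -> mink (G x) (G1 x) = 0.
  by move=> Ix; exact: (vderiv_null oI Ix g00 (dG x Ix)).
have g11 x : I x -> mink (G1 x) (G1 x) = 1.
  move=> Ix.
  have -> : G1 x = derive1 rho x *: F x + rho x *: dmx F x.
    rewrite G1E.
    exact: vderiv_dmx (vderivZ (smooth1_is_derive1 srho Ix) (lift_vderiv Ix)).
  rewrite !minkE (minkC (dmx F x)) lift_null // lift_deriv_orth // -(rho2 x Ix); ring.
clearbody G.
have g12 x : I x -> mink (G1 x) (G2 x) = 0.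
  by move=> Ix; exact: (vderiv_null oI Ix g11 (dG1 x Ix)).
have g02 x : I x -> mink (G x) (G2 x) = -1.
  move=> Ix; have := is_derive1_ext oI Ix (fun y Iy => esym (g01 y Iy)) (is_derive1_cst 0 x).
  move=> /(is_derive1_unique (vderiv_mink (dG x Ix) (dG1 x Ix))).
  by rewrite g11 // => H; lra.
have en0 x : I x -> mink (G x) (en x) = -1.
  by move=> Ix; rewrite enE !minkE g00 // g02 //; ring.
have enn x : I x -> mink (en x) (en x) = 0.
  by move=> Ix; rewrite enE !minkE (minkC (G2 x) (G x)) g00 // g02 // muE; field.
have en1 x : I x -> mink (en x) (G1 x) = 0.
  by move=> Ix; rewrite enE !minkE (minkC (G2 x) (G1 x)) g12 // g01 //; ring.
have [J [Q [oJ Jx JJ0 sQ HQ]]] := @adapted_isometry _ _ J0 G G1 en x0 (ltnW n2) oJ0 J0x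
  (smoothmx_subset J0I sG) (smoothmx_subset J0I sG1) (smoothmx_subset J0I sen)
  (fun x Jx => And3 (g00 x Jx.1) (en0 x Jx.1) (enn x Jx.1))
  (fun x Jx => And3 (g11 x Jx.1) (g01 x Jx.1) (en1 x Jx.1)).
have JI : J `<=` I by move=> x /JJ0 [].
have fut_e x : J x -> mink (Q x *m Tvec R n) (Tvec R n) < 0.
  move=> Jx'; have [iQ Q0 Q1 Qn] := HQ x Jx'; have [Ix fx] := JJ0 x Jx'.
  apply: (mink_Tvec_lt0 Q0 Qn (g00 x Ix) (en0 x Ix) (enn x Ix)).
  by rewrite GE !mxE -mulrDr /rho mulrAC; apply: divr_gt0 => //; exact: sv.
have [e [se mobe colE]] := @mob_of_isometry _ _ J Q (ltnW n2) oJ sQ (fun x Jx => let: And4 a _ _ _ := HQ x Jx in a) fut_e.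
  exists J, e; split; last exact: Jx.
  have c0 x : J x -> col (ix 0) (e x) = G x.
    by move=> Jx'; rewrite colE ?ltn_eqF ?(ltnW n2) //; case: (HQ x Jx').
  have c1 x : J x -> col (ix 1) (e x) = G1 x.
    by move=> Jx'; rewrite colE ?ltn_eqF ?(ltnW n2) //; case: (HQ x Jx').
  have cn x : J x -> col (ix n.+1) (e x) = en x.
    by move=> Jx'; rewrite colE ?gtn_eqF ?(ltnW n2) //; case: (HQ x Jx').
  split.
    split=> // x Jx'; split; first exact: mobe.
    by exists (rho x); split; [exact: rho0 (JI _ Jx')|rewrite c0].
  move=> x Jx' a a2n; have iex : isometry (e x) := mob_isometry (mobe x Jx').
  have a1n : (1 <= a <= n)%N by case/andP: a2n => a2 ->; rewrite (ltnW a2).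
  have ie' y : J y -> isometry (e y) by move=> Jy; exact: mob_isometry (mobe y Jy).
  have [b0a bna] := mink_bvec_end_mid R a1n.
  have b1a : mink (bvec R (ix 1)) (bvec R a) = 0.
    by rewrite minkC mink_bvec_mid_mid // eq_ix // gtn_eqF //; case/andP: a2n.
  rewrite -!(phi_mid ie' Jx' _ a1n).
  have D0 : col (ix 0) (dmx e x) = G1 x.
    exact: (vderiv_unique (vderiv_col (ix 0) se Jx') (vderiv_ext oJ Jx' (fun y Jy => esym (c0 y Jy)) (dG x (JI _ Jx')))).
  have D1 : col (ix 1) (dmx e x) = G2 x.
    exact: (vderiv_unique (vderiv_col (ix 1) se Jx') (vderiv_ext oJ Jx' (fun y Jy => esym (c1 y Jy)) (dG1 x (JI _ Jx')))).
  have G2E : G2 x = en x + mu x *: G x by rewrite enE subrK.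
  rewrite D0 D1 G2E -(c1 x Jx') -(c0 x Jx') -(cn x Jx') !minkE !isometry_col //.
  by rewrite b0a b1a bna; split; ring.
Qed.

Lemma second_order_restrict (J W : set R) (e : R -> 'M[R]_(n.+2)) : open W ->
  second_order I F J e -> second_order I F (J `&` W) e.
Proof.
move=> oW [[oJ JI se H1] H2]; split; last by move=> x [Jx _]; exact: H2.
split; [exact: openI|by move=> x [/JI]| |by move=> x [/H1]].
by apply: (smoothmx_subset _ se) => x [].
Qed.

(** Whichever frame [xget] has chosen, [dens_formula] evaluates its density by an expression that
    mentions no frame; the independence of the arclength from the frame is contained in this. *)
Lemma cds_formula (J : set R) (H0 H1 H2 : R -> V) (H3 : V) (s : R -> R) x :
  open J -> J `<=` I -> J x ->
  (forall y, J y -> exists c, H0 y = c *: F y) ->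
  (forall y, J y -> 0 < s y) ->
  (forall y, J y -> vderiv H0 y (s y *: H1 y)) ->
  (forall y, J y -> vderiv H1 y (s y *: H2 y)) ->
  vderiv H2 x (s x *: H3) -> mink (H1 x) (H1 x) != 0 ->
  cds I F x = s x * arcden (H0 x) (H1 x) (H2 x) H3.
Proof.
move=> oJ JI Jx H0F s0 dH0 dH1 dH2 H11.
have [J1 [e1 [so1 J1x]]] := second_order_exists (JI _ Jx).
rewrite /cds; set P := [set r | _].
have : P (xget 0 P) by apply: xgetPex; exists (dens e1 x), J1, e1.
move=> [J2 [e [so [J2x ->]]]].
have so' := second_order_restrict oJ so.
by apply: (@dens_formula _ _ n2 _ _ _ _ so') => [y [_ /H0F]|y [_ /s0]||y [_ /dH0]|y [_ /dH1]||].
Qed.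

Lemma cds_formula_dx x : I x -> cds I F x =
  arcden (F x) (dmx F x) (dmx (dmx F) x) (dmx (dmx (dmx F)) x).
Proof.
move=> Ix; have s1 := smoothmx_dmx oI lift_smooth; have s2 := smoothmx_dmx oI s1.
rewrite (@cds_formula I F (dmx F) (dmx (dmx F)) (dmx (dmx (dmx F)) x) (fun=> 1) x) //.
- by rewrite mul1r.
- by move=> y _; exists 1; rewrite scale1r.
- by move=> y Iy; rewrite scale1r; exact: lift_vderiv.
- by move=> y Iy; rewrite scale1r; exact: smoothmx_vderiv s1 Iy.
- by rewrite scale1r; exact: smoothmx_vderiv s2 Ix.
- by rewrite gt_eqF // lift_speed_gt0.
Qed.

End SecondOrderExistence.

(** * Canonical vectors of a curve and the Euler-Lagrange field *)

Section Canonical.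
Variables (R : realType) (n : nat).
Hypothesis n3 : (3 <= n)%N.
Local Notation V := 'cV[R]_(n.+2).
Local Notation ix := (@idx n).
Let n2 : (2 <= n)%N := ltnW n3.

(** For a special third order frame, e0, e1, en, e2 are the columns 0, 1, n+1, 2. The other columns
    are determined only up to rotation and enter solely through the vector X, which is why such a
    system can exist on the whole curve. *)
Record canonical (J : set R) (s mu : R -> R) (e0 e1 en e2 X : R -> V) : Prop := Canonical {
  can_open : open J;
  can_pos : forall x, J x -> 0 < s x;
  can_smooth_s : smooth1 J s;
  can_smooth_mu : smooth1 J mu;
  can_smooth0 : smoothmx J e0;
  can_smooth1 : smoothmx J e1;
  can_smoothn : smoothmx J en;
  can_smooth2 : smoothmx J e2;
  can_smoothX : smoothmx J X;
  can_D0 : forall x, J x -> vderiv e0 x (s x *: e1 x);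
  can_D1 : forall x, J x -> vderiv e1 x (s x *: (mu x *: e0 x + en x));
  can_Dn : forall x, J x -> vderiv en x (s x *: (mu x *: e1 x + e2 x));
  can_D2 : forall x, J x -> vderiv e2 x (s x *: (e0 x + X x));
  can_table : forall x, J x -> [/\ mink (e0 x) (e0 x) = 0, mink (e0 x) (e1 x) = 0,
     mink (e1 x) (e1 x) = 1, mink (e0 x) (en x) = -1 & mink (en x) (en x) = 0];
  can_table1n : forall x, J x -> mink (e1 x) (en x) = 0;
  can_table2 : forall x, J x -> [/\ mink (e0 x) (e2 x) = 0, mink (e1 x) (e2 x) = 0,
     mink (en x) (e2 x) = 0 & mink (e2 x) (e2 x) = 1] }.

Definition dds_vec (s : R -> R) (G : R -> V) (x : R) : V := (s x)^-1 *: dmx G x.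

(* The Euler-Lagrange field of the conformal arclength, up to the factor 1/2 and a multiple of [e0] *)
Definition EL (s mu : R -> R) (e2 X : R -> V) (x : R) : V :=
  - dds_vec s (dds_vec s X) x + (derive1 mu x / s x) *: e2 x + (2 * mu x) *: X x.

Lemma dds_vec_ext (U : set R) s s' (G G' : R -> V) x : open U -> U x ->
  (forall y, U y -> s y = s' y) -> (forall y, U y -> G y = G' y) ->
  dds_vec s G x = dds_vec s' G' x.
Proof. by move=> oU Ux ss GG; rewrite /dds_vec (dmx_ext oU Ux GG) ss. Qed.

Lemma EL_ext (U : set R) s s' mu mu' e2 e2' X X' x : open U -> U x ->
  (forall y, U y -> s y = s' y) -> (forall y, U y -> mu y = mu' y) ->
  (forall y, U y -> e2 y = e2' y) -> (forall y, U y -> X y = X' y) ->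
  EL s mu e2 X x = EL s' mu' e2' X' x.
Proof.
move=> oU Ux ss mm ee XX.
have H y (Uy : U y) := dds_vec_ext oU Uy ss XX.
rewrite /EL (derive1_ext oU Ux mm) (dds_vec_ext oU Ux ss H).
by rewrite (ss _ Ux) (mm _ Ux) (ee _ Ux) (XX _ Ux).
Qed.

Lemma smooth_dds_vec (J : set R) s (G : R -> V) : open J -> (forall x, J x -> 0 < s x) ->
  smooth1 J s -> smoothmx J G -> smoothmx J (dds_vec s G).
Proof.
move=> oJ s0 ss sG; apply: (smoothmxZ oJ); last exact: smoothmx_dmx.
by apply: (smooth1V oJ) => // x /s0 /gt_eqF ->.
Qed.

Lemma vderiv_dds_vec (J : set R) s (G : R -> V) x : (forall x, J x -> 0 < s x) ->
  smoothmx J G -> J x -> vderiv G x (s x *: dds_vec s G x).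
Proof.
move=> s0 sG Jx; rewrite /dds_vec scalerA divff ?scale1r; first exact: smoothmx_vderiv sG Jx.
by rewrite gt_eqF // s0.
Qed.

Lemma dds_vec_vderiv s (G : R -> V) x d : s x != 0 -> vderiv G x (s x *: d) -> dds_vec s G x = d.
Proof. by move=> s0 dG; rewrite /dds_vec (vderiv_dmx dG) scalerA mulVf // scale1r. Qed.

Section ThetaSections.
Variables (e : R -> 'M[R]_(n.+2)) (sg tau : 'I_(n.+2) -> R -> R) (y : R).
Hypothesis iA : isometry (e y).

Lemma mid3 (b : 'I_n.+2) : (3 <= b <= n)%N -> (1 <= b <= n)%N.
Proof. by case/andP => b3 ->; rewrite (ltn_trans _ b3). Qed.

Lemma mid2 (b : 'I_n.+2) : (2 <= b <= n)%N -> (1 <= b <= n)%N.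
Proof. by case/andP => b3 ->; rewrite (ltn_trans _ b3). Qed.

Lemma mink_sect_end (i : 'I_n.+2) : i = ix 0 \/ i = ix n.+1 ->
  mink (sect e sg y) (col i (e y)) = 0.
Proof.
move=> ii; rewrite /sect mink_suml big1 // => b b3n; rewrite minkZl isometry_col // minkC.
have [b0 bn] := mink_bvec_end_mid R (mid3 b3n).
by case: ii => ->; rewrite ?b0 ?bn mulr0.
Qed.

Lemma mink_sect_mid (i : 'I_n.+2) : (1 <= i <= n)%N ->
  mink (sect e sg y) (col i (e y)) = if (3 <= i)%N then sg i y else 0.
Proof.
move=> i1n; rewrite /sect mink_suml.
have E b : mink (sg b y *: col b (e y)) (col i (e y)) = sg b y * (i == b)%:R.
  by rewrite minkZl isometry_col // minkC mink_bvec_mid_mid.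
under eq_bigr do rewrite E.
case: ifP => i3.
  rewrite (bigD1 i) ?i3 /=; last by case/andP: i1n.
  rewrite eqxx mulr1 big1 ?addr0 // => b /andP[_ bi].
  by rewrite eq_sym (negbTE bi) mulr0.
rewrite big1 // => b /andP[b3 _]; case: eqP => [ib|_]; last by rewrite mulr0.
by rewrite ib b3 in i3.
Qed.

Lemma mink_sect_sect : mink (sect e sg y) (sect e tau y) =
  \sum_(b < n.+2 | (3 <= b <= n)%N) sg b y * tau b y.
Proof.
rewrite minkC {1}/sect mink_suml; apply: eq_bigr => b b3n.
rewrite minkZl minkC mink_sect_mid ?mid3 //.
by case/andP: b3n => -> _; rewrite mulrC.
Qed.

End ThetaSections.

Section SpecialFrame.
Variables (I J : set R) (F : R -> V) (e : R -> 'M[R]_(n.+2)).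
Hypothesis st : special_third I F J e.
Hypotheses (sc : smooth1 J (cds I F)) (c0 : forall x, J x -> 0 < cds I F x).
Local Notation s := (cds I F).
Local Notation E i x := (col (ix i) (e x)).

Let so : second_order I F J e. Proof. by case: st. Qed.
Let oJ := second_order_open so.
Let se := second_order_smooth so.
Let ie := second_order_isometry so.

Lemma special_phi x : J x -> [/\ phi e x (ix 1) (ix 0) = s x, phi e x (ix 0) (ix 2) = s x,
  phi e x (ix 0) (ix 0) = 0 & forall b : 'I_(n.+2), (3 <= b <= n)%N -> phi e x (ix 0) b = 0].
Proof. by case: st => _ /(_ x). Qed.

Let sn x : J x -> s x != 0. Proof. by move=> /c0 /gt_eqF ->. Qed.

Lemma ix2_mid : (2 <= ix 2 <= n)%N.
Proof. by rewrite val_ix ?n2 // (leq_trans n2). Qed.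

Lemma ix_cases2 (P : 'I_n.+2 -> Prop) : P (ix 0) -> P (ix 1) -> P (ix n.+1) -> P (ix 2) ->
  (forall i : 'I_n.+2, (3 <= i <= n)%N -> P i) -> forall i, P i.
Proof.
move=> P0 P1 Pn P2 Pm; apply: ix_cases1 => // i /andP[i2 i_n].
have [i2'|i2'] := eqVneq (i : nat) 2%N; first by rewrite -(idxK i) i2'.
by apply: Pm; rewrite i_n andbT ltn_neqAle eq_sym i2' i2.
Qed.

Lemma frame_table2 x : J x -> [/\ mink (E 0 x) (E 2 x) = 0, mink (E 1 x) (E 2 x) = 0,
     mink (E n.+1 x) (E 2 x) = 0 & mink (E 2 x) (E 2 x) = 1].
Proof.
move=> Jx; have [-> -> ->] := frame_table_mid n2 so Jx ix2_mid; split=> //.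
rewrite isometry_col; last exact: ie.
by rewrite mink_bvec_mid_mid ?eqxx // mid2 ?ix2_mid.
Qed.

Lemma frame_table23 x (b : 'I_n.+2) : J x -> (3 <= b <= n)%N -> mink (E 2 x) (col b (e x)) = 0.
Proof.
move=> Jx /andP[b3 bn]; rewrite isometry_col; last exact: ie.
rewrite mink_bvec_mid_mid ?mid2 ?ix2_mid // eq_sym eq_ix ?(leq_trans n2) //.
by rewrite gtn_eqF.
Qed.

Lemma mid32 (b : 'I_n.+2) : (3 <= b <= n)%N -> (2 <= b <= n)%N.
Proof. by case/andP => b3 ->; rewrite (ltn_trans _ b3). Qed.

Lemma special_D0 x : J x -> vderiv (fun y => E 0 y) x (s x *: E 1 x).
Proof.
move=> Jx; have := second_order_D0 n2 so Jx.
by have [-> _ -> _] := special_phi Jx; rewrite scale0r add0r.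
Qed.

Lemma special_D1 x : J x ->
  vderiv (fun y => E 1 y) x (s x *: (mu1 I F e x *: E 0 x + E n.+1 x)).
Proof.
move=> Jx; have := second_order_D1 n2 so Jx.
have [-> _ _ _] := special_phi Jx.
by rewrite scalerDr scalerA /mu1 mulrC divfK ?sn.
Qed.

Lemma special_Dn x : J x ->
  vderiv (fun y => E n.+1 y) x (s x *: (mu1 I F e x *: E 1 x + E 2 x)).
Proof.
move=> Jx; have [p [dp [p0 p1 pn] pm _]] := second_order_Dn n2 so Jx.
have [h10 h02 h00 h0b] := special_phi Jx.
have [t02 t12 tn2 t22] := frame_table2 Jx.
have pE : p = s x *: E 2 x.
  apply: (frame_ext (ie Jx)); apply: ix_cases2; rewrite ?minkZl.
  - by rewrite minkC p0 (minkC (E 2 x)) t02 mulr0.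
  - by rewrite minkC p1 (minkC (E 2 x)) t12 mulr0.
  - by rewrite minkC pn (minkC (E 2 x)) tn2 mulr0.
  - by rewrite pm ?ix2_mid // h02 t22 mulr1.
  - by move=> b b3n; rewrite pm ?mid32 // h0b // minkZl frame_table23 // mulr0.
by move: dp; rewrite h00 pE scale0r subr0 scalerDr scalerA /mu1 mulrC divfK ?sn.
Qed.

Lemma phi_skew_mid x (a b : 'I_n.+2) : J x -> (1 <= a <= n)%N -> (1 <= b <= n)%N ->
  phi e x a b = - phi e x b a.
Proof.
by move=> Jx a1 b1; rewrite -!(phi_mid ie Jx) // (phi_skew oJ se ie Jx).
Qed.

Lemma special_D2 x : J x ->
  vderiv (fun y => E 2 y) x (s x *: (E 0 x + sect e (qX I F e) x)).
Proof.
move=> Jx; suff <- : col (ix 2) (dmx e x) = s x *: (E 0 x + sect e (qX I F e) x).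
  exact: vderiv_col se Jx.
have [h10 h02 h00 h0b] := special_phi Jx.
have [t00 t01 t11 t0n tnn] := frame_table n2 so Jx.
have [t02 t12 tn2 t22] := frame_table2 Jx.
have m2 := mid2 ix2_mid.
case: (so) => _ /(_ x Jx (ix 2) ix2_mid) [h20 h21].
apply: (frame_ext (ie Jx)); apply: ix_cases2; rewrite ?minkZl ?minkDl.
- rewrite (phi_skew oJ se ie Jx) (phi_mid ie Jx) // h20 t00 mink_sect_end; [ring|exact: ie|by left].
- rewrite (phi_skew oJ se ie Jx) (phi_mid ie Jx) // h21 t01 mink_sect_mid; [|exact: ie|exact: ix1_mid n2].
  by rewrite val_ix //=; ring.
- rewrite (phi_col0 ie Jx) h02 t0n mink_sect_end; [ring|exact: ie|by right].
- rewrite (phi_skew_diag oJ se ie Jx) t02 mink_sect_mid; [|exact: ie|exact: m2].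
  by rewrite val_ix ?(leq_trans n2) //=; ring.
- move=> b b3n; rewrite minkZl minkDl (phi_mid ie Jx) ?mid3 //.
  have [-> _ _] := frame_table_mid n2 so Jx (mid32 b3n).
  rewrite mink_sect_mid; [|exact: ie|exact: mid3].
  by case/andP: (b3n) => -> _; rewrite add0r /qX mulrC divfK // sn.
Qed.

Lemma smooth_inv_cds : smooth1 J (fun x => (s x)^-1).
Proof. by apply: (smooth1V oJ) => // x /c0 /gt_eqF ->. Qed.

Lemma smooth_mu1 : smooth1 J (mu1 I F e).
Proof.
apply: (smooth1M oJ); last exact: smooth_inv_cds.
have H : smooth1 J (fun x => - mink (col (ix 1) (dmx e x)) (col (ix n.+1) (e x))).
  apply: (smooth1N oJ); apply: (smooth1_mink oJ); first exact: (smoothmx_col oJ (smoothmx_dmx oJ se)).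
  exact: (smoothmx_col oJ se).
by apply: (smooth1_ext oJ _ H) => x Jx; rewrite (phi_col0 ie Jx) opprK.
Qed.

Lemma smooth_phi_mid (a b : 'I_n.+2) : (1 <= a <= n)%N -> smooth1 J (fun x => phi e x a b).
Proof.
move=> a1.
have H : smooth1 J (fun x => mink (col b (dmx e x)) (col a (e x))).
  apply: (smooth1_mink oJ); first exact: (smoothmx_col oJ (smoothmx_dmx oJ se)).
  exact: (smoothmx_col oJ se).
by apply: (smooth1_ext oJ _ H) => x Jx; rewrite (phi_mid ie Jx).
Qed.

Lemma smooth_qX (b : 'I_n.+2) : (1 <= b <= n)%N -> smooth1 J (qX I F e b).
Proof.
by move=> b1; apply: (smooth1M oJ); [exact: smooth_phi_mid|exact: smooth_inv_cds].
Qed.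

Lemma smooth_covd (sg : 'I_n.+2 -> R -> R) :
  (forall b : 'I_n.+2, (1 <= b <= n)%N -> smooth1 J (sg b)) ->
  forall b : 'I_n.+2, (1 <= b <= n)%N -> smooth1 J (covd I F e sg b).
Proof.
move=> ss b b1; apply: (smooth1M oJ); last exact: smooth_inv_cds.
apply: (smooth1D oJ); first exact: smooth1_derive1 (ss _ b1).
apply: (smooth1_sum oJ) => c c3; apply: (smooth1M oJ); first exact: ss (mid3 c3).
exact: smooth_phi_mid.
Qed.

Lemma smooth_sect (sg : 'I_n.+2 -> R -> R) :
  (forall b : 'I_n.+2, (1 <= b <= n)%N -> smooth1 J (sg b)) -> smoothmx J (sect e sg).
Proof.
move=> ss; apply: (smoothmx_sum oJ) => b b3; apply: (smoothmxZ oJ); first exact: ss (mid3 b3).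
exact: (smoothmx_col oJ se).
Qed.

Lemma canonical_of_special : canonical J s (mu1 I F e) (fun x => E 0 x) (fun x => E 1 x)
  (fun x => E n.+1 x) (fun x => E 2 x) (sect e (qX I F e)).
Proof.
by apply: (Canonical oJ c0 sc smooth_mu1 (smoothmx_col oJ se) (smoothmx_col oJ se)
  (smoothmx_col oJ se) (smoothmx_col oJ se) (smooth_sect smooth_qX) special_D0 special_D1
  special_Dn special_D2 (frame_table n2 so) (frame_table1n n2 so) frame_table2).
Qed.

(** A Gauss formula for the bundle spanned by e_3, ..., e_n. Components along e_0, e_1, e_{n+1}
    vanish because phi^b_0, phi^b_1 and phi^0_b do; the e_2 component is minus the product with X,
    since phi^2_b = - phi^b_2. *)
Lemma vderiv_sect (sg : 'I_n.+2 -> R -> R) x :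
  (forall b : 'I_n.+2, (1 <= b <= n)%N -> smooth1 J (sg b)) -> J x ->
  vderiv (sect e sg) x (s x *: (sect e (covd I F e sg) x
    - (\sum_(b < n.+2 | (3 <= b <= n)%N) sg b x * qX I F e b x) *: E 2 x)).
Proof.
move=> ss Jx.
have [h10 h02 h00 h0b] := special_phi Jx.
have [t00 t01 t11 t0n tnn] := frame_table n2 so Jx.
have [t02 t12 tn2 t22] := frame_table2 Jx.
pose d (b : 'I_n.+2) := derive1 (sg b) x *: col b (e x) + sg b x *: col b (dmx e x).
have D : vderiv (sect e sg) x (\sum_(b < n.+2 | (3 <= b <= n)%N) d b).
  apply: vderiv_sum => b b3; apply: vderivZ; last exact: vderiv_col se Jx.
  exact: smooth1_is_derive1 (ss _ (mid3 b3)) Jx.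
suff <- : \sum_(b < n.+2 | (3 <= b <= n)%N) d b = s x *: (sect e (covd I F e sg) x
    - (\sum_(b < n.+2 | (3 <= b <= n)%N) sg b x * qX I F e b x) *: E 2 x) by [].
have first_sum (i : 'I_n.+2) : mink (\sum_(b < n.+2 | (3 <= b <= n)%N) d b) (col i (e x)) =
    mink (sect e (fun b y => derive1 (sg b) y) x) (col i (e x))
    + \sum_(b < n.+2 | (3 <= b <= n)%N) sg b x * mink (col b (dmx e x)) (col i (e x)).
  rewrite /sect !mink_suml -big_split /=; apply: eq_bigr => b _.
  by rewrite /d minkDl !minkZl.
have m2 := mid2 ix2_mid.
case: (so) => _ hso.
apply: (frame_ext (ie Jx)); apply: ix_cases2.
- rewrite first_sum !mink_sect_end; [|exact: ie|by left].
  rewrite big1 => [|b b3]; last first.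
    rewrite (phi_skew oJ se ie Jx) (phi_mid ie Jx) ?mid3 //.
    by have [-> _] := hso x Jx b (mid32 b3); rewrite oppr0 mulr0.
  rewrite minkZl minkDl minkNl minkZl mink_sect_end; [|exact: ie|by left].
  by rewrite (minkC (E 2 x)) t02; ring.
- rewrite first_sum mink_sect_mid; [|exact: ie|exact: ix1_mid n2].
  rewrite big1 => [|b b3]; last first.
    rewrite (phi_skew oJ se ie Jx) (phi_mid ie Jx) ?mid3 //.
    by have [_ ->] := hso x Jx b (mid32 b3); rewrite oppr0 mulr0.
  rewrite minkZl minkDl minkNl minkZl mink_sect_mid; [|exact: ie|exact: ix1_mid n2].
  by rewrite (minkC (E 2 x)) t12 val_ix //=; ring.
- rewrite first_sum !mink_sect_end; [|exact: ie|by right].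
  rewrite big1 => [|b b3]; last by rewrite (phi_col0 ie Jx) h0b // oppr0 mulr0.
  rewrite minkZl minkDl minkNl minkZl mink_sect_end; [|exact: ie|by right].
  by rewrite (minkC (E 2 x)) tn2; ring.
- rewrite first_sum mink_sect_mid; [|exact: ie|exact: m2].
  rewrite minkZl minkDl minkNl minkZl mink_sect_mid; [|exact: ie|exact: m2].
  rewrite t22 val_ix ?(leq_trans n2) //= !add0r mulr1 -sumrN mulr_sumr.
  apply: eq_bigr => b b3; rewrite (phi_mid ie Jx _ m2) (phi_skew_mid Jx m2 (mid3 b3)).
  by rewrite /qX; field; exact: sn.
- move=> c c3; have c1 := mid3 c3; rewrite first_sum mink_sect_mid; [|exact: ie|exact: c1].
  rewrite minkZl minkDl minkNl minkZl mink_sect_mid; [|exact: ie|exact: c1].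
  rewrite (frame_table23 Jx c3) mulr0 subr0; case/andP: (c3) => -> _.
  rewrite /covd mulrC divfK ?sn //; congr (_ + _); apply: eq_bigr => b b3.
  by rewrite (phi_mid ie Jx).
Qed.

Local Notation q := (qX I F e).

Lemma mink_sect_Xnorm2 x : J x -> mink (sect e q x) (sect e q x) = Xnorm2 I F e x.
Proof.
move=> Jx; rewrite mink_sect_sect; last exact: ie.
by apply: eq_bigr => b _; rewrite expr2.
Qed.

Lemma smooth_Xnorm2 : smooth1 J (Xnorm2 I F e).
Proof.
have H : smooth1 J (fun x => mink (sect e q x) (sect e q x)).
  by apply: (smooth1_mink oJ); exact: smooth_sect smooth_qX.
by apply: (smooth1_ext oJ _ H) => x Jx; rewrite mink_sect_Xnorm2.
Qed.

(** The ambient derivative of X may replace the covariant one here, because their difference is a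
    multiple of e_2 and hence orthogonal to X. *)
Lemma dds_Xnorm2 x : J x -> dds I F (Xnorm2 I F e) x =
  2 * \sum_(b < n.+2 | (3 <= b <= n)%N) covd I F e q b x * q b x.
Proof.
move=> Jx; have D := vderiv_sect smooth_qX Jx.
have H := is_derive1_ext oJ Jx mink_sect_Xnorm2 (vderiv_mink D D).
have [t02 t12 tn2 t22] := frame_table2 Jx.
rewrite /dds (is_derive1_derive1 H) (minkC (sect e q x)) -mulr2n -mulr_natl.
rewrite minkZl minkDl minkNl minkZl (minkC (E 2 x)) mink_sect_mid; [|exact: ie|exact: mid2 ix2_mid].
rewrite val_ix ?(leq_trans n2) //= mulr0 subr0 mink_sect_sect; last exact: ie.
by field; exact: sn.
Qed.

(** Apply the Gauss formula twice: X' = nabla X - |X|^2 e_2, and differentiating again produces -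
    <nabla X, X> e_2 and - (|X|^2)' e_2. As <nabla X, X> is half of (|X|^2)', the two add up to the
    coefficient 3/2. The term -|X|^2 (e_0 + X) comes from the derivative of e_2. *)
Lemma EL_special x : J x -> EL s (mu1 I F e) (fun x => E 2 x) (sect e q) x =
  - (sect e (covd I F e (covd I F e q)) x - (Xnorm2 I F e x + 2 * mu1 I F e x) *: sect e q x)
  + (dds I F (mu1 I F e) x + 3 / 2 * dds I F (Xnorm2 I F e) x) *: E 2 x
  + Xnorm2 I F e x *: E 0 x.
Proof.
move=> Jx.
have XsE y : J y -> dds_vec s (sect e q) y = sect e (covd I F e q) y - Xnorm2 I F e y *: E 2 y.
  move=> Jy; rewrite (dds_vec_vderiv (sn Jy) (vderiv_sect smooth_qX Jy)).
  congr (_ - _ *: _); apply: eq_bigr => b _; exact: esym (expr2 _).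
have D2 : vderiv (fun y => sect e (covd I F e q) y - Xnorm2 I F e y *: E 2 y) x
   (s x *: (sect e (covd I F e (covd I F e q)) x - (1 / 2 * dds I F (Xnorm2 I F e) x) *: E 2 x)
    - (derive1 (Xnorm2 I F e) x *: E 2 x + Xnorm2 I F e x *: (s x *: (E 0 x + sect e q x)))).
  apply: vderivB; last first.
    by apply: vderivZ; [exact: smooth1_is_derive1 smooth_Xnorm2 Jx|exact: special_D2].
  have := vderiv_sect (smooth_covd smooth_qX) Jx.
  by rewrite dds_Xnorm2 // mulrA divfK ?mul1r // pnatr_eq0.
have -> : EL s (mu1 I F e) (fun x => E 2 x) (sect e q) x =
   - dds_vec s (fun y => sect e (covd I F e q) y - Xnorm2 I F e y *: E 2 y) x
   + (dds I F (mu1 I F e) x) *: E 2 x + (2 * mu1 I F e x) *: sect e q x.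
  by rewrite /EL (dds_vec_ext oJ Jx (fun y _ => erefl (s y)) XsE).
rewrite /dds_vec (vderiv_dmx D2).
have -> : derive1 (Xnorm2 I F e) x = s x * dds I F (Xnorm2 I F e) x.
  by rewrite /dds mulrC divfK ?sn.
have s0 := sn Jx; apply/matrixP => i j; rewrite !mxE; field; exact: s0.
Qed.

Definition geodesic_equations x : Prop :=
  dds I F (mu1 I F e) x + 3 / 2 * dds I F (Xnorm2 I F e) x = 0 /\
  sect e (covd I F e (covd I F e q)) x
    - (Xnorm2 I F e x + 2 * mu1 I F e x) *: sect e q x = 0.

Lemma EL_of_equations x : J x -> geodesic_equations x -> forall Z, mink (E 0 x) Z = 0 ->
  mink (EL s (mu1 I F e) (fun x => E 2 x) (sect e q) x) Z = 0.
Proof.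
move=> Jx [H1 H2] Z Z0; rewrite EL_special // H1 H2 oppr0 scale0r !add0r minkZl Z0 mulr0.
by [].
Qed.

(** The vector of the second equation is a section of the bundle spanned by e_3, ..., e_n. The
    product with e_2 therefore isolates the first equation and the products with e_b the second,
    while the e_0 term of EL is orthogonal to all of them. *)
Lemma equations_of_EL x : J x ->
  (forall i : 'I_n.+2, (2 <= i <= n)%N ->
     mink (EL s (mu1 I F e) (fun x => E 2 x) (sect e q) x) (col i (e x)) = 0) ->
  geodesic_equations x.
Proof.
move=> Jx H; rewrite /geodesic_equations; have [t02 t12 tn2 t22] := frame_table2 Jx.
have iex := ie Jx; have m2 := mid2 ix2_mid.
have v2 : (3 <= ix 2)%N = false by rewrite val_ix // (leq_trans n2).
have ELx := EL_special Jx.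
set Y := sect e _ x - _ *: _ in ELx *.
have Y0 : mink Y (E 0 x) = 0.
  by rewrite /Y !minkE !mink_sect_end //; [ring|left|left].
have Y1 : mink Y (E 1 x) = 0.
  by rewrite /Y !minkE !mink_sect_mid ?ix1_mid // val_ix //=; ring.
have Yn : mink Y (E n.+1 x) = 0.
  by rewrite /Y !minkE !mink_sect_end //; [ring|right|right].
have Y2 : mink Y (E 2 x) = 0.
  by rewrite /Y !minkE !mink_sect_mid // v2; ring.
clearbody Y; rewrite ELx in H.
split.
  have := H _ ix2_mid; rewrite !minkE Y2 t02 t22 => /eqP.
  by rewrite oppr0 mulr1 mulr0 add0r addr0 => /eqP.
apply: (frame_ext iex); apply: ix_cases2; rewrite ?mink0l //.
move=> b b3; have := H b (mid32 b3); rewrite mink0l !minkE.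
rewrite frame_table23 // mulr0 addr0.
have [-> _ _] := frame_table_mid n2 so Jx (mid32 b3).
by rewrite mulr0 addr0 => /eqP; rewrite oppr_eq0 => /eqP.
Qed.

End SpecialFrame.
End Canonical.

Section CanonicalExistence.
Variables (R : realType) (n : nat).
Hypothesis n3 : (3 <= n)%N.
Local Notation V := 'cV[R]_(n.+2).
Local Notation ix := (@idx n).
Let n2 : (2 <= n)%N := ltnW n3.

Lemma sqrt_eq1 (a : R) : Num.sqrt a = 1 -> a = 1.
Proof.
have [a0 H|a0] := leP 0 a; first by rewrite -(sqr_sqrtr a0) H expr1n.
by rewrite (ler0_sqrtr (ltW a0)) => /eqP; rewrite eq_sym oner_eq0.
Qed.

Lemma dmxZ (J : set R) (c : R) (G : R -> V) x : smoothmx J G -> J x ->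
  dmx (fun y => c *: G y) x = c *: dmx G x.
Proof.
move=> sG Jx; have := vderivZ (is_derive1_cst c x) (smoothmx_vderiv sG Jx).
by rewrite scale0r add0r => /vderiv_dmx.
Qed.

Lemma dds_vecZ (J : set R) s (c : R) (G : R -> V) x : smoothmx J G -> J x ->
  dds_vec s (fun y => c *: G y) x = c *: dds_vec s G x.
Proof. by move=> sG Jx; rewrite /dds_vec (dmxZ _ sG Jx) !scalerA mulrC. Qed.

Section Canonical.
Variables (J : set R) (s mu : R -> R) (e0 e1 en e2 X : R -> V).
Hypothesis can : canonical J s mu e0 e1 en e2 X.
Let oJ := can_open can.

Lemma canonical_scale (c : R) : c * c = 1 -> canonical J s mu (fun x => c *: e0 x)
  (fun x => c *: e1 x) (fun x => c *: en x) (fun x => c *: e2 x) (fun x => c *: X x).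
Proof.
move=> cc; have sc (G : R -> V) : smoothmx J G -> smoothmx J (fun x => c *: G x).
  by move=> sG; apply: (smoothmxZ oJ); [exact: smooth1_cst|exact: sG].
have dc (G : R -> V) x d : vderiv G x d -> vderiv (fun x => c *: G x) x (c *: d).
  by move=> dG; have := vderivZ (is_derive1_cst c x) dG; rewrite scale0r add0r.
have mc (u v : V) : mink (c *: u) (c *: v) = mink u v.
  by rewrite minkZl minkZr mulrA cc mul1r.
have D (a b : R) (u v : V) : c *: (a *: (b *: u + v)) = a *: (b *: (c *: u) + c *: v).
  by rewrite !scalerDr !scalerA; congr (_ *: _ + _ *: _); ring.
apply: (Canonical oJ (can_pos can) (can_smooth_s can) (can_smooth_mu can) (sc _ (can_smooth0 can))
   (sc _ (can_smooth1 can)) (sc _ (can_smoothn can)) (sc _ (can_smooth2 can)) (sc _ (can_smoothX can))).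
- by move=> x Jx; rewrite scalerA mulrC -scalerA; apply: dc; exact: (can_D0 can).
- by move=> x Jx; rewrite -D; apply: dc; exact: (can_D1 can).
- by move=> x Jx; rewrite -D; apply: dc; exact: (can_Dn can).
- move=> x Jx; rewrite -[c *: e0 x]scale1r -D scale1r; apply: dc; exact: (can_D2 can).
- by move=> x Jx; rewrite !mc; exact: (can_table can).
- by move=> x Jx; rewrite !mc; exact: (can_table1n can).
- by move=> x Jx; rewrite !mc; exact: (can_table2 can).
Qed.

Lemma canonical_subset (W : set R) : open W -> W `<=` J ->
  canonical W s mu e0 e1 en e2 X.
Proof.
move=> oW WJ; have [_ h1 h2 h3 h4 h5 h6 h7 h8 h9 h10 h11 h12 h13 h14 h15] := can.
apply: (Canonical oW _ (smooth1_subset WJ h2) (smooth1_subset WJ h3) (smoothmx_subset WJ h4)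
  (smoothmx_subset WJ h5) (smoothmx_subset WJ h6) (smoothmx_subset WJ h7) (smoothmx_subset WJ h8)) => x /WJ.
- exact: h1.
- exact: h9.
- exact: h10.
- exact: h11.
- exact: h12.
- exact: h13.
- exact: h14.
- exact: h15.
Qed.

Lemma EL_scale (c : R) x : J x -> EL s mu (fun x => c *: e2 x) (fun x => c *: X x) x =
  c *: EL s mu e2 X x.
Proof.
move=> Jx; have sX := can_smoothX can.
have sXs := smooth_dds_vec oJ (can_pos can) (can_smooth_s can) sX.
have H y (Jy : J y) : dds_vec s (fun x => c *: X x) y = c *: dds_vec s X y := dds_vecZ _ _ sX Jy.
rewrite /EL (dds_vec_ext oJ Jx (fun y _ => erefl (s y)) H) (dds_vecZ _ _ sXs Jx).
by rewrite !scalerDr scalerN !scalerA; congr (_ + _ *: _ + _ *: _); ring.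
Qed.

Lemma smooth_EL : smoothmx J (EL s mu e2 X).
Proof.
have sX := can_smoothX can; have ss := can_smooth_s can; have sp := can_pos can.
have sXs := smooth_dds_vec oJ sp ss sX; have sXss := smooth_dds_vec oJ sp ss sXs.
apply: (smoothmxD oJ); last first.
  apply: (smoothmxZ oJ); last exact: sX.
  by apply: (smooth1M oJ); [exact: smooth1_cst|exact: can_smooth_mu can].
apply: (smoothmxD oJ).
  have H : smoothmx J (fun x => (-1) *: dds_vec s (dds_vec s X) x).
    by apply: (smoothmxZ oJ); [exact: smooth1_cst|exact: sXss].
  by apply: (smoothmx_ext oJ _ H) => y _; rewrite scaleN1r.
apply: (smoothmxZ oJ); last exact: can_smooth2 can.
apply: (smooth1M oJ); first exact: smooth1_derive1 (can_smooth_mu can).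
by apply: (smooth1V oJ) => // x /sp /gt_eqF ->.
Qed.

End Canonical.

(** * From canonical vectors back to local special frames *)

Section SpecialOfCanonical.
Variables (I J : set R) (F : R -> V) (mu : R -> R) (e0 e1 en e2 X : R -> V).
Hypothesis can : canonical J (cds I F) mu e0 e1 en e2 X.
Hypotheses (JI : J `<=` I) (e0F : forall x, J x -> exists k, k != 0 /\ e0 x = k *: F x).
Local Notation s := (cds I F).

Lemma special_of_future x0 : J x0 ->
  (forall x, J x -> 0 < e0 x (ix 0) 0 + e0 x (ix n.+1) 0) ->
  exists J' e, [/\ special_third I F J' e, J' x0, J' `<=` J &
    [/\ forall x, J' x -> col (ix 0) (e x) = e0 x,
    forall x, J' x -> col (ix 1) (e x) = e1 x,
    forall x, J' x -> col (ix n.+1) (e x) = en x &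
    forall x, J' x -> col (ix 2) (e x) = e2 x]].
Proof.
move=> Jx0 fut; have oJ := can_open can; have tb := can_table can.
have t1n := can_table1n can; have t2 := can_table2 can.
have n0 : (0 < n)%N := ltnW n2.
have [J1 [Q1 [oJ1 J1x J1J sQ1 HQ1]]] := @adapted_isometry _ _ J e0 e1 en x0 n0 oJ Jx0
  (can_smooth0 can) (can_smooth1 can) (can_smoothn can)
  (fun x Jx => let: And5 a _ _ b c := tb x Jx in And3 a b c)
  (fun x Jx => let: And5 _ a b _ _ := tb x Jx in And3 b a (etrans (minkC _ _) (t1n x Jx))).
have v2 : (2 <= ix 2 <= n)%N by rewrite val_ix // (leq_trans n2).
have HQ1' x : J1 x -> [/\ mink (e2 x) (e2 x) = 1, mink (Q1 x *m bvec R (ix 0)) (e2 x) = 0,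
     mink (Q1 x *m bvec R (ix 1)) (e2 x) = 0 & mink (Q1 x *m bvec R (ix n.+1)) (e2 x) = 0].
  move=> J1x'; have [_ -> -> ->] := HQ1 x J1x'.
  by have [-> -> -> ->] := t2 x (J1J _ J1x').
have [J2 [Q [oJ2 J2x J2J1 sQ HQ]]] := adapted_isometry_extend v2 oJ1 J1x
  (smoothmx_subset J1J (can_smooth2 can)) sQ1 (fun x Jx => let: And4 a _ _ _ := HQ1 x Jx in a) HQ1'.
have J2J : J2 `<=` J by move=> x /J2J1 /J1J.
have HQ2 x : J2 x -> [/\ isometry (Q x), Q x *m bvec R (ix 2) = e2 x,
    Q x *m bvec R (ix 0) = e0 x, Q x *m bvec R (ix 1) = e1 x & Q x *m bvec R (ix n.+1) = en x].
  move=> J2x'; have [a b c d f] := HQ x J2x'; have [_ c' d' f'] := HQ1 x (J2J1 _ J2x').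
  by split=> //; [rewrite -b idxK|rewrite c|rewrite d|rewrite f].
have iQ x : J2 x -> isometry (Q x) by move=> /HQ2 [].
have fut_e x : J2 x -> mink (Q x *m Tvec R n) (Tvec R n) < 0.
  move=> J2x'; have [_ _ Q0 _ Qn] := HQ2 x J2x'.
  have [t00 _ _ t0n tnn] := tb x (J2J _ J2x').
  exact: (mink_Tvec_lt0 Q0 Qn t00 t0n tnn (fut _ (J2J _ J2x'))).
have [e [se mobe colE]] := @mob_of_isometry _ _ J2 Q n0 oJ2 sQ iQ fut_e.
have c0 x : J2 x -> col (ix 0) (e x) = e0 x.
  by move=> Jx'; rewrite colE ?ltn_eqF ?(ltnW n2) //; case: (HQ2 x Jx').
have c1 x : J2 x -> col (ix 1) (e x) = e1 x.
  by move=> Jx'; rewrite colE ?ltn_eqF ?(ltnW n2) //; case: (HQ2 x Jx').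
(* Here n >= 3 matters: column n carries the sign that corrects the determinant and escapes [colE],
   so column 2 must be a different one. *)
have c2 x : J2 x -> col (ix 2) (e x) = e2 x.
  by move=> Jx'; rewrite colE ?ltn_eqF ?(ltnW n2) //; case: (HQ2 x Jx').
have cn x : J2 x -> col (ix n.+1) (e x) = en x.
  by move=> Jx'; rewrite colE ?gtn_eqF ?(ltnW n2) //; case: (HQ2 x Jx').
exists J2, e; split=> //.
have ie y : J2 y -> isometry (e y) by move=> Jy; exact: mob_isometry (mobe y Jy).
have DE i (g g' : R -> V) x : J2 x -> (forall y, J2 y -> col (ix i) (e y) = g y) ->
    vderiv g x (g' x) -> col (ix i) (dmx e x) = g' x.
  move=> Jx' cg dg.
  exact: (vderiv_unique (vderiv_col (ix i) se Jx') (vderiv_ext oJ2 Jx' (fun y Jy => esym (cg y Jy)) dg)).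
have D0 x (Jx : J2 x) := DE 0%N e0 (fun x => s x *: e1 x) x Jx c0 (can_D0 can (J2J _ Jx)).
have D1 x (Jx : J2 x) := DE 1%N e1 (fun x => s x *: (mu x *: e0 x + en x)) x Jx c1 (can_D1 can (J2J _ Jx)).
have Dn x (Jx : J2 x) := DE n.+1 en (fun x => s x *: (mu x *: e1 x + e2 x)) x Jx cn (can_Dn can (J2J _ Jx)).
have D2 x (Jx : J2 x) := DE 2%N e2 (fun x => s x *: (e0 x + X x)) x Jx c2 (can_D2 can (J2J _ Jx)).
have orth x (i : 'I_n.+2) : J2 x -> (2 <= i <= n)%N -> [/\ mink (e0 x) (col i (e x)) = 0,
    mink (e1 x) (col i (e x)) = 0 & mink (en x) (col i (e x)) = 0].
  move=> Jx' i2n; have [b0 bn] := mink_bvec_end_mid R (mid2 i2n).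
  rewrite -(c0 x Jx') -(c1 x Jx') -(cn x Jx') !isometry_col ?b0 ?bn; try exact: ie.
  split=> //; rewrite minkC mink_bvec_mid_mid ?mid2 // eq_ix // gtn_eqF //.
  by case/andP: i2n.
have so : second_order I F J2 e.
  split.
    split=> //; first by move=> x /J2J /JI.
    move=> x Jx'; split; first exact: mobe.
    by have [k [k0 kE]] := e0F (J2J _ Jx'); exists k; rewrite c0.
  move=> x Jx' a a2n; have [h0 h1 hn] := orth x a Jx' a2n.
  rewrite -!(phi_mid ie Jx' _ (mid2 a2n)) D0 // D1 // !minkE h0 h1 hn.
  by split; ring.
split=> // x Jx'; have Jx := J2J _ Jx'.
have [t00 t01 t11 t0n tnn] := tb x Jx; have [t02 t12 tn2 t22] := t2 x Jx.
have i1 : (1 <= ix 1 <= n)%N := ix1_mid n2.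
(* Differentiating <en,e2> = 0 gives <e2,e2> + <en,e0> + <en,X> = 0, and the first two terms cancel.
   Hence phi^0_2 is exactly s. *)
have X_en : mink (X x) (en x) = 0.
  have := vderiv_mink_cst oJ Jx (fun y Jy => let: And4 _ _ h _ := t2 y Jy in h)
    (lt0r_neq0 (can_pos can Jx)) (can_Dn can Jx) (can_D2 can Jx).
  by rewrite !minkE (minkC (en x) (e0 x)) t0n t12 t22 (minkC (X x)) => H; lra.
split.
- by rewrite -(phi_mid ie Jx' _ i1) D0 // c1 // minkZl t11 mulr1.
- apply: oppr_inj; rewrite -(phi_col0 ie Jx') D2 // cn // !minkE t0n X_en; ring.
- apply: oppr_inj; rewrite -(phi_col0 ie Jx') D0 // cn // !minkE (t1n x Jx) mulr0 oppr0.
  by [].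
- move=> b b3n; apply: oppr_inj; rewrite -(phi_col0 ie Jx') (phi_skew oJ2 se ie Jx').
  have [h0 h1 hn] := orth x b Jx' (mid32 b3n).
  rewrite Dn // !minkE h1 -(c2 x Jx') isometry_col; last exact: ie.
  rewrite mink_bvec_mid_mid ?mid2 // eq_sym eq_ix ?(leq_trans n2) //.
  by rewrite gtn_eqF; [rewrite mulr0n; ring|case/andP: b3n].
Qed.

End SpecialOfCanonical.

Section SpecialOfCanonicalUpToSign.
Variables (I J : set R) (F : R -> V) (mu : R -> R) (e0 e1 en e2 X : R -> V).
Hypothesis can : canonical J (cds I F) mu e0 e1 en e2 X.
Hypotheses (JI : J `<=` I) (e0F : forall x, J x -> exists k, k != 0 /\ e0 x = k *: F x).
Local Notation s := (cds I F).

(* [mob] asks for a future-pointing [e_0], whence the sign [c]. *)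
Lemma special_of_canonical x0 : J x0 ->
  exists J' e (c : R), [/\ special_third I F J' e, J' x0, J' `<=` J, c * c = 1 &
    col (ix 0) (e x0) = c *: e0 x0 /\
    EL s (mu1 I F e) (fun x => col (ix 2) (e x)) (sect e (qX I F e)) x0 =
      c *: EL s mu e2 X x0].
Proof.
move=> Jx0; have oJ := can_open can.
have [t00 _ _ t0n _] := can_table can Jx0.
have e00 := mink_neq0 t0n.
have [c [cE c0]] := null_future_sign t00 e00.
have cc : c * c = 1 by case: cE => ->; rewrite ?mulrNN mulr1.
have cn0 : c != 0 by apply/eqP => cz; move: cc; rewrite cz mul0r => /eqP; rewrite eq_sym oner_eq0.
pose fut x := c * (e0 x (ix 0) 0 + e0 x (ix n.+1) 0).
have sfut : smooth1 J fut.
  apply: (smooth1M oJ); first exact: smooth1_cst.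
  by apply: (smooth1D oJ); exact: (can_smooth0 can).
pose Jc := [set x | J x /\ 0 < fut x].
have oJc : open Jc by apply: open_setI_gt0 => // x Jx; exact: smooth1_continuous sfut Jx.
have JcJ : Jc `<=` J by move=> x [].
have canc := canonical_scale (canonical_subset can oJc JcJ) cc.
have futc x : Jc x -> 0 < (c *: e0 x) (ix 0) 0 + (c *: e0 x) (ix n.+1) 0.
  by move=> [_]; rewrite /fut !mxE mulrDr.
have cF x : Jc x -> exists k, k != 0 /\ c *: e0 x = k *: F x.
  move=> /JcJ /e0F [k [k0 ->]]; exists (c * k); rewrite scalerA; split=> //.
  by rewrite mulf_neq0.
have [J' [e [st J'x J'Jc [C0 C1 Cn C2]]]] :=
  special_of_future canc (subset_trans JcJ JI) cF (conj Jx0 c0) futc.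
have J'J : J' `<=` J by move=> x /J'Jc /JcJ.
exists J', e, c; split=> //; split; first exact: C0.
have oJ' : open J' by case: st => [[[]]].
have cans := canonical_of_special n3 st (smooth1_subset J'J (can_smooth_s can))
   (fun x Jx => can_pos can (J'J _ Jx)).
have canc' := canonical_subset canc oJ' J'Jc.
have sn x : J' x -> s x != 0 by move=> /J'J /(can_pos can) /gt_eqF ->.
(* The two canonical systems share s and, up to the factor c, the vectors e0, e1, en, e2. Comparing
   the equations for e1' identifies mu; comparing those for e2' identifies X. *)
have muE x : J' x -> mu1 I F e x = mu x.
  move=> Jx; have D := vderiv_ext oJ' Jx C1 (can_D1 cans Jx).
  have := scalerI (sn x Jx) (vderiv_unique D (can_D1 canc' Jx)).
  rewrite C0 // Cn // => /addIr /(congr1 (fun v => mink v (c *: en x))) /=.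
  rewrite [LHS]minkZl [RHS]minkZl; have [_ _ _ -> _] := can_table canc' Jx.
  by rewrite !mulrN1 => /oppr_inj.
have XE x : J' x -> sect e (qX I F e) x = c *: X x.
  move=> Jx; have D := vderiv_ext oJ' Jx C2 (can_D2 cans Jx).
  have := scalerI (sn x Jx) (vderiv_unique D (can_D2 canc' Jx)).
  by rewrite C0 // => /addrI.
rewrite (EL_ext oJ' J'x (fun y _ => erefl (s y)) muE C2 XE).
exact: (EL_scale can _ Jx0).
Qed.

End SpecialOfCanonicalUpToSign.
End CanonicalExistence.

(** * Global canonical vectors of a 1-generic curve *)

Section GenericCurve.
Variables (R : realType) (n : nat).
Hypothesis n3 : (3 <= n)%N.
Local Notation V := 'cV[R]_(n.+2).
Local Notation ix := (@idx n).
Let n2 : (2 <= n)%N := ltnW n3.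
Variables (I : set R) (F : R -> V).
Hypotheses (oI : open I) (gF : one_generic I F).

Let liF : lift_immersion I F. Proof. by case: gF. Qed.

Lemma psq_ge0 (e : R -> 'M[R]_(n.+2)) x : 0 <= psq e x.
Proof. by apply: sumr_ge0 => i _; exact: sqr_ge0. Qed.

Lemma cds_gt0 x : I x -> 0 < cds I F x.
Proof.
move=> Ix; case: gF => _ ex ps; rewrite /cds; set P := [set r | _].
have : P (xget 0 P).
  by apply: xgetPex; have [J [e [so Jx]]] := ex x Ix; exists (dens e x), J, e.
move=> [J [e [so [Jx ->]]]]; have p0 := ps J e x so Jx.
have pp : 0 < psq e x by rewrite lt0r p0 psq_ge0.
(* In [psq] one divides by phi^1_0, and division by 0 yields 0; thus a nonzero [psq] also forces
   phi^1_0 to be nonzero. *)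
rewrite /dens mulr_gt0 ?sqrtr_gt0 // normr_gt0; apply: contra_neq p0 => ph0.
by rewrite /psq big1 // => i _; rewrite ph0 invr0 mulr0 expr0n.
Qed.

(** The fourth root is smooth only where the Gram determinant is positive, and this positivity is
    read back from that of the density itself. *)
Lemma smooth_cds : smooth1 I (cds I F).
Proof.
have s0 := lift_smooth liF; have s1 := smoothmx_dmx oI s0; have s2 := smoothmx_dmx oI s1.
have s3 := smoothmx_dmx oI s2.
have cE := cds_formula_dx n2 oI liF.
have sp := lift_speed_gt0 oI liF.
have Pp x : I x -> 0 < gramP (F x) (dmx F x) (dmx (dmx F) x) (dmx (dmx (dmx F)) x).
  move=> Ix; have := cds_gt0 Ix; rewrite cE // /arcden pmulr_lgt0 ?invr_gt0 ?sp //.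
  by rewrite !sqrtr_gt0.
have m (f g : R -> V) : smoothmx I f -> smoothmx I g -> smooth1 I (fun x => mink (f x) (g x)).
  by move=> sf sg; exact: smooth1_mink.
have sM := smooth1M oI; have sB := smooth1B oI; have sD := smooth1D oI.
have sP : smooth1 I (fun x => gramP (F x) (dmx F x) (dmx (dmx F) x) (dmx (dmx (dmx F)) x)).
  rewrite /gramP /gram_poly; apply: (sD); [apply: (sB)|].
  - apply: (sM); first by apply: (sM); exact: (m).
    by apply: (sB); apply: (sM); exact: (m).
  - apply: (sM); first by apply: (sM); [apply: (sM); [exact: smooth1_cst|exact: (m)]|exact: (m)].
    by apply: (sB); apply: (sM); exact: (m).
  - apply: (sM); first by apply: (sM); exact: (m).
    by apply: (sB); apply: (sM); exact: (m).
have H : smooth1 I (fun x => arcden (F x) (dmx F x) (dmx (dmx F) x) (dmx (dmx (dmx F)) x)).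
  apply: (sM); last first.
    by apply: (smooth1V oI) => [x Ix|]; [rewrite gt_eqF // sp|exact: (m)].
  apply: (smooth1_sqrt oI) => [x Ix|]; first by rewrite sqrtr_gt0 Pp.
  by apply: (smooth1_sqrt oI).
by apply: (smooth1_ext oI _ H) => x Ix; rewrite cE.
Qed.

Local Notation s := (cds I F).

(** The factor [rho] is chosen so that the lift has |e0'| = s in the parameter x, that is, unit
    speed in arclength. The later vectors are arclength derivatives corrected by multiples of
    earlier ones, which yields all products of the table by differentiation, except the length of
    e2. *)
Lemma canonical_of_generic : exists mu e0 e1 en e2 X,
  canonical I s mu e0 e1 en e2 X /\ forall x, I x -> exists k, k != 0 /\ e0 x = k *: F x.
Proof.
have ss := smooth_cds; have sp := cds_gt0.
have sn x : I x -> s x != 0 by move=> /sp /gt_eqF ->.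
have sF := lift_smooth liF; have vp := lift_speed_gt0 oI liF.
pose rho x := s x / Num.sqrt (mink (dmx F x) (dmx F x)).
have rho0 x : I x -> rho x != 0.
  by move=> Ix; rewrite mulf_neq0 ?sn // invr_neq0 // gt_eqF // sqrtr_gt0 vp.
have rho2 x : I x -> rho x ^+ 2 * mink (dmx F x) (dmx F x) = s x ^+ 2.
  move=> Ix; have -> : rho x ^+ 2 = s x ^+ 2 / Num.sqrt (mink (dmx F x) (dmx F x)) ^+ 2.
    by rewrite /rho exprMn exprVn.
  rewrite sqr_sqrtr; last exact: ltW (vp _ Ix).
  by rewrite divfK // gt_eqF // vp.
have srho : smooth1 I rho.
  apply: (smooth1M oI); first exact: ss.
  apply: (smooth1V oI) => [x Ix|]; first by rewrite gt_eqF // sqrtr_gt0 vp.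
  by apply: (smooth1_sqrt oI) => [x Ix|]; [exact: vp|exact: smooth_speed oI liF].
have [G GE] : {G : R -> V | forall x, G x = rho x *: F x} by exists (fun x => rho x *: F x).
have sG : smoothmx I G.
  by apply: (smoothmx_ext oI _ (smoothmxZ oI srho sF)) => x _; rewrite GE.
have sdds (H : R -> V) : smoothmx I H -> smoothmx I (dds_vec s H).
  exact: smooth_dds_vec oI sp ss.
have ddds (H : R -> V) x : smoothmx I H -> I x -> vderiv H x (s x *: dds_vec s H x).
  exact: vderiv_dds_vec sp.
have [G1 [G1E sG1 dG]] : exists G1, [/\ G1 = dds_vec s G, smoothmx I G1 &
    forall x, I x -> vderiv G x (s x *: G1 x)].
  by exists (dds_vec s G); split=> [//||x Ix]; [exact: sdds|exact: ddds].
have [G2 [sG2 dG1]] : exists G2, smoothmx I G2 /\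
    forall x, I x -> vderiv G1 x (s x *: G2 x).
  by exists (dds_vec s G1); split=> [|x Ix]; [exact: sdds|exact: ddds].
have [mu muE] : {mu : R -> R | forall x, mu x = - (1 / 2) * mink (G2 x) (G2 x)}.
  by exists (fun x => - (1 / 2) * mink (G2 x) (G2 x)).
have smu : smooth1 I mu.
  have H : smooth1 I (fun x => - (1 / 2) * mink (G2 x) (G2 x)).
    by apply: (smooth1M oI); [exact: smooth1_cst|exact: smooth1_mink].
  by apply: (smooth1_ext oI _ H) => x _; rewrite muE.
have [en enE] : {en : R -> V | forall x, en x = G2 x - mu x *: G x}.
  by exists (fun x => G2 x - mu x *: G x).
have sen : smoothmx I en.
  by apply: (smoothmx_ext oI _ (smoothmxB oI sG2 (smoothmxZ oI smu sG))) => x _; rewrite enE.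
have [En' [sEn' den]] : exists E, smoothmx I E /\ forall x, I x -> vderiv en x (s x *: E x).
  by exists (dds_vec s en); split=> [|x Ix]; [exact: sdds|exact: ddds].
have [e2 e2E] : {e2 : R -> V | forall x, e2 x = En' x - mu x *: G1 x}.
  by exists (fun x => En' x - mu x *: G1 x).
have se2 : smoothmx I e2.
  by apply: (smoothmx_ext oI _ (smoothmxB oI sEn' (smoothmxZ oI smu sG1))) => x _; rewrite e2E.
have [E2' [sE2' de2]] : exists E, smoothmx I E /\ forall x, I x -> vderiv e2 x (s x *: E x).
  by exists (dds_vec s e2); split=> [|x Ix]; [exact: sdds|exact: ddds].
have g00 x : I x -> mink (G x) (G x) = 0.
  by move=> Ix; rewrite GE !minkE (lift_null liF) // !mulr0.
have g01 x : I x -> mink (G x) (G1 x) = 0.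
  move=> Ix; have := vderiv_mink_cst oI Ix g00 (sn x Ix) (dG x Ix) (dG x Ix).
  by rewrite (minkC (G1 x)); lra.
have g11 x : I x -> mink (G1 x) (G1 x) = 1.
  move=> Ix.
  have D := vderiv_ext oI Ix (fun y _ => esym (GE y)) (vderivZ (smooth1_is_derive1 srho Ix) (lift_vderiv liF Ix)).
  have E := vderiv_unique (dG x Ix) D.
  have : s x ^+ 2 * mink (G1 x) (G1 x) = s x ^+ 2 * 1.
    rewrite expr2 -mulrA -minkZr -minkZl E !minkE (minkC (dmx F x)) (lift_null liF) //.
    rewrite (lift_deriv_orth oI liF) // mulr1 -expr2 -(rho2 x Ix); ring.
  by apply: mulfI; rewrite sqrf_eq0 sn.
have g12 x : I x -> mink (G1 x) (G2 x) = 0.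
  move=> Ix; have := vderiv_mink_cst oI Ix g11 (sn x Ix) (dG1 x Ix) (dG1 x Ix).
  by rewrite (minkC (G2 x)); lra.
have g02 x : I x -> mink (G x) (G2 x) = -1.
  move=> Ix; have := vderiv_mink_cst oI Ix g01 (sn x Ix) (dG x Ix) (dG1 x Ix).
  by rewrite g11 //; lra.
have t0n x : I x -> mink (G x) (en x) = -1.
  by move=> Ix; rewrite enE !minkE g00 // g02 //; ring.
have tnn x : I x -> mink (en x) (en x) = 0.
  by move=> Ix; rewrite enE !minkE (minkC (G2 x) (G x)) g00 // g02 // muE; field.
have t1n x : I x -> mink (G1 x) (en x) = 0.
  by move=> Ix; rewrite enE !minkE (minkC (G1 x) (G x)) g12 // g01 //; ring.
have G2E x : G2 x = mu x *: G x + en x by rewrite enE addrC subrK.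
have EnE x : En' x = mu x *: G1 x + e2 x by rewrite e2E addrC subrK.
have tn' x : I x -> mink (en x) (En' x) = 0.
  move=> Ix; have := vderiv_mink_cst oI Ix tnn (sn x Ix) (den x Ix) (den x Ix).
  by rewrite (minkC (En' x)); lra.
have t0' x : I x -> mink (G x) (En' x) = 0.
  move=> Ix; have := vderiv_mink_cst oI Ix t0n (sn x Ix) (dG x Ix) (den x Ix).
  by rewrite t1n //; lra.
have t1' x : I x -> mink (G1 x) (En' x) = mu x.
  move=> Ix; have := vderiv_mink_cst oI Ix t1n (sn x Ix) (dG1 x Ix) (den x Ix).
  by rewrite G2E !minkE t0n // tnn //; lra.
have t02 x : I x -> mink (G x) (e2 x) = 0.
  by move=> Ix; rewrite e2E !minkE t0' // g01 //; ring.
have t12 x : I x -> mink (G1 x) (e2 x) = 0.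
  by move=> Ix; rewrite e2E !minkE t1' // g11 //; ring.
have tn2 x : I x -> mink (en x) (e2 x) = 0.
  by move=> Ix; rewrite e2E !minkE tn' // (minkC (en x) (G1 x)) t1n //; ring.
have t22 x : I x -> mink (e2 x) (e2 x) = 1.
  move=> Ix; have dmu := smooth1_is_derive1 smu Ix.
  pose G3 := (derive1 mu x / s x) *: G x + (2 * mu x) *: G1 x + 0 *: en x + 1 *: e2 x.
  have dG2 : vderiv G2 x (s x *: G3).
    have D := vderiv_ext oI Ix (fun y _ => esym (G2E y)) (vderivD (vderivZ dmu (dG x Ix)) (den x Ix)).
    suff <- : derive1 mu x *: G x + mu x *: (s x *: G1 x) + s x *: En' x = s x *: G3 by [].
    rewrite EnE /G3; apply/matrixP => i j; rewrite !mxE; field; exact: sn.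
  (* The length of e2 is fixed by self-consistency: for the normalized chain the density formula
     reads s = s <e2,e2>^(1/4). *)
  have := @cds_formula _ _ n2 I F oI liF I G G1 G2 G3 s x oI (@subset_refl _ I) Ix
    (fun y _ => ex_intro _ (rho y) (GE y)) sp dG dG1 dG2.
  rewrite g11 // oner_eq0 => /(_ isT).
  have -> : arcden (G x) (G1 x) (G2 x) G3 = Num.sqrt (Num.sqrt (mink (e2 x) (e2 x))).
    rewrite /arcden g11 // divr1; congr (Num.sqrt (Num.sqrt _)).
    have -> : G2 x = mu x *: G x + 0 *: G1 x + 1 *: en x by rewrite G2E scale0r scale1r addr0.
    have -> : gramP (G x) (G1 x) (mu x *: G x + 0 *: G1 x + 1 *: en x) G3 =
        gramP (1 *: G x) (0 *: G x + 1 *: G1 x) (mu x *: G x + 0 *: G1 x + 1 *: en x) G3.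
      by rewrite !scale1r !scale0r !add0r.
    rewrite gramP_triangular; first by rewrite !mulr1 expr1n mul1r.
      by split; [exact: g00|exact: g01|exact: g11|exact: t0n|exact: tnn].
    by split; [exact: t1n|exact: t02|exact: t12|exact: tn2].
  move=> /esym; rewrite -[RHS]mulr1 => /(mulfI (sn x Ix)) /sqrt_eq1 /sqrt_eq1.
  by [].
exists mu, G, G1, en, e2, (fun x => E2' x - G x); split; last first.
  by move=> x Ix; exists (rho x); split; [exact: rho0|exact: GE].
apply: (Canonical oI sp ss smu sG sG1 sen se2 (smoothmxB oI sE2' sG) dG).
- by move=> x Ix; rewrite -G2E; exact: dG1.
- by move=> x Ix; rewrite -EnE; exact: den.
- by move=> x Ix; rewrite addrC subrK; exact: de2.
- by move=> x Ix; split; [exact: g00|exact: g01|exact: g11|exact: t0n|exact: tnn].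
- exact: t1n.
- by move=> x Ix; split; [exact: t02|exact: t12|exact: tn2|exact: t22].
Qed.

End GenericCurve.

(** * Smooth functions of two variables *)

Section TwoVariables.
Variable R : realType.
Implicit Types (g h : R -> R -> R) (T J : set R).

Section Domain.
Variables (T J : set R).
Hypotheses (oT : open T) (oJ : open J).

Definition diff2_base g : Prop := forall t x, T t -> J x ->
  [/\ {for (t, x), continuous (fun p : R * R => g p.1 p.2)},
      derivable (fun s => g s x) t 1 & derivable (fun y => g t y) x 1].

(** The analogue of [diffk]: recursion on the partial derivative applied first, with joint
    continuity recorded at every order as [smooth2] requires. *)
Fixpoint diff2k (k : nat) g : Prop :=
  diff2_base g /\ (if k is k'.+1 then diff2k k' (pdiff true g) /\ diff2k k' (pdiff false g) else True).

Lemma diff2k_base k g : diff2k k g -> diff2_base g.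
Proof. by case: k => [|k] []. Qed.

Lemma diff2kW k g : diff2k k.+1 g -> diff2k k g.
Proof.
elim: k g => [|k IH] g; first by case.
by case=> bg [Hx Ht]; split; [exact: bg|split; [exact: IH Hx|exact: IH Ht]].
Qed.

Let oTJ : open (T `*` J).
Proof.
rewrite openE => -[t x] [/= Tt Jx]; exists (T, J) => //=.
by split; [exact: open_nbhs_nbhs (conj oT Tt)|exact: open_nbhs_nbhs (conj oJ Jx)].
Qed.

Lemma smooth2_base g : smooth2 (T `*` J) g -> diff2_base g.
Proof.
move=> sg t x Tt Jx; have [cg dg] := sg [::].
have [d1 d2] := dg (t, x) (conj Tt Jx); split; [|exact: d1|exact: d2].
move: cg; rewrite (continuous_open_subspace (fun p : R * R => g p.1 p.2) oTJ) => cg.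
by apply: (cg (t, x)); rewrite inE; split.
Qed.

Lemma smooth2_pdiff b g : smooth2 (T `*` J) g -> smooth2 (T `*` J) (pdiff b g).
Proof.
move=> sg w; have := sg (rcons w b).
by rewrite foldr_rcons.
Qed.

Lemma smooth2_diff2k g : smooth2 (T `*` J) g <-> forall k, diff2k k g.
Proof.
split=> [sg k|].
  elim: k g sg => [|k IH] g sg; split; [exact: smooth2_base|exact: I|exact: smooth2_base|].
  by split; [exact: IH (@smooth2_pdiff true _ sg)|exact: IH (@smooth2_pdiff false _ sg)].
(* In [foldr pdiff g w] the last letter of w acts first on g, so the word is taken apart from its
   end. *)
move=> Hg w; elim/last_ind: w g Hg => [|w b IH] g Hg; last first.
  rewrite foldr_rcons; apply: IH => k.
  by case: (Hg k.+1) => _ []; case: b.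
have bg := diff2k_base (Hg 0%N); split; last first.
  by move=> [t x] [/= Tt Jx]; case: (bg t x Tt Jx) => _ d1 d2; exact: (conj d1 d2).
rewrite (continuous_open_subspace (fun p : R * R => g p.1 p.2) oTJ) => -[t x]; rewrite inE => -[/= Tt Jx].
by case: (bg t x Tt Jx) => c _ _; exact: c.
Qed.

Lemma pdiff_ext b g h : (forall t x, T t -> J x -> g t x = h t x) ->
  forall t x, T t -> J x -> pdiff b g t x = pdiff b h t x.
Proof.
move=> gh t x Tt Jx; case: b => /=; last by apply: (derive1_ext oJ Jx) => y Jy; exact: gh.
by apply: (derive1_ext oT Tt) => y Jy; exact: gh.
Qed.

Lemma diff2_base_ext g h : (forall t x, T t -> J x -> g t x = h t x) ->
  diff2_base g -> diff2_base h.
Proof.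
move=> gh bg t x Tt Jx; case: (bg t x Tt Jx) => c d1 d2; split.
- have N : \forall p \near (t, x), g p.1 p.2 = h p.1 p.2.
    by apply: (near_open oTJ (z := (t, x)) (conj Tt Jx)) => -[t' x'] [/= ? ?]; exact: gh.
  have E : g (t, x).1 (t, x).2 = h (t, x).1 (t, x).2 by exact: gh.
  rewrite /prop_for /continuous_at -E; apply: cvg_trans c.
  by apply: near_eq_cvg; apply: filterS N => p ->.
- by apply: (derivable_ext oT Tt _ d1) => y Ty; exact: gh.
- by apply: (derivable_ext oJ Jx _ d2) => y Jy; exact: gh.
Qed.

Lemma diff2k_ext k g h : (forall t x, T t -> J x -> g t x = h t x) ->
  diff2k k g -> diff2k k h.
Proof.
elim: k g h => [|k IH] g h gh [bg H]; split; try exact: (diff2_base_ext gh bg).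
  exact: I.
case: H => Ht Hx; split; [apply: IH Ht|apply: IH Hx]; exact: pdiff_ext.
Qed.

Lemma diff2_base_fst g t x : diff2_base g -> T t -> J x ->
  is_derive t (1 : R) (fun s => g s x) (pdiff true g t x).
Proof. by move=> bg Tt Jx; have [_ d _] := bg t x Tt Jx; exact: derivable_is_derive1 d. Qed.

Lemma diff2_base_snd g t x : diff2_base g -> T t -> J x ->
  is_derive x (1 : R) (fun y => g t y) (pdiff false g t x).
Proof. by move=> bg Tt Jx; have [_ _ d] := bg t x Tt Jx; exact: derivable_is_derive1 d. Qed.

Lemma diff2_baseD g h : diff2_base g -> diff2_base h -> diff2_base (fun t x => g t x + h t x).
Proof.
move=> bg bh t x Tt Jx; have [c _ _] := bg t x Tt Jx; have [c' _ _] := bh t x Tt Jx; split.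
- exact: cvgD c c'.
- exact: is_derive1_derivable (is_derive1D (diff2_base_fst bg Tt Jx) (diff2_base_fst bh Tt Jx)).
- exact: is_derive1_derivable (is_derive1D (diff2_base_snd bg Tt Jx) (diff2_base_snd bh Tt Jx)).
Qed.

Lemma diff2_baseM g h : diff2_base g -> diff2_base h -> diff2_base (fun t x => g t x * h t x).
Proof.
move=> bg bh t x Tt Jx; have [c _ _] := bg t x Tt Jx; have [c' _ _] := bh t x Tt Jx; split.
- exact: cvgM c c'.
- exact: is_derive1_derivable (is_derive1M (diff2_base_fst bg Tt Jx) (diff2_base_fst bh Tt Jx)).
- exact: is_derive1_derivable (is_derive1M (diff2_base_snd bg Tt Jx) (diff2_base_snd bh Tt Jx)).
Qed.

Lemma diff2kD k g h : diff2k k g -> diff2k k h -> diff2k k (fun t x => g t x + h t x).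
Proof.
elim: k g h => [|k IH] g h [bg Hg] [bh Hh]; split; [exact: diff2_baseD|exact: I|exact: diff2_baseD|].
case: Hg Hh => g1 g2 [h1 h2]; split.
  apply: diff2k_ext (IH _ _ g1 h1) => t x Tt Jx.
  by rewrite [RHS](is_derive1_derive1 (is_derive1D (diff2_base_fst bg Tt Jx) (diff2_base_fst bh Tt Jx))).
apply: diff2k_ext (IH _ _ g2 h2) => t x Tt Jx.
by rewrite [RHS](is_derive1_derive1 (is_derive1D (diff2_base_snd bg Tt Jx) (diff2_base_snd bh Tt Jx))).
Qed.

Lemma diff2kM k g h : diff2k k g -> diff2k k h -> diff2k k (fun t x => g t x * h t x).
Proof.
elim: k g h => [|k IH] g h Hg Hh; have bg := diff2k_base Hg; have bh := diff2k_base Hh;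
  split; [exact: diff2_baseM|exact: I|exact: diff2_baseM|].
have Wg := diff2kW Hg; have Wh := diff2kW Hh.
case: Hg Hh => [_ [g1 g2]] [_ [h1 h2]]; split.
  apply: diff2k_ext (diff2kD (IH _ _ g1 Wh) (IH _ _ Wg h1)) => t x Tt Jx.
  by rewrite [RHS](is_derive1_derive1 (is_derive1M (diff2_base_fst bg Tt Jx) (diff2_base_fst bh Tt Jx))).
apply: diff2k_ext (diff2kD (IH _ _ g2 Wh) (IH _ _ Wg h2)) => t x Tt Jx.
by rewrite [RHS](is_derive1_derive1 (is_derive1M (diff2_base_snd bg Tt Jx) (diff2_base_snd bh Tt Jx))).
Qed.

Lemma diff2k_cst k (c : R) : diff2k k (fun _ _ => c).
Proof.
have b c' : diff2_base (fun _ _ => c').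
  move=> t x Tt Jx; split; first exact: cst_continuous.
    exact: is_derive1_derivable (is_derive1_cst _ _).
  exact: is_derive1_derivable (is_derive1_cst _ _).
elim: k c => [|k IH] c; split; [exact: b|exact: I|exact: b|split].
  by apply: diff2k_ext (IH 0) => t x _ _ /=; rewrite (is_derive1_derive1 (is_derive1_cst _ _)).
by apply: diff2k_ext (IH 0) => t x _ _ /=; rewrite (is_derive1_derive1 (is_derive1_cst _ _)).
Qed.

Lemma diff2k_fst k : diff2k k (fun t _ => t).
Proof.
have b : diff2_base (fun t _ => t).
  move=> t x Tt Jx; split; first exact: cvg_fst.
    exact: is_derive1_derivable (is_derive1_id _).
  exact: is_derive1_derivable (is_derive1_cst _ _).
case: k => [|k]; split; [exact: b|exact: I|exact: b|split].
  by apply: diff2k_ext (diff2k_cst k 1) => t x _ _ /=; rewrite (is_derive1_derive1 (is_derive1_id _)).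
by apply: diff2k_ext (diff2k_cst k 0) => t x _ _ /=; rewrite (is_derive1_derive1 (is_derive1_cst _ _)).
Qed.

Lemma diff2k_snd k (f : R -> R) : smooth1 J f -> diff2k k (fun _ x => f x).
Proof.
have b f' : smooth1 J f' -> diff2_base (fun _ x => f' x).
  move=> sf t x Tt Jx; split.
  - by apply: (@continuous_comp _ _ _ snd f' (t, x)); [exact: cvg_snd|exact: smooth1_continuous sf Jx].
  - exact: is_derive1_derivable (is_derive1_cst _ _).
  - exact: is_derive1_derivable (smooth1_is_derive1 sf Jx).
elim: k f => [|k IH] f sf; split; [exact: b|exact: I|exact: b|split].
  by apply: diff2k_ext (diff2k_cst k 0) => t x _ _ /=; rewrite (is_derive1_derive1 (is_derive1_cst _ _)).
exact: IH (smooth1_derive1 sf).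
Qed.

Local Notation U := (T `*` J).

Lemma smooth2_ext g h : (forall t x, T t -> J x -> g t x = h t x) -> smooth2 U g -> smooth2 U h.
Proof. by move=> gh /smooth2_diff2k H; apply/smooth2_diff2k => k; exact: diff2k_ext gh _. Qed.

Lemma smooth2D g h : smooth2 U g -> smooth2 U h -> smooth2 U (fun t x => g t x + h t x).
Proof. by move=> /smooth2_diff2k Hg /smooth2_diff2k Hh; apply/smooth2_diff2k => k; exact: diff2kD. Qed.

Lemma smooth2M g h : smooth2 U g -> smooth2 U h -> smooth2 U (fun t x => g t x * h t x).
Proof. by move=> /smooth2_diff2k Hg /smooth2_diff2k Hh; apply/smooth2_diff2k => k; exact: diff2kM. Qed.

Lemma smooth2_cst (c : R) : smooth2 U (fun _ _ => c).
Proof. by apply/smooth2_diff2k => k; exact: diff2k_cst. Qed.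

Lemma smooth2_fst : smooth2 U (fun t _ => t).
Proof. by apply/smooth2_diff2k => k; exact: diff2k_fst. Qed.

Lemma smooth2_snd (f : R -> R) : smooth1 J f -> smooth2 U (fun _ x => f x).
Proof. by move=> sf; apply/smooth2_diff2k => k; exact: diff2k_snd. Qed.

Lemma smooth2B g h : smooth2 U g -> smooth2 U h -> smooth2 U (fun t x => g t x - h t x).
Proof.
move=> sg sh; apply: (smooth2_ext _ (smooth2D sg (smooth2M (smooth2_cst (-1)) sh))) => t x _ _.
by rewrite mulN1r.
Qed.

Lemma smooth2_sum (K : Type) (r : seq K) (P : pred K) (h : K -> R -> R -> R) :
  (forall i, P i -> smooth2 U (h i)) -> smooth2 U (fun t x => \sum_(i <- r | P i) h i t x).
Proof.
move=> Hh; elim: r => [|i r IH].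
  by apply: (smooth2_ext _ (smooth2_cst 0)) => t x _ _; rewrite big_nil.
case Pi: (P i); last by apply: (smooth2_ext _ IH) => t x _ _; rewrite big_cons Pi.
by apply: (smooth2_ext _ (smooth2D (Hh _ Pi) IH)) => t x _ _; rewrite big_cons Pi.
Qed.

Lemma smooth2_slice g t : smooth2 U g -> T t -> smooth1 J (g t).
Proof.
move=> sg Tt k x Jx; have [_ dg] := sg (nseq k false).
have [_] := dg (t, x) (conj Tt Jx).
suff -> : foldr (@pdiff R) g (nseq k false) t = iter k (@derive1 R R) (g t) by [].
elim: k {dg} => [//|k IH] /=; apply/funext => y.
by rewrite -IH.
Qed.

(** The mean value theorem is used twice: in the first variable for the difference of two slices,
    then in the second variable for the partial derivative so obtained. *)
Lemma double_difference g (t x r : R) : 0 < r ->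
  (forall t' x', t <= t' <= t + r -> x <= x' <= x + r -> derivable (fun s => g s x') t' 1 /\
     derivable (fun y => pdiff true g t' y) x' 1) ->
  exists t' x', [/\ t < t' < t + r, x < x' < x + r &
    g (t + r) (x + r) - g t (x + r) - g (t + r) x + g t x = r ^+ 2 * pdiff false (pdiff true g) t' x'].
Proof.
move=> r0 D; have tr : t < t + r by rewrite ltrDl.
have xr : x < x + r by rewrite ltrDl.
have E (t' : R) : t <= t' <= t + r -> is_derive t' (1 : R) (fun s => g s (x + r) - g s x)
    (pdiff true g t' (x + r) - pdiff true g t' x).
  move=> tt; apply: is_derive1B; apply: derivable_is_derive1.
    by case: (D t' (x + r) tt) => [|d _]; [rewrite lexx ltW|exact: d].
  by case: (D t' x tt) => [|d _]; [rewrite lexx ltW|exact: d].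
have [t' tt' Et] := @MVT R (fun s => g s (x + r) - g s x)
   (fun t' => pdiff true g t' (x + r) - pdiff true g t' x) t (t + r) tr
   ltac:(by move=> z; rewrite in_itv /= => /andP[z1 z2]; apply: E; rewrite !ltW)
   ltac:(by apply: derivable_within_continuous => z; rewrite in_itv /= => /E /is_derive1_derivable).
rewrite in_itv /= in tt'; have tt : t <= t' <= t + r by case/andP: tt' => a b; rewrite !ltW.
have E' (x' : R) : x <= x' <= x + r -> is_derive x' (1 : R) (fun y => pdiff true g t' y)
    (pdiff false (pdiff true g) t' x').
  by move=> xx; apply: derivable_is_derive1; case: (D t' x' tt xx).
have [x' xx' Ex] := @MVT R (fun y => pdiff true g t' y)
   (fun x' => pdiff false (pdiff true g) t' x') x (x + r) xr
   ltac:(by move=> z; rewrite in_itv /= => /andP[z1 z2]; apply: E'; rewrite !ltW)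
   ltac:(by apply: derivable_within_continuous => z; rewrite in_itv /= => /E' /is_derive1_derivable).
rewrite in_itv /= in xx'; exists t', x'; split=> //.
have := Et; rewrite Ex => H.
have rr (a : R) : a + r - a = r by rewrite addrC addKr.
rewrite !rr in H.
transitivity ((g (t + r) (x + r) - g (t + r) x) - (g t (x + r) - g t x)); first ring.
by rewrite H; ring.
Qed.

Lemma dist_half (d a b c : R) : `|a - c| < d / 2 -> `|b - c| < d / 2 -> `|a - b| <= d.
Proof. by rewrite !ltr_norml ler_norml => /andP[? ?] /andP[? ?]; apply/andP; split; lra. Qed.

(** The double difference is symmetric in the two variables, so the two mixed derivatives agree at a
    pair of points of an arbitrarily small box; their continuity carries the equality to the
    corner. *)
Lemma clairaut g t x : smooth2 U g -> T t -> J x ->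
  pdiff true (pdiff false g) t x = pdiff false (pdiff true g) t x.
Proof.
move=> sg Tt Jx.
set A := pdiff true (pdiff false g); set B := pdiff false (pdiff true g).
have sA : smooth2 U A by do 2 apply: smooth2_pdiff.
have sB : smooth2 U B by do 2 apply: smooth2_pdiff.
have [cA _ _] := smooth2_base sA Tt Jx; have [cB _ _] := smooth2_base sB Tt Jx.
apply/eqP; rewrite -subr_eq0 -normr_le0; apply/ler_addgt0Pr => d d0; rewrite add0r.
have d2 : 0 < d / 2 by rewrite divr_gt0.
have /cvgrPdist_lt /(_ _ d2) NA := cA; have /cvgrPdist_lt /(_ _ d2) NB := cB.
have NU := open_nbhs_nbhs (conj oTJ (conj Tt Jx : (T `*` J) (t, x))).
have N : nbhs (t, x) (U `&` ((fun p => `|A t x - A p.1 p.2| < d / 2) `&`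
    (fun p => `|B t x - B p.1 p.2| < d / 2))).
  by apply: filterI; [exact: NU|apply: filterI; [exact: NA|exact: NB]].
have [r0 /= r00 Hr] := (iffLR (nbhs_ballP (t, x) _)) N.
pose r := r0 / 2; have r_gt0 : 0 < r by rewrite divr_gt0.
have box t' x' : t <= t' <= t + r -> x <= x' <= x + r ->
    [/\ T t', J x', `|A t x - A t' x'| < d / 2 & `|B t x - B t' x'| < d / 2].
  move=> /andP[t1 t2] /andP[x1 x2].
  have rr0 : r < r0 by rewrite /r; lra.
  have [[Tt' Jx'] [a1 a2]] := Hr (t', x') ltac:(split; rewrite /ball /= ltr_norml; apply/andP; split; lra).
  by split; [exact: Tt'|exact: Jx'|exact: a1|exact: a2].
have bg := smooth2_base sg; have bt := smooth2_base (@smooth2_pdiff true _ sg).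
have bx := smooth2_base (@smooth2_pdiff false _ sg).
have D1 t' x' : t <= t' <= t + r -> x <= x' <= x + r ->
    derivable (fun s => g s x') t' 1 /\ derivable (fun y => pdiff true g t' y) x' 1.
  move=> tt xx; have [Tt' Jx' _ _] := box t' x' tt xx.
  by case: (bg t' x' Tt' Jx') (bt t' x' Tt' Jx') => _ d1 _ [_ _ d3]; exact: (conj d1 d3).
have D2 x' t' : x <= x' <= x + r -> t <= t' <= t + r ->
    derivable (fun y => g t' y) x' 1 /\ derivable (fun s => pdiff false g s x') t' 1.
  move=> xx tt; have [Tt' Jx' _ _] := box t' x' tt xx.
  by case: (bg t' x' Tt' Jx') (bx t' x' Tt' Jx') => _ _ d1 [_ d3 _]; exact: (conj d1 d3).
have [t1 [x1 [tt1 xx1 E1]]] := @double_difference g t x r r_gt0 D1.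
(* Exchanging the arguments of g turns the mixed derivative into the one taken in the other
   order. *)
have [x2 [t2 [xx2 tt2 E2]]] := @double_difference (fun a b => g b a) x t r r_gt0 D2.
have AB : B t1 x1 = A t2 x2.
  have r2 : r ^+ 2 != 0 by rewrite expf_neq0 // gt_eqF.
  apply: (mulfI r2); rewrite -[LHS]E1 -[RHS]E2; ring.
have lw (a b c : R) : a < b < c -> a <= b <= c by case/andP=> ? ?; rewrite !ltW.
have [_ _ _ b1] := box _ _ (lw _ _ _ tt1) (lw _ _ _ xx1).
have [_ _ a2 _] := box _ _ (lw _ _ _ tt2) (lw _ _ _ xx2).
rewrite AB in b1.
exact: (dist_half a2 b1).
Qed.

End Domain.

Lemma smooth2_subset (T T' J J' : set R) g : open T -> open T' -> open J -> open J' ->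
  T' `<=` T -> J' `<=` J -> smooth2 (T `*` J) g -> smooth2 (T' `*` J') g.
Proof.
move=> oT oT' oJ oJ' TT JJ /(smooth2_diff2k oT oJ) H; apply/(smooth2_diff2k oT' oJ') => k.
elim: k g {H}(H k) => [|k IH] g [bg Hg]; split; try by move=> t x /TT Tt /JJ Jx; exact: bg.
  exact: I.
by case: Hg => g1 g2; split; [exact: IH g1|exact: IH g2].
Qed.

End TwoVariables.

(* [ring] and [field] compare atoms up to conversion, so the products are made opaque first. *)
Ltac abstract_mink := repeat match goal with |- context [mink ?u ?v] =>
  let m := fresh "m" in move: (mink u v) => m end.

(** * The first variation of the conformal arclength *)

Section FirstVariation.
Variables (R : realType) (n : nat).
Hypothesis n3 : (3 <= n)%N.
Local Notation V := 'cV[R]_(n.+2).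
Let n2 : (2 <= n)%N := ltnW n3.

Section Families.
Variables (T J : set R) (s : R -> R).
Hypotheses (oT : open T) (oJ : open J) (ss : smooth1 J s) (sp : forall x, J x -> 0 < s x).
Implicit Types H K : R -> R -> V.

Definition smooth_family H := forall i, smooth2 (T `*` J) (fun t x => H t x i 0).

Definition dt H t x : V := dmx (fun t' => H t' x) t.

Lemma smooth_family_dds H : smooth_family H -> smooth_family (fun t => dds_vec s (H t)).
Proof.
move=> sH i; have si : smooth1 J (fun x => (s x)^-1).
  by apply: (smooth1V oJ) => // x /sp /gt_eqF ->.
apply: (smooth2_ext oT oJ _ (smooth2M oT oJ (smooth2_snd oT oJ si) (@smooth2_pdiff _ _ _ false _ (sH i)))).
by move=> t x _ _; rewrite !mxE.
Qed.

Lemma smooth_family_mink H K : smooth_family H -> smooth_family K ->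
  smooth2 (T `*` J) (fun t x => mink (H t x) (K t x)).
Proof.
move=> sH sK; have HK i j := smooth2M oT oJ (sH i) (sK j).
apply: (smooth2B oT oJ); [apply: (smooth2B oT oJ)|]; [|exact: HK|exact: HK].
by apply: (smooth2_sum oT oJ) => i _; exact: HK.
Qed.

Lemma smooth_family_slice H t : smooth_family H -> T t -> smoothmx J (H t).
Proof. by move=> sH Tt i j; rewrite ord1; exact: smooth2_slice (sH i) Tt. Qed.

Lemma smooth_family_dt H : smooth_family H -> smooth_family (dt H).
Proof.
move=> sH i; apply: (smooth2_ext oT oJ _ (@smooth2_pdiff _ _ _ true _ (sH i))) => t x _ _.
by rewrite mxE.
Qed.

Lemma vderiv_dt H t x : smooth_family H -> T t -> J x -> vderiv (fun t' => H t' x) t (dt H t x).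
Proof.
move=> sH Tt Jx i; rewrite mxE.
exact: (diff2_base_fst (smooth2_base oT oJ (sH i)) Tt Jx).
Qed.

(** As s does not depend on t, this is the symmetry of mixed derivatives. *)
Lemma dt_dds H t x : smooth_family H -> T t -> J x ->
  dt (fun t' => dds_vec s (H t')) t x = dds_vec s (dt H t) x.
Proof.
move=> sH Tt Jx; apply/matrixP => i j; rewrite ord1 !mxE.
have c := clairaut oT oJ (sH i) Tt Jx.
transitivity ((s x)^-1 * pdiff true (pdiff false (fun t x => H t x i 0)) t x).
  have b := diff2_base_fst (smooth2_base oT oJ (@smooth2_pdiff _ _ _ false _ (sH i))) Tt Jx.
  have := is_derive1M (is_derive1_cst (s x)^-1 t) b; rewrite mul0r add0r => /is_derive1_derive1 <-.
  by apply: (derive1_ext oT Tt) => y _; rewrite !mxE.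
rewrite c /=; congr (_ * _); apply: (derive1_ext oJ Jx) => y _.
by rewrite mxE.
Qed.

End Families.

(** The differential of [gram_poly] in the direction of the primed arguments. *)
Definition dgram_poly (A B C E G K M U A' B' C' E' G' K' M' U' : R) : R :=
  2 * A * A' * (C * U - G ^+ 2) + A ^+ 2 * (C' * U + C * U' - 2 * G * G')
  - 2 * (A' * B + A * B') * (C * M - E * G)
  - 2 * A * B * (C' * M + C * M' - E' * G - E * G')
  + 2 * B * B' * (C * K - E ^+ 2) + B ^+ 2 * (C' * K + C * K' - 2 * E * E').

Lemma is_derive1_gram_poly (A B C E G K M U : R -> R) (A' B' C' E' G' K' M' U' t : R) :
  is_derive t 1 A A' -> is_derive t 1 B B' -> is_derive t 1 C C' -> is_derive t 1 E E' ->
  is_derive t 1 G G' -> is_derive t 1 K K' -> is_derive t 1 M M' -> is_derive t 1 U U' ->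
  is_derive t (1 : R) (fun t => gram_poly (A t) (B t) (C t) (E t) (G t) (K t) (M t) (U t))
    (dgram_poly (A t) (B t) (C t) (E t) (G t) (K t) (M t) (U t) A' B' C' E' G' K' M' U').
Proof.
move=> dA dB dC dE dG dK dM dU.
have sq (f : R -> R) (f' : R) : is_derive t 1 f f' -> is_derive t (1 : R) (fun t => f t ^+ 2) (2 * f t * f').
  move=> df; apply: (is_derive_eq (is_derive1M df df)); ring.
have c2 := is_derive1_cst (2 : R) t.
have H := is_derive1D (is_derive1B (is_derive1M (sq _ _ dA) (is_derive1B (is_derive1M dC dU) (sq _ _ dG)))
  (is_derive1M (is_derive1M (is_derive1M c2 dA) dB) (is_derive1B (is_derive1M dC dM) (is_derive1M dE dG))))
  (is_derive1M (sq _ _ dB) (is_derive1B (is_derive1M dC dK) (sq _ _ dE))).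
by apply: (is_derive_eq H); rewrite /dgram_poly; ring.
Qed.

(** On the base chain A = -1, B = 0, C = 1, E = 0, G = 2 mu, M = -m and U = 4 mu^2 + 1. Hence the
    determinant is U - G^2 = 1, and most terms of its differential disappear. The vectors w_i are
    arbitrary. *)
Lemma gram_poly_variation (e0 e1 en e2 g0 g1 g2 g3 w0 w1 w2 w3 : V) (mu m : R) :
  [/\ mink e0 e0 = 0, mink e0 e1 = 0, mink e1 e1 = 1, mink e0 en = -1 & mink en en = 0] ->
  mink e1 en = 0 ->
  [/\ mink e0 e2 = 0, mink e1 e2 = 0, mink en e2 = 0 & mink e2 e2 = 1] ->
  [/\ g0 = e0, g1 = e1, g2 = mu *: e0 + en & g3 = m *: e0 + (2 * mu) *: e1 + e2] ->
  gramP g0 g1 g2 g3 = 1 /\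
  dgram_poly (mink g0 g2) (mink g0 g3) (mink g1 g1) (mink g1 g2) (mink g1 g3) (mink g2 g2)
    (mink g2 g3) (mink g3 g3) (mink w0 g2 + mink g0 w2) (mink w0 g3 + mink g0 w3)
    (mink w1 g1 + mink g1 w1) (mink w1 g2 + mink g1 w2) (mink w1 g3 + mink g1 w3)
    (mink w2 g2 + mink g2 w2) (mink w2 g3 + mink g2 w3) (mink w3 g3 + mink g3 w3) =
  - 2 * (mink w0 (mu *: e0 + en) + mink e0 w2) + (4 * mu ^+ 2 + 1) * (2 * mink e1 w1)
    + 2 * mink g3 w3 - 4 * mu * (mink w1 g3 + mink e1 w3) - 2 * m * (mink w0 g3 + mink e0 w3).
Proof.
move=> [t00 t01 t11 t0n tnn] t1n [t02 t12 tn2 t22] [-> -> g2E g3E].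
have hA : mink e0 g2 = -1 by rewrite g2E !minkE t00 t0n; ring.
have hB : mink e0 g3 = 0 by rewrite g3E !minkE t00 t01 t02; ring.
have hE : mink e1 g2 = 0 by rewrite g2E !minkE (minkC e1) t01 t1n; ring.
have hG : mink e1 g3 = 2 * mu by rewrite g3E !minkE (minkC e1 e0) t01 t11 t12; ring.
have hM : mink g2 g3 = - m.
  by rewrite g2E g3E !minkE t00 t01 t02 (minkC en e0) (minkC en e1) t0n t1n tn2; ring.
have hU : mink g3 g3 = 4 * mu ^+ 2 + 1.
  rewrite g3E !minkE (minkC e1 e0) (minkC e2 e0) (minkC e2 e1).
  by rewrite t00 t01 t02 t11 t12 t22; ring.
rewrite /gramP /gram_poly /dgram_poly -g2E hA hB hE hG hM hU t11 (minkC w1 e1) (minkC w3 g3).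
by abstract_mink; split; ring.
Qed.

Variables (T I J : set R) (s mu r : R -> R) (e0 e1 en e2 X : R -> V) (W : R -> R -> V).
Hypotheses (oT : open T) (T0 : T 0) (oI : open I) (JI : J `<=` I).
Hypothesis sW : forall i j, smooth2 (T `*` I) (fun t x => W t x i j).
Hypothesis liW : forall t, T t -> lift_immersion I (W t).
Hypothesis can : canonical J s mu e0 e1 en e2 X.
Hypotheses (sr : smooth1 J r) (r0 : forall x, J x -> r x != 0).
Hypothesis e0W : forall x, J x -> e0 x = r x *: W 0 x.

Let oJ := can_open can.
Let sp := can_pos can.
Let ss := can_smooth_s can.
Let sn x : J x -> s x != 0. Proof. by move=> /sp /gt_eqF ->. Qed.

(** Both r and s belong to the base curve: for t other than 0 the lift is not normalized and s is
    not its density. The density formula allows this, and d/ds then commutes with d/dt. *)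
Definition var0 t x : V := r x *: W t x.
Definition var1 t : R -> V := dds_vec s (var0 t).
Definition var2 t : R -> V := dds_vec s (var1 t).
Definition var3 t : R -> V := dds_vec s (var2 t).

Let sf0 : smooth_family T J var0.
Proof.
move=> i; have sWJ := smooth2_subset oT oT oI oJ (@subset_refl _ T) JI (sW i 0).
apply: (smooth2_ext oT oJ _ (smooth2M oT oJ (smooth2_snd oT oJ sr) sWJ)) => t x _ _.
by rewrite mxE.
Qed.
Let sf1 : smooth_family T J var1. Proof. exact: smooth_family_dds sf0. Qed.
Let sf2 : smooth_family T J var2. Proof. exact: smooth_family_dds sf1. Qed.
Let sf3 : smooth_family T J var3. Proof. exact: smooth_family_dds sf2. Qed.

Definition var_gram t x := gramP (var0 t x) (var1 t x) (var2 t x) (var3 t x).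
Definition var_speed t x := mink (var1 t x) (var1 t x).
Definition var_den t x := s x * arcden (var0 t x) (var1 t x) (var2 t x) (var3 t x).

Let vd0 t x : T t -> J x -> vderiv (var0 t) x (s x *: var1 t x).
Proof. by move=> Tt Jx; exact: (vderiv_dds_vec sp (smooth_family_slice sf0 Tt) Jx). Qed.
Let vd1 t x : T t -> J x -> vderiv (var1 t) x (s x *: var2 t x).
Proof. by move=> Tt Jx; exact: (vderiv_dds_vec sp (smooth_family_slice sf1 Tt) Jx). Qed.
Let vd2 t x : T t -> J x -> vderiv (var2 t) x (s x *: var3 t x).
Proof. by move=> Tt Jx; exact: (vderiv_dds_vec sp (smooth_family_slice sf2 Tt) Jx). Qed.

Lemma var_speed_gt0 t x : T t -> J x -> 0 < var_speed t x.
Proof.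
move=> Tt Jx; have Ix := JI Jx; have li := liW Tt.
have D := vderivZ (smooth1_is_derive1 sr Jx) (lift_vderiv li Ix).
have E := vderiv_unique (vd0 Tt Jx) D.
have H : s x ^+ 2 * var_speed t x = r x ^+ 2 * mink (dmx (W t) x) (dmx (W t) x).
  rewrite expr2 -mulrA /var_speed -minkZr -minkZl E !minkE (minkC (dmx (W t) x)) (lift_null li) //.
  rewrite (lift_deriv_orth oI li) //; ring.
have : 0 < s x ^+ 2 * var_speed t x.
  by rewrite H mulr_gt0 ?(lift_speed_gt0 oI li) // lt0r sqrf_eq0 r0 // sqr_ge0.
by rewrite pmulr_rgt0 // exprn_gt0 // sp.
Qed.

Lemma cds_var_den t x : T t -> J x -> cds I (W t) x = var_den t x.
Proof.
move=> Tt Jx; rewrite (@cds_formula _ _ n2 I (W t) oI (liW Tt) J (var0 t) (var1 t) (var2 t) (var3 t x) s x) //.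
- by move=> y _; exists (r y).
- by move=> y; exact: vd0.
- by move=> y; exact: vd1.
- exact: vd2.
- by rewrite gt_eqF // var_speed_gt0.
Qed.

Lemma smooth2_var_gram : smooth2 (T `*` J) var_gram.
Proof.
have m (H K : R -> R -> V) : smooth_family T J H -> smooth_family T J K -> smooth2 (T `*` J) (fun t x => mink (H t x) (K t x)).
  exact: smooth_family_mink.
have M := smooth2M oT oJ; have B := smooth2B oT oJ; have c2 := smooth2_cst oT oJ 2.
apply: (smooth2D oT oJ); first apply: (B).
- apply: (M); first by apply: (M); exact: (m).
  by apply: (B); apply: (M); exact: (m).
- apply: (M); first by apply: (M); [apply: (M); [exact: c2|exact: (m)]|exact: (m)].
  by apply: (B); apply: (M); exact: (m).
- apply: (M); first by apply: (M); exact: (m).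
  by apply: (B); apply: (M); exact: (m).
Qed.

Lemma smooth2_var_speed : smooth2 (T `*` J) var_speed.
Proof. exact: smooth_family_mink. Qed.

Definition var_dot t x : R := s x *
  (pdiff true var_gram t x / (2 * Num.sqrt (var_gram t x)) / (2 * Num.sqrt (Num.sqrt (var_gram t x)))
     / var_speed t x
   + Num.sqrt (Num.sqrt (var_gram t x)) * (- pdiff true var_speed t x / var_speed t x ^+ 2)).

(** Positivity of the determinant is assumed at the given (t, x) only, because a varied curve need
    not be 1-generic. *)
Lemma is_derive_var_den t x : T t -> J x -> 0 < var_gram t x ->
  is_derive t (1 : R) (fun t => var_den t x) (var_dot t x).
Proof.
move=> Tt Jx g0.
have dg := diff2_base_fst (smooth2_base oT oJ smooth2_var_gram) Tt Jx.
have dc := diff2_base_fst (smooth2_base oT oJ smooth2_var_speed) Tt Jx.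
have c0 : var_speed t x != 0 by rewrite gt_eqF // var_speed_gt0.
have sg0 : 0 < Num.sqrt (var_gram t x) by rewrite sqrtr_gt0.
have d1 := is_derive1_sqrt_comp (f := fun t => var_gram t x) g0 dg.
have d2 := is_derive1_sqrt_comp (f := fun t => Num.sqrt (var_gram t x)) sg0 d1.
have H := is_derive1M (is_derive1_cst (s x) t) (is_derive1M d2 (is_derive1V (f := fun t => var_speed t x) c0 dc)).
by apply: (is_derive_eq H); rewrite mul0r add0r /var_dot.
Qed.

Lemma base0 x : J x -> var0 0 x = e0 x. Proof. by move=> Jx; rewrite e0W. Qed.

Lemma base1 x : J x -> var1 0 x = e1 x.
Proof.
move=> Jx; rewrite /var1 (dds_vec_ext oJ Jx (fun y _ => erefl (s y)) base0).
exact: (dds_vec_vderiv (sn Jx) (can_D0 can Jx)).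
Qed.

Lemma base2 x : J x -> var2 0 x = mu x *: e0 x + en x.
Proof.
move=> Jx; rewrite /var2 (dds_vec_ext oJ Jx (fun y _ => erefl (s y)) base1).
exact: (dds_vec_vderiv (sn Jx) (can_D1 can Jx)).
Qed.

Lemma base3 x : J x -> var3 0 x = (derive1 mu x / s x) *: e0 x + (2 * mu x) *: e1 x + e2 x.
Proof.
move=> Jx; rewrite /var3 (dds_vec_ext oJ Jx (fun y _ => erefl (s y)) base2).
apply: (dds_vec_vderiv (sn Jx)).
have dmu := smooth1_is_derive1 (can_smooth_mu can) Jx.
have D := vderivD (vderivZ dmu (can_D0 can Jx)) (can_Dn can Jx).
suff -> : s x *: ((derive1 mu x / s x) *: e0 x + (2 * mu x) *: e1 x + e2 x) =
  derive1 mu x *: e0 x + mu x *: (s x *: e1 x) + s x *: (mu x *: e1 x + e2 x) by [].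
by apply/matrixP => i j; rewrite !mxE; field; exact: sn.
Qed.

(** The variation field of the normalized lift, called W in the overview; here [W] is the family of
    lifts. *)
Definition vf0 x := dt var0 0 x.
Definition vf1 := dds_vec s vf0.
Definition vf2 := dds_vec s vf1.
Definition vf3 := dds_vec s vf2.

Let sv0 : smoothmx J vf0. Proof. exact: smooth_family_slice (smooth_family_dt oT oJ sf0) T0. Qed.
Let sv1 : smoothmx J vf1. Proof. exact: smooth_dds_vec oJ sp ss sv0. Qed.
Let sv2 : smoothmx J vf2. Proof. exact: smooth_dds_vec oJ sp ss sv1. Qed.

Lemma dt_var1 x : J x -> dt var1 0 x = vf1 x.
Proof. by move=> Jx; exact: (dt_dds s oT oJ sf0 T0 Jx). Qed.

Lemma dt_var2 x : J x -> dt var2 0 x = vf2 x.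
Proof.
move=> Jx; rewrite (dt_dds s oT oJ sf1 T0 Jx).
exact: (dds_vec_ext oJ Jx (fun y _ => erefl (s y)) dt_var1).
Qed.

Lemma dt_var3 x : J x -> dt var3 0 x = vf3 x.
Proof.
move=> Jx; rewrite (dt_dds s oT oJ sf2 T0 Jx).
exact: (dds_vec_ext oJ Jx (fun y _ => erefl (s y)) dt_var2).
Qed.

Let dv0 x : J x -> vderiv (fun t => var0 t x) 0 (vf0 x).
Proof. by move=> Jx; exact: (vderiv_dt oT oJ sf0 T0 Jx). Qed.
Let dv1 x : J x -> vderiv (fun t => var1 t x) 0 (vf1 x).
Proof. by move=> Jx; rewrite -dt_var1 //; exact: (vderiv_dt oT oJ sf1 T0 Jx). Qed.
Let dv2 x : J x -> vderiv (fun t => var2 t x) 0 (vf2 x).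
Proof. by move=> Jx; rewrite -dt_var2 //; exact: (vderiv_dt oT oJ sf2 T0 Jx). Qed.
Let dv3 x : J x -> vderiv (fun t => var3 t x) 0 (vf3 x).
Proof. by move=> Jx; rewrite -dt_var3 //; exact: (vderiv_dt oT oJ sf3 T0 Jx). Qed.

Lemma vf0_orth x : J x -> mink (e0 x) (vf0 x) = 0.
Proof.
move=> Jx; rewrite -(base0 Jx).
apply: (vderiv_null (c := 0) oT T0 _ (dv0 Jx)) => t Tt.
by rewrite !minkE (lift_null (liW Tt)) ?mulr0 //; exact: JI.
Qed.

Let vdf0 x : J x -> vderiv vf0 x (s x *: vf1 x).
Proof. exact: (vderiv_dds_vec sp sv0). Qed.
Let vdf1 x : J x -> vderiv vf1 x (s x *: vf2 x).
Proof. exact: (vderiv_dds_vec sp sv1). Qed.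
Let vdf2 x : J x -> vderiv vf2 x (s x *: vf3 x).
Proof. exact: (vderiv_dds_vec sp sv2). Qed.

Lemma vf1_orth x : J x -> mink (e0 x) (vf1 x) = - mink (e1 x) (vf0 x).
Proof.
move=> Jx; have := vderiv_mink_cst oJ Jx vf0_orth (sn Jx) (can_D0 can Jx) (vdf0 Jx).
by rewrite addrC => /eqP; rewrite addr_eq0 => /eqP.
Qed.

Lemma var_base_products x : J x ->
  [/\ var_gram 0 x = 1, var_speed 0 x = 1,
    pdiff true var_speed 0 x = 2 * mink (e1 x) (vf1 x) &
    pdiff true var_gram 0 x = 
      - 2 * (mink (vf0 x) (mu x *: e0 x + en x) + mink (e0 x) (vf2 x))
      + (4 * mu x ^+ 2 + 1) * (2 * mink (e1 x) (vf1 x))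
      + 2 * mink (var3 0 x) (vf3 x)
      - 4 * mu x * (mink (vf1 x) (var3 0 x) + mink (e1 x) (vf3 x))
      - 2 * (derive1 mu x / s x) * (mink (vf0 x) (var3 0 x) + mink (e0 x) (vf3 x))].
Proof.
move=> Jx.
have P := gram_poly_variation (vf0 x) (vf1 x) (vf2 x) (vf3 x) (can_table can Jx) (can_table1n can Jx)
  (can_table2 can Jx) (And4 (base0 Jx) (base1 Jx) (base2 Jx) (base3 Jx)).
split.
- by case: P.
- by rewrite /var_speed base1 //; case: (can_table can Jx).
- have H := vderiv_mink (dv1 Jx) (dv1 Jx).
  rewrite /pdiff (is_derive1_derive1 H) base1 // (minkC (vf1 x)); ring.
- have H := is_derive1_gram_poly (vderiv_mink (dv0 Jx) (dv2 Jx)) (vderiv_mink (dv0 Jx) (dv3 Jx))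
    (vderiv_mink (dv1 Jx) (dv1 Jx)) (vderiv_mink (dv1 Jx) (dv2 Jx)) (vderiv_mink (dv1 Jx) (dv3 Jx))
    (vderiv_mink (dv2 Jx) (dv2 Jx)) (vderiv_mink (dv2 Jx) (dv3 Jx)) (vderiv_mink (dv3 Jx) (dv3 Jx)).
  case: P => _ P; exact: (etrans (is_derive1_derive1 H) P).
Qed.

(* What is left at the end points when [var_dot] is integrated by parts until [vf0] carries no derivative *)
Definition bdry x : R :=
  1 / 2 * (mink (e2 x) (vf2 x) - mink (e0 x + X x) (vf1 x) + mink (e1 x + dds_vec s X x) (vf0 x)
    - mink (e0 x) (vf1 x) + mink (e1 x) (vf0 x) + mink (e1 x - (2 * mu x) *: e2 x) (vf0 x))
  - 2 * mink (e1 x) (vf0 x).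

Let sX := can_smoothX can.
Let sXs : smoothmx J (dds_vec s X). Proof. exact: smooth_dds_vec oJ sp ss sX. Qed.

Lemma smooth_bdry : smooth1 J bdry.
Proof.
have m (f g : R -> V) : smoothmx J f -> smoothmx J g -> smooth1 J (fun x => mink (f x) (g x)).
  by move=> sf sg; exact: smooth1_mink.
have s0 := can_smooth0 can; have s1 := can_smooth1 can; have s2 := can_smooth2 can.
have c (k : R) := @smooth1_cst _ J oJ k.
have D := smooth1D oJ; have B := smooth1B oJ; have M := smooth1M oJ.
have h1 := m _ _ s2 sv2.
have h2 := m _ _ (smoothmxD oJ s0 sX) sv1.
have h3 := m _ _ (smoothmxD oJ s1 sXs) sv0.
have h4 := m _ _ s0 sv1.
have h5 := m _ _ s1 sv0.
have h6 := m _ _ (smoothmxB oJ s1 (smoothmxZ oJ (M _ _ (c 2) (can_smooth_mu can)) s2)) sv0.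
exact: (B _ _ (M _ _ (c (1 / 2)) (D _ _ (D _ _ (B _ _ (D _ _ (B _ _ h1 h2) h3) h4) h5) h6)) (M _ _ (c 2) h5)).
Qed.

(** On the base curve the determinant and the speed are 1, so the density varies by s times a
    quarter of the variation of the determinant minus the variation of the speed. After [bdry] is
    differentiated with the structure equations, an algebraic identity is left, valid modulo
    <e0,vf0> = 0 and its derivative. *)
Lemma first_variation x : J x ->
  var_dot 0 x = derive1 bdry x + s x / 2 * mink (EL s mu e2 X x) (vf0 x).
Proof.
move=> Jx; have [hg hc hdc hdg] := var_base_products Jx.
have o0 := vf0_orth Jx; have o1 := vf1_orth Jx.
have d0 := can_D0 can Jx; have d1 := can_D1 can Jx; have d2 := can_D2 can Jx.
have dX := vderiv_dds_vec sp sX Jx; have dXs := vderiv_dds_vec sp sXs Jx.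
have dmu := smooth1_is_derive1 (can_smooth_mu can) Jx.
have c2 := is_derive1_cst (2 : R) x.
have w0 := vdf0 Jx; have w1 := vdf1 Jx; have w2 := vdf2 Jx.
have h1 := vderiv_mink d2 w2.
have h2 := vderiv_mink (vderivD d0 dX) w1.
have h3 := vderiv_mink (vderivD d1 dXs) w0.
have h4 := vderiv_mink d0 w1.
have h5 := vderiv_mink d1 w0.
have h6 := vderiv_mink (vderivB d1 (vderivZ (is_derive1M c2 dmu) d2)) w0.
have H := is_derive1B (is_derive1M (is_derive1_cst (1 / 2 : R) x)
  (is_derive1D (is_derive1D (is_derive1B (is_derive1D (is_derive1B h1 h2) h3) h4) h5) h6))
  (is_derive1M c2 h5).
rewrite [derive1 bdry x](is_derive1_derive1 H) /var_dot hg hc hdc hdg !sqrtr1 base3 //.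
have [m mE] : {m | m = derive1 mu x / s x} by exists (derive1 mu x / s x).
have -> : derive1 mu x = s x * m by rewrite mE mulrC divfK // sn.
have -> : s x * m / s x = m by rewrite [s x * m]mulrC mulfK // sn.
have -> : EL s mu e2 X x = - dds_vec s (dds_vec s X) x + m *: e2 x + (2 * mu x) *: X x by rewrite mE.
move: (sn Jx) o0 o1.
generalize (e0 x) (e1 x) (en x) (e2 x) (X x) (vf0 x) (vf1 x) (vf2 x) (vf3 x) (dds_vec s X x)
  (dds_vec s (dds_vec s X) x) (s x) (mu x).
move=> u0 u1 un u2 Y z0 z1 z2 z3 Ys Yss a b a0 {}o0 {}o1.
rewrite !minkE !(minkC z0) !(minkC z1) o0 o1.
by abstract_mink; field.
Qed.

(* A variation proportional to [e0] only moves the lift, not the curve. *)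
Lemma bdry_eq0 x : J x -> (exists N : set R, [/\ open N, N x, N `<=` J &
    forall y t, N y -> T t -> exists c, var0 t y = c *: e0 y]) -> bdry x = 0.
Proof.
move=> Jx [N [oN Nx NJ HN]].
(* The pointwise factors of the hypothesis have no regularity; pairing with en, where <e0,en> = -1,
   exhibits the factor of [vf0] as a smooth function. *)
pose lam y := - mink (vf0 y) (en y).
have v0E y : N y -> vf0 y = lam y *: e0 y.
  move=> Ny; have Jy := NJ _ Ny; have [_ _ _ t0n _] := can_table can Jy.
  have d := is_derive1N (vderiv_mink (dv0 Jy) (vderiv_cst (en y) 0)).
  have D := vderivZ d (vderiv_cst (e0 y) 0).
  have E t : T t -> (- mink (var0 t y) (en y)) *: e0 y = var0 t y.
    move=> Tt; have [c ->] := HN y t Ny Tt.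
    by rewrite minkZl t0n mulrN1 opprK.
  have := vderiv_unique (dv0 Jy) (vderiv_ext oT T0 E D).
  by rewrite mink0r addr0 scaler0 addr0.
have slam : smooth1 J lam.
  by apply: (smooth1N oJ); apply: (smooth1_mink oJ); [exact: sv0|exact: (can_smoothn can)].
have slamN := smooth1_subset NJ slam.
have sm (h : R -> R) : smooth1 N h -> smooth1 N (fun y => derive1 h y / s y).
  move=> sh; apply: (smooth1M oN); first exact: smooth1_derive1.
  by apply: (smooth1V oN) => [y /NJ /sp /gt_eqF ->//|]; exact: smooth1_subset ss.
pose lam1 y := derive1 lam y / s y.
have v1E y : N y -> vf1 y = lam1 y *: e0 y + lam y *: e1 y.
  move=> Ny; have Jy := NJ _ Ny.
  rewrite /vf1 (dds_vec_ext oN Ny (fun z _ => erefl (s z)) v0E).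
  apply: (dds_vec_vderiv (sn Jy)).
  have := vderivZ (smooth1_is_derive1 slam Jy) (can_D0 can Jy).
  suff -> : s y *: (lam1 y *: e0 y + lam y *: e1 y) = derive1 lam y *: e0 y + lam y *: (s y *: e1 y) by [].
  by apply/matrixP => i j; rewrite !mxE /lam1; field; exact: sn.
have [lam2 v2E] : exists l, vf2 x = l *: e0 x + (2 * lam1 x) *: e1 x + lam x *: (mu x *: e0 x + en x).
  exists (derive1 lam1 x / s x).
  rewrite /vf2 (dds_vec_ext oN Nx (fun z _ => erefl (s z)) v1E).
  apply: (dds_vec_vderiv (sn Jx)).
  have := vderivD (vderivZ (smooth1_is_derive1 (sm _ slamN) Nx) (can_D0 can Jx))
     (vderivZ (smooth1_is_derive1 slam Jx) (can_D1 can Jx)).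
  set a := _ + _; set b := s x *: _; suff -> : b = a by [].
  by rewrite /a /b; apply/matrixP => i j; rewrite !mxE /lam1; field; exact: sn.
have [t00 t01 t11 t0n tnn] := can_table can Jx; have t1n := can_table1n can Jx.
have [t02 t12 tn2 t22] := can_table2 can Jx.
(* The remaining products vanish: differentiating <e0,e2> = 0 and <e1,e2> = 0 makes X orthogonal to
   e0 and e1, and differentiating <e0,X> = 0 makes X' orthogonal to e0. *)
have X0 y : J y -> mink (e0 y) (X y) = 0.
  move=> Jy; have [a00 _ _ _ _] := can_table can Jy; have [_ a12 _ _] := can_table2 can Jy.
  have := vderiv_mink_cst (c := 0) oJ Jy
    (fun z Jz => let: And4 h _ _ _ := can_table2 can Jz in h) (sn Jy) (can_D0 can Jy) (can_D2 can Jy).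
  by rewrite minkDr a00 a12 !add0r.
have X1 : mink (e1 x) (X x) = 0.
  have := vderiv_mink_cst (c := 0) oJ Jx
    (fun z Jz => let: And4 _ h _ _ := can_table2 can Jz in h) (sn Jx) (can_D1 can Jx) (can_D2 can Jx).
  by rewrite !minkE t02 tn2 (minkC (e1 x)) t01 => H; lra.
have Xs0 : mink (e0 x) (dds_vec s X x) = 0.
  by have := vderiv_mink_cst (c := 0) oJ Jx X0 (sn Jx) (can_D0 can Jx) (vderiv_dds_vec sp sX Jx); rewrite X1 add0r.
have X0x := X0 x Jx.
rewrite /bdry v2E (v1E x Nx) (v0E x Nx); move: Xs0; generalize (dds_vec s X x) => Xs Xs0; rewrite !minkE.
rewrite (minkC (e2 x) (e0 x)) (minkC (e2 x) (e1 x)) (minkC (e2 x) (en x)) (minkC (X x) (e0 x)).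
rewrite (minkC (X x) (e1 x)) (minkC (e1 x) (e0 x)) (minkC Xs (e0 x)).
rewrite t00 t01 t02 t12 tn2 X0x X1 Xs0.
by abstract_mink; ring.
Qed.

End FirstVariation.

(** * Differentiation under the integral and the integrated first variation *)

Section IntegralDerivative.
Variable R : realType.
Local Notation leb := (@lebesgue_measure R).

Lemma continuous_segment_within (f : R -> R) (a b : R) :
  (forall x, a <= x <= b -> {for x, continuous f}) -> {within `[a, b], continuous f}.
Proof.
move=> cf; apply: continuous_in_subspaceT => x; rewrite inE /= in_itv /=.
exact: cf.
Qed.

Lemma continuous_segment_integrable (f : R -> R) (a b : R) :
  (forall x, a <= x <= b -> {for x, continuous f}) ->
  leb.-integrable `[a, b] (EFin \o f).
Proof.
move=> cf; apply: continuous_compact_integrable; first exact: segment_compact.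
exact: continuous_segment_within cf.
Qed.

Lemma Rintegral_derive1 (f : R -> R) (a b : R) (J : set R) : a <= b ->
  [set` `[a, b]] `<=` J -> smooth1 J f ->
  Rintegral leb [set` `[a, b]] (derive1 f) = f b - f a.
Proof.
move=> ab abJ sf; have Jab x : a <= x <= b -> J x.
  by move=> xab; apply: abJ; rewrite /= in_itv.
move: ab; rewrite le_eqVlt => /predU1P[ab|ab].
  by rewrite ab set_itv1 Rintegral_set1 subrr.
have cf x : a <= x <= b -> {for x, continuous f} by move=> /Jab; exact: smooth1_continuous.
rewrite /Rintegral (@continuous_FTC2 _ _ f) //.
- apply: continuous_segment_within => x /Jab Jx.
  exact: smooth1_continuous (smooth1_derive1 sf) Jx.
- split.
  + move=> x; rewrite in_itv /= => /andP[ax xb].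
    by apply: (sf 0%N x); apply: Jab; rewrite !ltW.
  + by apply: cvg_at_right_filter; apply: cf; rewrite lexx ltW.
  + by apply: cvg_at_left_filter; apply: cf; rewrite lexx ltW.
Qed.

Lemma continuous_pair_snd (g : R -> R -> R) (t x : R) :
  {for (t, x), continuous (fun p : R * R => g p.1 p.2)} -> {for x, continuous (g t)}.
Proof.
move=> cg; apply: (@continuous_comp _ _ _ (fun y => (t, y)) (fun p => g p.1 p.2) x _ cg).
by apply: (@cvg_pair _ _ _ _ (nbhs t) (nbhs x)); [exact: cvg_cst|exact: cvg_id].
Qed.

(** The dominating function is |fdot 0 x| + 1: joint continuity of fdot along t = 0 and compactness
    of the segment make the bound uniform in x for small t. *)
Lemma is_derive_Rintegral (f fdot : R -> R -> R) (a b d : R) : a <= b -> 0 < d ->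
  (forall t x, - d < t < d -> a <= x <= b -> is_derive t (1 : R) (fun t => f t x) (fdot t x)) ->
  (forall t x, - d < t < d -> a <= x <= b -> {for x, continuous (f t)}) ->
  (forall x, a <= x <= b -> {for (0, x), continuous (fun p : R * R => fdot p.1 p.2)}) ->
  is_derive (0 : R) (1 : R) (fun t => Rintegral leb [set` `[a, b]] (f t))
    (Rintegral leb [set` `[a, b]] (fdot 0)).
Proof.
move=> ab d0 df cf cfd.
have c0 x : a <= x <= b -> {for x, continuous (fdot 0)}.
  by move=> xab; exact: continuous_pair_snd (cfd x xab).
have N : \forall t \near (0 : R), [set` `[a, b]] `<=` [set x | `|fdot t x| <= `|fdot 0 x| + 1].
  have /compact_near_coveringP cpt := @segment_compact R a b.
  apply: (cpt R (nbhs (0 : R)) (fun t x => `|fdot t x| <= `|fdot 0 x| + 1)).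
  move=> x; rewrite /= in_itv /= => xab.
  have h : (0 : R) < 1 / 2 by rewrite divr_gt0.
  have /cvgrPdist_lt /(_ _ h) [[A B] /= [A0 Bx] AB] := cfd x xab.
  have /cvgrPdist_lt /(_ _ h) Cx := c0 x xab.
  exists (B `&` (fun y => `|fdot 0 x - fdot 0 y| < 1 / 2), A) => /=.
    by split; [apply: filterI; [exact: Bx|exact: Cx]|exact: A0].
  move=> [y t] /= [[By Cy] At]; have {}AB := AB (t, y) (conj At By); rewrite /= in AB.
  rewrite -lerBlDl; apply: (le_trans (lerB_dist _ _)).
  rewrite distrC; apply: (@dist_half _ _ _ _ (fdot 0 x)); rewrite distrC; last exact: AB.
  exact: Cy.
have [r /= r0 Hr] := (iffLR (nbhs_ballP (0 : R) _)) N.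
pose u := Num.min r d.
have u0 : 0 < u by rewrite lt_min r0.
have ut t : - u < t < u -> - d < t < d /\ (forall x, a <= x <= b -> `|fdot t x| <= `|fdot 0 x| + 1).
  move=> /andP[t1 t2]; have ud : u <= d by rewrite ge_min lexx orbT.
  have ur : u <= r by rewrite ge_min lexx.
  split; first by apply/andP; split; lra.
  move=> x xab; apply: (Hr t); last by rewrite /= in_itv.
  by rewrite /ball /= sub0r normrN ltr_norml; apply/andP; split; lra.
have mB : measurable ([set` `[a, b]] : set (measurableTypeR R)) by exact: measurable_itv.
have I0 : [set` `]- u, u[] (0 : R) by rewrite /= in_itv /= oppr_lt0 u0.
have If t : [set` `]- u, u[] t -> leb.-integrable `[a, b] (EFin \o f t).
  rewrite /= in_itv /= => /ut [td _]; apply: continuous_segment_integrable => x xab.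
  exact: cf.
have Df (t x : R) : [set` `]- u, u[] t -> [set` `[a, b]] x -> derivable (fun t => f t x) t 1.
  rewrite /= !in_itv /= => /ut [td _] xab; exact: is_derive1_derivable (df t x td xab).
have G0 x : 0 <= `|fdot 0 x| + 1 by rewrite addr_ge0.
have IG : leb.-integrable `[a, b] (EFin \o (fun x => `|fdot 0 x| + 1)).
  apply: continuous_segment_integrable => x xab.
  by apply: continuousD; [exact: (cvg_norm (c0 x xab))|exact: cst_continuous].
have GB (t x : R) : [set` `]- u, u[] t -> [set` `[a, b]] x -> `|partial1of2 f t x| <= `|fdot 0 x| + 1.
  rewrite /= !in_itv /= => /ut [td Ht] xab.
  by rewrite /partial1of2 (is_derive1_derive1 (df t x td xab)); exact: Ht.
have D := @derivable_under_integral R _ (measurableTypeR R) leb f _ mB 0 (- u) u I0 If Df _ G0 IG GB.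
have E := @differentiation_under_integral R _ (measurableTypeR R) leb f _ mB 0 (- u) u I0 If Df _ G0 IG GB.
have -> : Rintegral leb [set` `[a, b]] (fdot 0) =
    derive1 (fun t => Rintegral leb [set` `[a, b]] (f t)) 0.
  rewrite E; apply: eq_Rintegral => x; rewrite inE /= in_itv /= => xab.
  have dd : - d < 0 < d by rewrite oppr_lt0 d0.
  by rewrite /partial1of2 (is_derive1_derive1 (df 0 x dd xab)).
exact: derivable_is_derive1 D.
Qed.

End IntegralDerivative.

Section FirstVariationIntegral.
Variables (R : realType) (n : nat).
Hypothesis n3 : (3 <= n)%N.
Local Notation V := 'cV[R]_(n.+2).
Local Notation leb := (@lebesgue_measure R).
Variables (I J : set R) (s mu r : R -> R) (e0 e1 en e2 X : R -> V) (W : R -> R -> V).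
Variables (eps a b : R) (K : set R).
Local Notation T := [set` `]- eps, eps[].
Hypotheses (eps0 : 0 < eps) (oI : open I) (JI : J `<=` I).
Hypothesis sW : forall i j, smooth2 (T `*` I) (fun t x => W t x i j).
Hypothesis liW : forall t, T t -> lift_immersion I (W t).
Hypothesis can : canonical J s mu e0 e1 en e2 X.
Hypotheses (sr : smooth1 J r) (r0 : forall x, J x -> r x != 0).
Hypothesis e0W : forall x, J x -> e0 x = r x *: W 0 x.
Hypotheses (ab : a <= b) (abJ : [set` `[a, b]] `<=` J).
Hypotheses (cK : closed K) (Ka : ~ K a) (Kb : ~ K b).
Hypothesis WK : forall t x, T t -> I x -> ~ K x -> exists c, W t x = c *: W 0 x.

Let oT : open T. Proof. exact: interval_open. Qed.
Let T0 : T 0. Proof. by rewrite /= in_itv /= oppr_lt0 eps0. Qed.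
Let oJ := can_open can.
Let abJ' x : a <= x <= b -> J x. Proof. by move=> xab; apply: abJ; rewrite /= in_itv. Qed.

(** As K is closed, the curve is left unchanged on a whole neighbourhood of x, and this also
    controls the derivatives of the variation field that occur in [bdry]. *)
Lemma bdry_end x : J x -> ~ K x -> bdry s mu r e0 e1 e2 X W x = 0.
Proof.
move=> Jx nKx; apply: (bdry_eq0 oT T0 oI JI sW can sr Jx).
exists (J `&` ~` K); split.
- by apply: openI; [exact: oJ|exact: closed_openC].
- by split.
- by move=> y [].
- move=> y t [Jy nKy] Tt; have [c Hc] := WK Tt (JI Jy) nKy.
  by exists c; rewrite /var0 Hc e0W // !scalerA mulrC.
Qed.

Lemma continuous_var_dot t x : T t -> J x -> 0 < var_gram s r W t x ->
  {for (t, x), continuous (fun p : R * R => var_dot s r W p.1 p.2)}.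
Proof.
move=> Tt Jx g0.
have sg := smooth2_var_gram oT oI JI sW can sr.
have sc := smooth2_var_speed oT oI JI sW can sr.
have [cg _ _] := smooth2_base oT oJ sg Tt Jx.
have [cc _ _] := smooth2_base oT oJ sc Tt Jx.
have [cdg _ _] := smooth2_base oT oJ (@smooth2_pdiff _ _ _ true _ sg) Tt Jx.
have [cdc _ _] := smooth2_base oT oJ (@smooth2_pdiff _ _ _ true _ sc) Tt Jx.
have c0 : var_speed s r W t x != 0 by rewrite gt_eqF // (var_speed_gt0 oT oI JI sW liW can sr r0).
have cs : {for (t, x), continuous (fun p : R * R => s p.2)}.
  apply: (@continuous_comp _ _ _ snd s (t, x)); first exact: cvg_snd.
  exact: smooth1_continuous (can_smooth_s can) Jx.
have csqrt (h : R * R -> R) : {for (t, x), continuous h} -> {for (t, x), continuous (fun p => Num.sqrt (h p))}.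
  by move=> ch; apply: (@continuous_comp _ _ _ h (@Num.sqrt R) (t, x)) => //; exact: sqrt_continuous.
have cst2 : {for (t, x), continuous (fun _ : R * R => 2 : R)} by exact: cst_continuous.
have cM (f g : R * R -> R) : {for (t, x), continuous f} -> {for (t, x), continuous g} ->
  {for (t, x), continuous (fun p => f p * g p)} by exact: continuousM.
have cD (f g : R * R -> R) : {for (t, x), continuous f} -> {for (t, x), continuous g} ->
  {for (t, x), continuous (fun p => f p + g p)} by exact: continuousD.
have cN (f : R * R -> R) : {for (t, x), continuous f} -> {for (t, x), continuous (fun p => - f p)}.
  exact: continuousN.
have cV (f : R * R -> R) : f (t, x) != 0 -> {for (t, x), continuous f} ->
  {for (t, x), continuous (fun p => (f p)^-1)} by exact: continuousV.
have cq := csqrt _ cg; have cqq := csqrt _ cq.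
have q0 : 0 < Num.sqrt (var_gram s r W t x) by rewrite sqrtr_gt0.
have qq0 : 0 < Num.sqrt (Num.sqrt (var_gram s r W t x)) by rewrite sqrtr_gt0.
have v1 := cV _ _ (cM _ _ cst2 cq).
have v2 := cV _ _ (cM _ _ cst2 cqq).
have v3 := cV _ c0 cc.
have v4 := cV _ _ (cM _ _ cc cc).
have n1 : 2 * Num.sqrt (var_gram s r W t x) != 0 by rewrite mulf_neq0 ?pnatr_eq0 // gt_eqF.
have n2 : 2 * Num.sqrt (Num.sqrt (var_gram s r W t x)) != 0 by rewrite mulf_neq0 ?pnatr_eq0 // gt_eqF.
have n4 : var_speed s r W t x * var_speed s r W t x != 0 by rewrite mulf_neq0.
exact: (cM _ _ cs (cD _ _ (cM _ _ (cM _ _ (cM _ _ cdg (v1 n1)) (v2 n2)) v3)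
  (cM _ _ cqq (cM _ _ (cN _ cdc) (v4 n4))))).
Qed.

(** The determinant is 1 at t = 0, so by compactness it is positive over the segment for all small
    t; on that range the density is differentiable in t. The total derivative integrates to the
    difference of [bdry] at the end points, both outside K. *)
Lemma first_variation_integral :
  is_derive (0 : R) (1 : R) (fun t => Rintegral leb [set` `[a, b]] (cds I (W t)))
    (Rintegral leb [set` `[a, b]] (fun x => s x / 2 * mink (EL s mu e2 X x) (vf0 r W x))).
Proof.
have g1 x : J x -> var_gram s r W 0 x = 1.
  by move=> Jx; case: (var_base_products oT T0 oI JI sW can sr e0W Jx).
have sg := smooth2_var_gram oT oI JI sW can sr.
have N : \forall t \near (0 : R), [set` `[a, b]] `<=` [set x | 0 < var_gram s r W t x].
  have /compact_near_coveringP cpt := @segment_compact R a b.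
  apply: (cpt R (nbhs (0 : R)) (fun t x => 0 < var_gram s r W t x)).
  move=> x; rewrite /= in_itv /= => /abJ' Jx.
  have [cg _ _] := smooth2_base oT oJ sg T0 Jx.
  have P : nbhs (var_gram s r W 0 x) [set y : R | 0 < y].
    by apply: open_nbhs_nbhs; split; [exact: open_gt|rewrite /= g1].
  have [[A B] /= [A0 Bx] AB] := cg _ P.
  exists (B, A) => /=; first by split; [exact: Bx|exact: A0].
  by move=> [y t] /= [By At]; exact: (AB (t, y) (conj At By)).
have [d' /= d'0 Hd] := (iffLR (nbhs_ballP (0 : R) _)) N.
pose d := Num.min d' eps.
have d0 : 0 < d by rewrite lt_min d'0.
have Hg t x : - d < t < d -> a <= x <= b -> T t /\ 0 < var_gram s r W t x.
  move=> /andP[t1 t2] xab; have dd : d <= d' by rewrite ge_min lexx.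
  have de : d <= eps by rewrite ge_min lexx orbT.
  split; first by rewrite /= in_itv /=; apply/andP; split; lra.
  apply: (Hd t); last by rewrite /= in_itv.
  by rewrite /ball /= sub0r normrN ltr_norml; apply/andP; split; lra.
have sEL := smooth_EL can.
have sv0 : smoothmx J (vf0 r W).
  have sf0 : smooth_family T J (var0 r W).
    move=> i; have sWJ := smooth2_subset oT oT oI oJ (@subset_refl _ T) JI (sW i 0).
    apply: (smooth2_ext oT oJ _ (smooth2M oT oJ (smooth2_snd oT oJ sr) sWJ)) => t x _ _.
    by rewrite mxE.
  exact: (smooth_family_slice (smooth_family_dt oT oJ sf0) T0).
have sB : smooth1 J (bdry s mu r e0 e1 e2 X W) := smooth_bdry oT T0 oI JI sW can sr.
have sh : smooth1 J (fun x => s x / 2 * mink (EL s mu e2 X x) (vf0 r W x)).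
  apply: (smooth1M oJ); last exact: smooth1_mink.
  by apply: (smooth1M oJ); [exact: can_smooth_s can|exact: smooth1_cst].
have -> : Rintegral leb [set` `[a, b]] (fun x => s x / 2 * mink (EL s mu e2 X x) (vf0 r W x)) =
    Rintegral leb [set` `[a, b]] (var_dot s r W 0).
  have -> : Rintegral leb [set` `[a, b]] (var_dot s r W 0) =
      Rintegral leb [set` `[a, b]] (fun x => derive1 (bdry s mu r e0 e1 e2 X W) x +
         s x / 2 * mink (EL s mu e2 X x) (vf0 r W x)).
    apply: eq_Rintegral => x; rewrite inE /= in_itv /= => /abJ' Jx.
    exact: (first_variation oT T0 oI JI sW liW can sr e0W Jx).
  rewrite RintegralD.
  - rewrite (Rintegral_derive1 ab abJ sB) !bdry_end ?subrr ?add0r //.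
    + by apply: abJ'; rewrite lexx.
    + by apply: abJ'; rewrite lexx andbT.
  - exact: measurable_itv.
  - apply: continuous_segment_integrable => x /abJ' Jx.
    exact: smooth1_continuous (smooth1_derive1 sB) Jx.
  - by apply: continuous_segment_integrable => x /abJ' Jx; exact: smooth1_continuous sh Jx.
have cden t x : T t -> J x -> cds I (W t) x = var_den s r W t x.
  by move=> Tt Jx; exact: (cds_var_den n3 oT oI JI sW liW can sr r0 Tt Jx).
have dden t x : - d < t < d -> a <= x <= b ->
    is_derive t (1 : R) (fun t => cds I (W t) x) (var_dot s r W t x).
  move=> td xab; have [Tt g0] := Hg t x td xab; have Jx := abJ' xab.
  apply: (is_derive1_ext oT Tt _ (is_derive_var_den oT oI JI sW liW can sr r0 Tt Jx g0)) => t' Tt'.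
  by rewrite cden.
apply: (is_derive_Rintegral ab d0 dden) => [t x td xab|x xab].
  have [Tt g0] := Hg t x td xab; have Jx := abJ' xab.
  have [cg _ _] := smooth2_base oT oJ sg Tt Jx.
  have [cc _ _] := smooth2_base oT oJ (smooth2_var_speed oT oI JI sW can sr) Tt Jx.
  have c0 : var_speed s r W t x != 0 by rewrite gt_eqF // (var_speed_gt0 oT oI JI sW liW can sr r0).
  have cs := smooth1_continuous (can_smooth_s can) Jx.
  have csqrt (h : R -> R) : {for x, continuous h} -> {for x, continuous (fun p => Num.sqrt (h p))}.
    by move=> ch; apply: (@continuous_comp _ _ _ h (@Num.sqrt R) x) => //; exact: sqrt_continuous.
  have C : {for x, continuous (var_den s r W t)}.
    apply: (@continuousM _ _ s (fun y => arcden _ _ _ _) x cs).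
    apply: (@continuousM _ _ (fun y => Num.sqrt (Num.sqrt (var_gram s r W t y))) (fun y => (var_speed s r W t y)^-1)).
      by apply: (csqrt); apply: (csqrt); exact: continuous_pair_snd cg.
    by apply: continuousV => //; exact: continuous_pair_snd cc.
  have E : \forall y \near x, var_den s r W t y = cds I (W t) y.
    by apply: (near_open oJ Jx) => y Jy; rewrite cden.
  rewrite /prop_for /continuous_at cden //; apply: cvg_trans C.
  by apply: near_eq_cvg; apply: filterS E => y ->.
have Jx := abJ' xab; apply: (continuous_var_dot T0 Jx).
by rewrite g1.
Qed.

End FirstVariationIntegral.

(** * Test variations *)

Section Bump.
Variable R : realType.
Local Notation leb := (@lebesgue_measure R).

(** The functions x^(-k) exp(-1/x), extended by 0, form a family whose derivatives are linear
    combinations of its members. Smoothness of the classical case k = 0 then follows by induction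
    over all k at once. *)
Definition flat (k : nat) (x : R) : R := if 0 < x then x ^- k * expR (- x^-1) else 0.

Lemma flat_ge0 k x : 0 <= flat k x.
Proof.
rewrite /flat; case: ifP => // x0; rewrite mulr_ge0 ?expR_ge0 // invr_ge0 exprn_ge0 //.
exact: ltW.
Qed.

Lemma flat_mul k x : flat k x = flat k.+1 x * x.
Proof.
rewrite /flat; case: ifP => x0; last by rewrite mul0r.
have xn : x != 0 by rewrite gt_eqF.
have xk : x ^+ k != 0 by rewrite expf_neq0.
by move: (expR _) => E; rewrite exprS; field; rewrite ?xn ?xk.
Qed.

(** This is exp(y) >= y^(k+1) / (k+1)! at y = 1/x; it gives continuity at 0. *)
Lemma flat_bound k x : flat k x <= (k.+1)`!%:R * `|x|.
Proof.
rewrite /flat; case: ifP => x0; last by rewrite mulr_ge0.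
rewrite gtr0_norm // expRN; have y0 : 0 < x^-1 by rewrite invr_gt0.
have := expR_ge1Dxn k (ltW y0) => B.
have B' : x^-1 ^+ k.+1 / (k.+1)`!%:R <= expR x^-1 by apply: le_trans B; rewrite lerDr.
have e0 := expR_gt0 x^-1; have f0 : 0 < (k.+1)`!%:R :> R by rewrite ltr0n fact_gt0.
rewrite ler_pdivrMr // -exprVn.
move: B'; rewrite ler_pdivrMr // exprS => B'.
have -> : x^-1 ^+ k = x * (x^-1 * x^-1 ^+ k) by rewrite mulrA divff ?mul1r // gt_eqF.
rewrite -mulrA [(k.+1)`!%:R * _]mulrC -mulrA ler_pM2l //.
Qed.

Lemma flat_continuous0 k : {for 0, continuous (flat k)}.
Proof.
rewrite /prop_for /continuous_at {2}/flat ltxx.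
apply/cvgrPdist_le => e e0; have c0 : 0 < (k.+1)`!%:R :> R by rewrite ltr0n fact_gt0.
have : \forall y \near (0 : R), `|0 - y| <= e / (k.+1)`!%:R.
  by apply/nbhs_ballP; exists (e / (k.+1)`!%:R) => [|y /ltW]; [exact: divr_gt0|].
apply: filterS => y; rewrite !sub0r !normrN => ye.
rewrite ger0_norm ?flat_ge0 //; apply: (le_trans (flat_bound k y)).
by rewrite mulrC -ler_pdivlMr.
Qed.

Lemma is_derive1_flat k x : is_derive x (1 : R) (flat k) (- k%:R * flat k.+1 x + flat k.+2 x).
Proof.
have [x0|x0|<-] := ltgtP 0 x.
- have xn : x != 0 by rewrite gt_eqF.
  have dV := is_derive1V xn (is_derive1_id x).
  have dE := is_derive1_comp (f := expR) (g := fun y => - y^-1) (is_derive_expR (- x^-1)) (is_derive1N dV).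
  have xk : x ^+ k != 0 by rewrite expf_neq0.
  have dX : is_derive x (1 : R) (fun y => y ^+ k) (k%:R * x ^+ k.-1).
    apply: DeriveDef; first exact: exprn_derivable.
    by rewrite exp_derive /GRing.scale /= mulr1.
  have D := is_derive1M (is_derive1V (f := fun y => y ^+ k) xk dX) dE.
  have oU := @open_gt R 0.
  apply: (is_derive1_ext (oU) x0 (f := fun y => (y ^+ k)^-1 * expR (- y^-1))).
    by move=> y y0; rewrite /flat (y0 : 0 < y).
  apply: (is_derive_eq D); rewrite /flat x0 /= .
  move: (expR (- x^-1)) => E; case: k {dX D xk} => [|k]; rewrite /= ?exprS ?expr0.
    by field; rewrite ?xn.
  have xk : x ^+ k != 0 by rewrite expf_neq0.
  by field; rewrite ?xn ?xk.
- have oU := @open_lt R 0.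
  have F j : flat j x = 0 by rewrite /flat ltNge (ltW x0).
  rewrite !F mulr0 addr0.
  apply: (is_derive1_ext oU x0 _ (is_derive1_cst 0 x)).
  by move=> y y0; rewrite /flat ltNge (ltW (y0 : y < 0)).
- have F j : flat j 0 = 0 by rewrite /flat ltxx.
  (* At 0 the difference quotient is again a member of the family, since flat_k(x) = x
     flat_{k+1}(x), and it is continuous there with value 0. *)
  rewrite !F mulr0 addr0; apply/is_derive1_caratheodory; exists (flat k.+1); split.
  + by move=> z; rewrite F !subr0; exact: flat_mul.
  + exact: flat_continuous0.
  + exact: F.
Qed.

Lemma smooth1_flat_affine (c d : R) : smooth1 setT (fun x => flat 0 (c * x + d)).
Proof.
have oT := @openT R.
have D k x : is_derive x (1 : R) (fun x => flat k (c * x + d))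
   ((- k%:R * flat k.+1 (c * x + d) + flat k.+2 (c * x + d)) * c).
  have da : is_derive x (1 : R) (fun x => c * x + d) (0 * x + c * 1 + 0).
    exact: is_derive1D (is_derive1M (is_derive1_cst c x) (is_derive1_id x)) (is_derive1_cst d x).
  apply: (is_derive_eq (is_derive1_comp (f := flat k) (g := fun x => c * x + d)
    (is_derive1_flat k (c * x + d)) da)).
  by rewrite mul0r add0r addr0 mulr1.
apply/smooth1_diffk => j.
suff H k : diffk j setT (fun x => flat k (c * x + d)) by exact: (H 0%N).
elim: j k => [|j IH] k.
  by split; [move=> x _; exact: is_derive1_derivable (D k x)|exact: I].
split; first by move=> x _; exact: is_derive1_derivable (D k x).
apply: (diffk_ext oT (f := fun x => (- k%:R * flat k.+1 (c * x + d) + flat k.+2 (c * x + d)) * c)).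
  by move=> x _; rewrite (is_derive1_derive1 (D k x)).
apply: (diffkM oT); last exact: diffk_cst.
apply: (diffkD oT); last exact: IH.
by apply: (diffkM oT); [exact: diffk_cst|exact: IH].
Qed.

Lemma bump_exists (a b : R) : exists f : R -> R,
  [/\ smooth1 setT f, forall x, 0 <= f x, forall x, a < x < b -> 0 < f x &
      forall x, ~ (a < x < b) -> f x = 0].
Proof.
exists (fun x => flat 0 (1 * x + - a) * flat 0 (-1 * x + b)); split.
- by apply: (smooth1M (@openT R)); exact: smooth1_flat_affine.
- by move=> x; rewrite mulr_ge0 ?flat_ge0.
- move=> x /andP[ax xb]; rewrite mul1r mulN1r /flat subr_gt0 ax [- x + b]addrC subr_gt0 xb.
  by rewrite !mulr_gt0 ?expR_gt0 // expr0 invr1 ltr01.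
- move=> x; rewrite mul1r mulN1r /flat subr_gt0 [- x + b]addrC subr_gt0.
  by case: (a < x) => //; rewrite ?mul0r //; case: (x < b) => //; rewrite mulr0.
Qed.

(** By continuity g >= g x0 / 2 on an interval ]p, q] around x0, which contributes a positive
    amount; the two remaining pieces contribute nothing negative. *)
Lemma Rintegral_gt0 (g : R -> R) (a b x0 : R) : a < x0 < b ->
  (forall x, a <= x <= b -> {for x, continuous g}) ->
  (forall x, a <= x <= b -> 0 <= g x) -> 0 < g x0 ->
  0 < Rintegral leb [set` `[a, b]] g.
Proof.
move=> /andP[ax xb] cg g0 gx0.
have cx : {for x0, continuous g} by apply: cg; rewrite !ltW.
have e0 : 0 < g x0 / 2 by rewrite divr_gt0.
have /cvgrPdist_lt /(_ _ e0) N := cx.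
have [r /= r0 Hr] := (iffLR (nbhs_ballP x0 _)) N.
pose p := Num.max a (x0 - r / 2); pose q := Num.min b (x0 + r / 2).
have ap : a <= p by rewrite le_max lexx.
have qb : q <= b by rewrite ge_min lexx.
have px : p < x0 by rewrite gt_max ax /=; lra.
have xq : x0 < q by rewrite lt_min xb /=; lra.
have pq : p < q by exact: lt_trans xq.
have gl x : p <= x <= q -> g x0 / 2 <= g x.
  move=> /andP[h1 h2]; have : ball x0 r x.
    move: h1 h2; rewrite ge_max le_min => /andP[_ h1] /andP[_ h2].
    by rewrite /ball /= ltr_norml; apply/andP; split; lra.
  by move=> /Hr; rewrite ltr_norml => /andP[_ h]; lra.
have Iab := continuous_segment_integrable cg.
have mI (i : interval R) : measurable ([set` i] : set (measurableTypeR R)) by exact: measurable_itv.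
have IS (i : interval R) : [set` i] `<=` [set` `[a, b]] -> leb.-integrable [set` i] (EFin \o g).
  by move=> iab; apply: (integrableS (mI _) (mI _) iab).
have E1 := @Rintegral_itvB R g (BLeft a) (BRight b) p Iab
  ltac:(by rewrite bnd_simp) ltac:(by rewrite bnd_simp; exact: ltW (lt_le_trans pq qb)).
have pb : [set` `]p, b]] `<=` [set` `[a, b]].
  by move=> x; rewrite /= !in_itv /= => /andP[h1 h2]; rewrite h2 andbT (le_trans ap) // ltW.
have E2 := @Rintegral_itvB R g (BRight p) (BRight b) q (IS _ pb)
  ltac:(by rewrite bnd_simp ltW) ltac:(by rewrite bnd_simp).
have P1 : 0 <= Rintegral leb [set` `[a, p]] g.
  apply: Rintegral_ge0 => x; rewrite /= in_itv /= => /andP[h1 h2]; apply: g0.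
  by rewrite h1 (le_trans h2) // ltW // (lt_le_trans pq).
have P2 : 0 <= Rintegral leb [set` `]q, b]] g.
  apply: Rintegral_ge0 => x; rewrite /= in_itv /= => /andP[h1 h2]; apply: g0.
  by rewrite h2 andbT (le_trans ap) // ltW // (lt_trans pq).
have sub : [set` `]p, q]] `<=` [set` `[a, b]].
  move=> x; rewrite /= !in_itv /= => /andP[h1 h2]; rewrite (le_trans h2 qb) andbT.
  by rewrite (le_trans ap) // ltW.
have P3 : (q - p) * (g x0 / 2) <= Rintegral leb [set` `]p, q]] g.
  have -> : (q - p) * (g x0 / 2) = Rintegral leb [set` `]p, q]] (fun=> g x0 / 2).
    rewrite Rintegral_cst; last exact: mI.
    have M := @lebesgue_measure_itv R (Interval (BRight p) (BRight q)).
    rewrite /= lte_fin pq -EFinB in M.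
    by rewrite mulrC; congr (_ * _); exact: (esym (congr1 fine M)).
  apply: le_Rintegral; [exact: mI| |exact: IS|].
    apply: (integrableS (mI _) (mI _) sub).
    by apply: continuous_segment_integrable => x _; exact: cst_continuous.
  by move=> x; rewrite /= in_itv /= => /andP[h1 h2]; apply: gl; rewrite h2 ltW.
have P4 : 0 < (q - p) * (g x0 / 2) by rewrite mulr_gt0 // subr_gt0.
have {}E1 : Rintegral leb [set` `[a, b]] g =
    Rintegral leb [set` `]p, b]] g + Rintegral leb [set` `[a, p]] g.
  by apply/eqP; rewrite -subr_eq; apply/eqP; exact: E1.
have {}E2 : Rintegral leb [set` `]p, b]] g =
    Rintegral leb [set` `]q, b]] g + Rintegral leb [set` `]p, q]] g.
  by apply/eqP; rewrite -subr_eq; apply/eqP; exact: E2.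
rewrite E1 E2 ltr_wpDr // ltr_wpDl //.
exact: lt_le_trans P4 P3.
Qed.

End Bump.

(** * Variations by null rotations *)

Section NullRotation.
Variables (R : realType) (n : nat).
Local Notation V := 'cV[R]_(n.+2).

(** The bivector p wedge z as a skew endomorphism N. For p null and z a unit vector orthogonal to p,
    N^2 v = - <p,v> p and N^3 = 0, so its exponential is quadratic in the parameter. *)
Definition null_generator (p z v : V) : V := mink p v *: z - mink z v *: p.

(* exp of [tau] times the skew endomorphism [null_generator p z], for [p] null and [z] a unit
   vector orthogonal to [p] *)
Definition null_rotation (p z : V) (tau : R) (v : V) : V :=
  v + tau *: null_generator p z v - (tau * tau * (1 / 2 * mink p v)) *: p.

Variables (p z : V).
Hypotheses (pp : mink p p = 0) (zz : mink z z = 1) (pz : mink p z = 0).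

Lemma null_rotation_null tau v : mink v v = 0 ->
  mink (null_rotation p z tau v) (null_rotation p z tau v) = 0.
Proof.
move=> vv; rewrite /null_rotation /null_generator !minkE (minkC z p) (minkC v p) (minkC v z) pp zz pz vv.
by abstract_mink; field.
Qed.

Lemma null_rotation_eq0 tau v : null_rotation p z tau v = 0 -> v = 0.
Proof.
move=> N0; have E w : mink w (null_rotation p z tau v) = 0 by rewrite N0 mink0r.
have pv : mink p v = 0.
  by rewrite -(E p) /null_rotation /null_generator !minkE pp pz; abstract_mink; ring.
have zv : mink z v = 0.
  rewrite -(E z) /null_rotation /null_generator !minkE (minkC z p) pz pv.
  by abstract_mink; ring.
by move: N0; rewrite /null_rotation /null_generator pv zv !scale0r subr0 scaler0 addr0 !mulr0 scale0r subr0.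
Qed.

(** A rotation commutes with its generator N, so the vector is the rotation of w + dtau N v. By
    isometry only the square of the latter counts, and <N v, N v> = <p,v>^2. *)
Lemma null_rotation_speed tau dtau v w :
  mink (null_rotation p z tau w + dtau *: (null_generator p z v - (tau * mink p v) *: p))
       (null_rotation p z tau w + dtau *: (null_generator p z v - (tau * mink p v) *: p)) =
  mink w w + 2 * dtau * (mink p v * mink z w - mink z v * mink p w) + (dtau * mink p v) ^+ 2.
Proof.
rewrite /null_rotation /null_generator !minkE (minkC z p) (minkC w p) (minkC w z) pp zz pz.
by abstract_mink; field.
Qed.

Variables (I : set R) (F : R -> V) (f : R -> R) (a b : R).
Hypotheses (oI : open I) (liF : lift_immersion I F) (sf : smooth1 setT f).
Hypotheses (ab : a <= b) (abI : [set` `[a, b]] `<=` I).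
Hypothesis f0 : forall x, ~ (a < x < b) -> f x = 0.

Definition test_variation t x : V := null_rotation p z (t * f x) (F x).

Let sfI : smooth1 I f. Proof. by apply: (smooth1_subset _ sf). Qed.
Let sF : smoothmx I F. Proof. exact: lift_smooth. Qed.

Let sc (c : V) : smooth1 I (fun x => mink c (F x)).
Proof. exact: (smooth1_mink oI (@smoothmx_cst _ _ oI _ _ c) sF). Qed.

Lemma test_variation_smooth (T : set R) (i : 'I_n.+2) (j : 'I_1) : open T ->
  smooth2 (T `*` I) (fun t x => test_variation t x i j).
Proof.
move=> oT; have tf := smooth2M oT oI (smooth2_fst oT oI) (smooth2_snd oT oI sfI).
have Fi := smooth2_snd oT oI (@sF i j).
have c (k : R) := @smooth2_cst _ _ _ oT oI k.
have m k := smooth2_snd oT oI (@sc k).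
have M := smooth2M oT oI; have B := smooth2B oT oI; have D := smooth2D oT oI.
have gi := B _ _ (M _ _ (m p) (c (z i j))) (M _ _ (m z) (c (p i j))).
have H := B _ _ (D _ _ Fi (M _ _ tf gi))
  (M _ _ (M _ _ (M _ _ tf tf) (M _ _ (c (1 / 2)) (m p))) (c (p i j))).
by apply: (smooth2_ext oT oI _ H) => t x _ _; rewrite !mxE.
Qed.

Lemma test_variation_vderiv t x : I x -> vderiv (test_variation t) x
  (null_rotation p z (t * f x) (dmx F x) + (t * derive1 f x) *:
     (null_generator p z (F x) - (t * f x * mink p (F x)) *: p)).
Proof.
move=> Ix; have dF := lift_vderiv liF Ix.
have df := is_derive1M (is_derive1_cst t x) (smooth1_is_derive1 sfI Ix).
have dm c := vderiv_mink (vderiv_cst c x) dF.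
have H := vderivB (vderivD dF (vderivZ df (vderivB (vderivZ (dm p) (vderiv_cst z x))
   (vderivZ (dm z) (vderiv_cst p x)))))
  (vderivZ (is_derive1M (is_derive1M df df) (is_derive1M (is_derive1_cst (1 / 2 : R) x) (dm p)))
     (vderiv_cst p x)).
move: H; set d := (X in vderiv _ x X) => H.
suff <- : d = null_rotation p z (t * f x) (dmx F x) + (t * derive1 f x) *:
     (null_generator p z (F x) - (t * f x * mink p (F x)) *: p) by exact: H.
rewrite /d /null_rotation /null_generator !mink0l; apply/matrixP => i j; rewrite !mxE.
by abstract_mink; field.
Qed.

Lemma derive1_bump_out x : ~ (a <= x <= b) -> derive1 f x = 0.
Proof.
move=> xab; have oU : open (~` [set` `[a, b]]).
  by apply: closed_openC; exact: interval_closed.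
have Ux : (~` [set` `[a, b]]) x by rewrite /= in_itv.
have E y : (~` [set` `[a, b]]) y -> 0 = f y.
  rewrite /= in_itv /= => yab; rewrite f0 // => /andP[h1 h2]; apply: yab.
  by rewrite !ltW.
exact: (is_derive1_derive1 (is_derive1_ext oU Ux E (is_derive1_cst 0 x))).
Qed.

(** Rotation keeps the lift null and nonzero; only positivity of the speed could fail, and positive
    speed orthogonal to the lift gives linear independence. Off the segment f' = 0 and the speed is
    unchanged, while on it a minimum over a compact set provides eps. *)
Lemma test_variation_immersion : exists2 eps, 0 < eps &
  forall t, - eps < t < eps -> lift_immersion I (test_variation t).
Proof.
pose be x := mink p (F x) * mink z (dmx F x) - mink z (F x) * mink p (dmx F x).
(* If |t| < m x then 2 |t| |f' be| < <F',F'>, which suffices at x because the last term of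
   [null_rotation_speed] is a square. The summand 1 keeps the denominator positive. *)
pose m x := mink (dmx F x) (dmx F x) / (1 + 2 * `|derive1 f x * be x|).
have den0 x : 0 < 1 + 2 * `|derive1 f x * be x| by rewrite ltr_wpDr // mulr_ge0.
have Iab x : a <= x <= b -> I x by move=> xab; apply: abI; rewrite /= in_itv.
have sF' := smoothmx_dmx oI sF.
have sc' c : smooth1 I (fun x => mink c (dmx F x)).
  exact: (smooth1_mink oI (@smoothmx_cst _ _ oI _ _ c) sF').
have sbe : smooth1 I (fun x => derive1 f x * be x).
  apply: (smooth1M oI); first exact: smooth1_derive1.
  exact: (smooth1B oI (smooth1M oI (@sc p) (@sc' z)) (smooth1M oI (@sc z) (@sc' p))).
have cm : {within `[a, b], continuous m}.
  apply: continuous_segment_within => x /Iab Ix.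
  apply: continuousM; first exact: smooth1_continuous (smooth_speed oI liF) Ix.
  apply: continuousV; first by rewrite gt_eqF.
  apply: continuousD; first exact: cst_continuous.
  apply: continuousM; first exact: cst_continuous.
  exact: (cvg_norm (smooth1_continuous sbe Ix)).
have [c cab Hc] := EVT_min ab cm; rewrite in_itv /= in cab.
have speed0 x := lift_speed_gt0 oI liF (x := x).
have mc : 0 < m c by rewrite divr_gt0 // speed0 //; exact: Iab.
exists (m c); first exact: mc.
move=> t tc; have {}tc : `|t| < m c by rewrite ltr_norml.
have oT : open (setT : set R) by exact: openT.
split.
  move=> i j.
  exact: (smooth2_slice (@test_variation_smooth setT i j oT) (Logic.I : setT t)).
move=> x Ix; have FF := lift_null liF Ix; have Fn0 := lift_neq0 liF Ix.
have N0 := null_rotation_null (t * f x) FF.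
have D := test_variation_vderiv t Ix.
have S : 0 < mink (dmx (test_variation t) x) (dmx (test_variation t) x).
  rewrite (vderiv_dmx D) null_rotation_speed -/(be x).
  rewrite ltr_wpDr ?sqr_ge0 //.
  have [xab|xab] := pselect (a <= x <= b); last first.
    by rewrite (derive1_bump_out xab) !mulr0 mul0r addr0; exact: speed0.
  have mx : `|t| < m x by apply: lt_le_trans tc _; apply: Hc; rewrite in_itv.
  move: mx; rewrite /m ltr_pdivlMr // mulrDr mulr1 => mx.
  have -> : 2 * (t * derive1 f x) * be x = t * (2 * (derive1 f x * be x)) by ring.
  have : - (`|t| * (2 * `|derive1 f x * be x|)) <= t * (2 * (derive1 f x * be x)).
    by rewrite lerNl; apply: le_trans (ler_norm _) _; rewrite normrN !normrM [`|2|]ger0_norm.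
  have := normr_ge0 t; lra.
split.
- by apply/eqP => /null_rotation_eq0 /eqP; rewrite (negbTE Fn0).
- exact: N0.
- move=> k l kl.
  have O : mink (test_variation t x) (dmx (test_variation t) x) = 0.
    apply: (vderiv_null (c := 0) oI Ix) => [y Iy|].
      exact: (null_rotation_null _ (lift_null liF Iy)).
    by rewrite (vderiv_dmx D).
  have l0 : l = 0.
    have := congr1 (mink (dmx (test_variation t) x)) kl.
    rewrite mink0r minkDr !minkZr (minkC _ (test_variation t x)) O mulr0 add0r => /eqP.
    by rewrite mulf_eq0 (gt_eqF S) orbF => /eqP.
  split=> //; move: kl; rewrite l0 scale0r addr0 => /eqP; rewrite scaler_eq0 => /orP[/eqP //|].
  by move=> /eqP /null_rotation_eq0 /eqP; rewrite (negbTE Fn0).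
Qed.

Lemma test_variation0 x : test_variation 0 x = F x.
Proof. by rewrite /test_variation /null_rotation !mul0r !scale0r addr0 subr0. Qed.

Lemma test_variation_out t x : ~ (a < x < b) -> test_variation t x = F x.
Proof.
by move=> /f0 fx; rewrite /test_variation /null_rotation fx !mulr0 mul0r !scale0r addr0 subr0.
Qed.

Lemma vf0_test_variation (r : R -> R) x :
  vf0 r test_variation x = (r x * f x) *: null_generator p z (F x).
Proof.
have dt := is_derive1M (is_derive1_id (0 : R)) (is_derive1_cst (f x) 0).
pose G := null_generator p z (F x).
have D := vderivZ (is_derive1_cst (r x) (0 : R))
  (vderivB (vderivD (vderiv_cst (F x) (0 : R)) (vderivZ dt (vderiv_cst G 0)))
    (vderivZ (is_derive1M (is_derive1M dt dt) (is_derive1_cst (1 / 2 * mink p (F x)) 0)) (vderiv_cst p 0))).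
transitivity (dmx (fun t => r x *: (F x + t * f x *: G - (t * f x * (t * f x) * (1 / 2 * mink p (F x))) *: p)) 0).
  by [].
rewrite (vderiv_dmx D); apply/matrixP => i j; rewrite !mxE /G /null_generator ?mxE.
by abstract_mink; ring.
Qed.

End NullRotation.

(** The hypothesis provides a factor at each point without regularity. Pairing with en identifies it
    as -1/<G,en>, which is smooth and never zero. *)
Lemma canonical_rescale (R : realType) n (J : set R) s mu (e0 e1 en e2 X G : R -> 'cV[R]_(n.+2)) :
  canonical J s mu e0 e1 en e2 X -> smoothmx J G ->
  (forall x, J x -> exists k, k != 0 /\ e0 x = k *: G x) ->
  exists r, [/\ smooth1 J r, forall x, J x -> r x != 0 & forall x, J x -> e0 x = r x *: G x].
Proof.
move=> can sG e0G; have oJ := can_open can.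
have H x : J x -> mink (G x) (en x) != 0 /\ e0 x = - (mink (G x) (en x))^-1 *: G x.
  move=> Jx; have [k [k0 kE]] := e0G x Jx; have [_ _ _ t0n _] := can_table can Jx.
  rewrite kE minkZl in t0n.
  have m0 : mink (G x) (en x) != 0.
    by apply/eqP => m0; move: t0n; rewrite m0 mulr0 => /eqP; rewrite eq_sym oppr_eq0 oner_eq0.
  split=> //; rewrite kE; congr (_ *: _); apply: (mulIf m0).
  by rewrite t0n mulNr mulVf.
exists (fun x => - (mink (G x) (en x))^-1); split.
- apply: (smooth1N oJ); apply: (smooth1V oJ) => [x /H[]//|].
  exact: (smooth1_mink oJ sG (can_smoothn can)).
- by move=> x /H [m0 _]; rewrite oppr_eq0 invr_neq0.
- by move=> x /H [].
Qed.

(** * Equivalence of stationarity with the two equations *)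

Section MainTheorem.
Variables (R : realType) (n : nat).
Hypothesis n3 : (3 <= n)%N.
Local Notation V := 'cV[R]_(n.+2).
Local Notation ix := (@idx n).
Variables (I : set R) (F : R -> V).
Hypotheses (oI : open I) (gF : one_generic I F).

Let liF : lift_immersion I F. Proof. by case: gF. Qed.

(** Canonical vectors on all of I give the first variation over the whole segment in one stroke. The
    integrand then vanishes point by point: near each point a special frame carries the equations,
    and its EL differs from the global one by a sign. *)
Lemma geodesic_of_equations :
  (forall (J : set R) (e : R -> 'M[R]_(n.+2)), special_third I F J e -> forall x, J x ->
    geodesic_equations I F e x) ->
  conformal_geodesic I F.
Proof.
move=> eqs a b ab abI eps W K eps0 cptK Kab sW liW W0 WK.
have [mu [e0 [e1 [en [e2 [X [can e0F]]]]]]] := canonical_of_generic n3 oI gF.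
pose T := [set` `]- eps, eps[].
have oT : open T by exact: interval_open.
have T0 : T 0 by rewrite /T /= in_itv /= oppr_lt0 eps0.
have liW' t : T t -> lift_immersion I (W t) by rewrite /T /= in_itv; exact: liW.
have [r [sr r0 e0W]] : exists r, [/\ smooth1 I r, forall x, I x -> r x != 0 & forall x, I x -> e0 x = r x *: W 0 x].
  apply: (canonical_rescale can (lift_smooth (liW' 0 T0))) => x Ix.
  have [k [k0 ->]] := e0F x Ix; have [c [c0 ->]] := W0 x Ix.
  by exists (k / c); rewrite scalerA divfK // mulf_neq0 // invr_neq0.
have WK' t x : T t -> I x -> ~ K x -> exists c, W t x = c *: W 0 x.
  move=> Tt Ix nKx; have [c [_ ->]] := WK t x ltac:(by move: Tt; rewrite /T /= in_itv) Ix nKx.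
  have [c' [c'0 ->]] := W0 x Ix.
  by exists (c / c'); rewrite scalerA divfK.
have cK : closed K by apply: compact_closed cptK; exact: order_hausdorff.
have Ka : ~ K a by move=> /Kab; rewrite /= in_itv /= ltxx.
have Kb : ~ K b by move=> /Kab; rewrite /= in_itv /= ltxx andbF.
have := first_variation_integral n3 eps0 oI (@subset_refl _ I) sW liW' can sr r0 e0W ab abI cK Ka Kb WK'.
have -> // : Rintegral lebesgue_measure [set` `[a, b]]
    (fun x => cds I F x / 2 * mink (EL (cds I F) mu e2 X x) (vf0 r W x)) = 0.
rewrite (@eq_Rintegral _ _ _ _ _ (cst 0)).
  by rewrite Rintegral_cst ?mul0r //; exact: measurable_itv.
move=> x; rewrite inE => /abI Ix /=.
have [J' [e [c [st J'x J'I cc [C0 CEL]]]]] := special_of_canonical n3 can (@subset_refl _ I) e0F Ix.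
have sc := smooth1_subset J'I (smooth_cds n3 oI gF).
have pc y (Jy : J' y) := cds_gt0 gF (J'I _ Jy).
have o0 := vf0_orth oT T0 oI (@subset_refl _ I) sW liW' can sr e0W Ix.
have := EL_of_equations n3 st sc pc J'x (eqs J' e st x J'x) (Z := vf0 r W x).
rewrite C0 minkZl o0 mulr0 => /(_ erefl); rewrite CEL minkZl => /eqP.
rewrite mulf_eq0 => /orP[/eqP c0|/eqP ->]; last by rewrite mulr0.
by move: cc; rewrite c0 mul0r => /eqP; rewrite eq_sym oner_eq0.
Qed.

(** One component of EL at one point is tested at a time. The rotation plane is frozen at x0, so
    that the variation is a fixed family of isometries applied with a varying angle. *)
Lemma equations_of_geodesic : conformal_geodesic I F ->
  forall (J : set R) (e : R -> 'M[R]_(n.+2)), special_third I F J e -> forall x, J x ->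
    geodesic_equations I F e x.
Proof.
move=> geo J e st x0 Jx0.
have so : second_order I F J e by case: st.
have JI := second_order_sub so; have ie := second_order_isometry so.
have sc := smooth1_subset JI (smooth_cds n3 oI gF).
have pc y (Jy : J y) := cds_gt0 gF (JI _ Jy).
have can := canonical_of_special n3 st sc pc.
apply: (equations_of_EL n3 st sc pc Jx0) => i i2n.
set s := cds I F in can *; set mu := mu1 I F e in can *.
set E0 := (fun x => col (ix 0) (e x)) in can *; set E2 := (fun x => col (ix 2) (e x)) in can *.
set X := sect e (qX I F e) in can *.
pose z := col i (e x0); pose p := col (ix n.+1) (e x0).
have [h0i _ hni] := frame_table_mid (ltnW n3) so Jx0 i2n.
have [_ _ _ e0p pp] := frame_table (ltnW n3) so Jx0.
have pz : mink p z = 0 by exact: hni.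
have zz : mink z z = 1.
  by rewrite /z isometry_col ?mink_bvec_mid_mid ?eqxx ?mid2 //; exact: ie.
have oJ := can_open can.
have [r [sr r0 e0W]] : exists r, [/\ smooth1 J r, forall x, J x -> r x != 0 & forall x, J x -> E0 x = r x *: F x].
  apply: (canonical_rescale can (smoothmx_subset JI (lift_smooth liF))) => x Jx.
  by case: so => [[_ _ _ /(_ x Jx) [_]]].
(* The integrand of the first variation is f h. At x0 the generator sends e_0 to - e_i, since
   <p,e_0> = -1 and <z,e_0> = 0, so h x0 is - s / 2 times the wanted component of EL. *)
pose h x := s x / 2 * mink (EL s mu E2 X x) (null_generator p z (E0 x)).
have sE0 := can_smooth0 can.
have sgen : smoothmx J (fun x => null_generator p z (E0 x)).
  have c (w : V) := @smoothmx_cst _ _ oJ _ _ w.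
  apply: (smoothmxB oJ); apply: (smoothmxZ oJ); [|exact: c| |exact: c].
    exact: (smooth1_mink oJ (c p) sE0).
  exact: (smooth1_mink oJ (c z) sE0).
have sh : smooth1 J h.
  apply: (smooth1M oJ); last exact: (smooth1_mink oJ (smooth_EL can) sgen).
  by apply: (smooth1M oJ); [exact: sc|exact: smooth1_cst].
suff h0 : h x0 = 0.
  move: h0; rewrite /h /null_generator /E0 (minkC p) e0p (minkC z) h0i scale0r subr0 minkZr.
  move/eqP; rewrite !mulf_eq0 invr_eq0 pnatr_eq0 oppr_eq0 oner_eq0 gt_eqF ?pc //=.
  by move=> /eqP.
apply/eqP/negPn/negP => hx0.
have hh : 0 < h x0 * h x0 by rewrite -expr2 lt0r sqrf_eq0 hx0 sqr_ge0.
(* Multiplying by the constant h x0 treats both signs of h x0 at once. *)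
pose U := [set x | J x /\ 0 < h x0 * h x].
have shh : smooth1 J (fun x => h x0 * h x) by apply: (smooth1M oJ); [exact: smooth1_cst|exact: sh].
have oU : open U by apply: open_setI_gt0 => // x Jx; exact: smooth1_continuous shh Jx.
have [d /= d0 Hd] := (iffLR (nbhs_ballP x0 _)) (open_nbhs_nbhs (conj oU (conj Jx0 hh))).
(* The bump lives on [al, be], which lies in the interior of [a, b] as the compact set of an
   admissible variation must, while h keeps its sign on all of [a, b]. *)
pose a := x0 - d / 2; pose b := x0 + d / 2; pose al := x0 - d / 4; pose be := x0 + d / 4.
have Uab x : a <= x <= b -> U x.
  move=> /andP[xa xb]; apply: Hd; rewrite /ball /= ltr_norml.
  by move: xa xb; rewrite /a /b => xa xb; apply/andP; split; lra.
have abJ : [set` `[a, b]] `<=` J by move=> x; rewrite /= in_itv /= => /Uab [].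
have ab : a <= b by rewrite /a /b; lra.
have albe : al <= be by rewrite /al /be; lra.
have x0in : al < x0 < be by rewrite /al /be; apply/andP; split; lra.
have aal : a < al by rewrite /a /al; lra.
have beb : be < b by rewrite /b /be; lra.
have [f [sf fge fgt fout]] := bump_exists al be.
have albeI : [set` `[al, be]] `<=` I.
  move=> x; rewrite /= in_itv /= => /andP[h1 h2]; apply: JI; apply: abJ.
  by rewrite /= in_itv /=; apply/andP; split; lra.
have [eps eps0 liW] := test_variation_immersion pp zz pz oI liF sf albe albeI fout.
pose W := test_variation p z F f.
pose T := [set` `]- eps, eps[].
have oT : open T by exact: interval_open.
have T0 : T 0 by rewrite /T /= in_itv /= oppr_lt0 eps0.
have liW' t : T t -> lift_immersion I (W t) by rewrite /T /= in_itv; exact: liW.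
have sW i' j' : smooth2 (T `*` I) (fun t x => W t x i' j') := test_variation_smooth p z oI liF sf i' j' oT.
pose K := [set` `[al, be]].
have cptK : compact K by exact: segment_compact.
have Kab : K `<=` [set` `]a, b[].
  by move=> x; rewrite /K /= !in_itv /= => /andP[h1 h2]; apply/andP; split; lra.
have out t x : ~ K x -> W t x = F x.
  move=> nK; apply: (test_variation_out _ _ _ fout) => /andP[h1 h2]; apply: nK.
  by rewrite /K /= in_itv /= !ltW.
have G := geo a b ab (subset_trans abJ JI) eps W K eps0 cptK Kab sW liW
  (fun x _ => ex_intro _ 1 (conj (oner_neq0 R) (etrans (test_variation0 p z F f x) (esym (scale1r (F x))))))
  (fun t x _ _ nK => ex_intro _ 1 (conj (oner_neq0 R) (etrans (out t x nK) (esym (scale1r (F x)))))).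
have e0W' x : J x -> E0 x = r x *: W 0 x by move=> Jx; rewrite e0W // /W test_variation0.
have Ka : ~ K a by rewrite /K /= in_itv /= leNgt aal.
have Kb : ~ K b by rewrite /K /= in_itv /= [b <= be]leNgt beb andbF.
have WK t x : T t -> I x -> ~ K x -> exists c, W t x = c *: W 0 x.
  by move=> _ _ nK; exists 1; rewrite !out // scale1r.
have cK : closed K by exact: interval_closed.
have D := first_variation_integral n3 eps0 oI JI sW liW' can sr r0 e0W' ab abJ cK Ka Kb WK.
have I0 := is_derive1_unique D G.
(* Here [vf0] is r f times the generator applied to F; by linearity the factor r turns F into e_0,
   which leaves f h. *)
have E : Rintegral lebesgue_measure [set` `[a, b]] (fun x => h x0 * (f x * h x)) =
    h x0 * Rintegral lebesgue_measure [set` `[a, b]] (fun x => s x / 2 * mink (EL s mu E2 X x) (vf0 r W x)).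
  rewrite -RintegralZl.
  - apply: eq_Rintegral => x; rewrite inE => /abJ Jx; congr (_ * _).
    rewrite /h /W vf0_test_variation minkZr.
    have -> : mink (EL s mu E2 X x) (null_generator p z (E0 x)) =
       r x * mink (EL s mu E2 X x) (null_generator p z (F x)).
      have ngZ (k : R) w : null_generator p z (k *: w) = k *: null_generator p z w.
        by rewrite /null_generator !minkZr scalerBr !scalerA.
      by rewrite e0W // ngZ minkZr.
    by abstract_mink; ring.
  - exact: measurable_itv.
  - have sv : smoothmx J (fun x => (r x * f x) *: null_generator p z (F x)).
      apply: (smoothmxZ oJ); first by apply: (smooth1M oJ); [exact: sr|exact: smooth1_subset sf].
      have c (w : V) := @smoothmx_cst _ _ oJ _ _ w; have sF := smoothmx_subset JI (lift_smooth liF).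
      apply: (smoothmxB oJ); apply: (smoothmxZ oJ); [|exact: c| |exact: c].
        exact: (smooth1_mink oJ (c p) sF).
      exact: (smooth1_mink oJ (c z) sF).
    have sg : smooth1 J (fun x => s x / 2 * mink (EL s mu E2 X x) ((r x * f x) *: null_generator p z (F x))).
      apply: (smooth1M oJ); last exact: (smooth1_mink oJ (smooth_EL can) sv).
      by apply: (smooth1M oJ); [exact: sc|exact: smooth1_cst].
    apply: continuous_segment_integrable => x xab.
    have Jx : J x by apply: abJ; rewrite /= in_itv.
    have -> : (fun x => s x / 2 * mink (EL s mu E2 X x) (vf0 r W x)) =
      (fun x => s x / 2 * mink (EL s mu E2 X x) ((r x * f x) *: null_generator p z (F x))).
      by apply/funext => y; rewrite vf0_test_variation.
    exact: smooth1_continuous sg Jx.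
have P : 0 < Rintegral lebesgue_measure [set` `[a, b]] (fun x => h x0 * (f x * h x)).
  apply: (@Rintegral_gt0 _ _ _ _ x0).
  - by case/andP: x0in => h1 h2; rewrite (lt_trans aal h1) (lt_trans h2 beb).
  - move=> x xab; have Jx : J x by apply: abJ; rewrite /= in_itv.
    have sg : smooth1 J (fun x => h x0 * (f x * h x)).
      apply: (smooth1M oJ); first exact: smooth1_cst.
      by apply: (smooth1M oJ); [exact: smooth1_subset sf|exact: sh].
    exact: smooth1_continuous sg Jx.
  - by move=> x /Uab [_ hx]; rewrite mulrCA mulr_ge0 // ltW.
  - by rewrite mulrCA mulr_gt0 // fgt.
by move: P; rewrite E I0 mulr0 ltxx.
Qed.

End MainTheorem.

Theorem mainTheorem5 (R : realType) (n : nat) (I : set R)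
    (F : R -> 'cV[R]_(n.+2)) :
  (3 <= n)%N -> open I -> is_interval I -> I !=set0 ->
  one_generic I F ->
  (conformal_geodesic I F <->
   (forall (J : set R) (e : R -> 'M[R]_(n.+2)),
      special_third I F J e -> forall x, J x ->
        dds I F (mu1 I F e) x + 3 / 2 * dds I F (Xnorm2 I F e) x = 0 /\
        sect e (covd I F e (covd I F e (qX I F e))) x
          - (Xnorm2 I F e x + 2 * mu1 I F e x) *: sect e (qX I F e) x = 0)).
Proof.
move=> n3 oI _ _ gF; split.
  exact: equations_of_geodesic.
exact: geodesic_of_equations.
Qed.
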